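(* Let $f(z)=z+\sum_{n\ge 2}a_nz^n$ belong to the class $K$ of normalized close-to-convex functions. (i) If $a_2=0$ then $f'\in H^{1/3}$ and $f\in H^{1/2}$. (ii) If $a_2\ne0$ then $f'\in H^p$ for all $0<p<1/3$ and $f\in H^q$ for all $0<q<1/2$. All four estimates are sharp. That is: in (i), for every $p>1/3$ there exists $f\in K$ with $a_2=0$ and $f'\notin H^p$, and for every $q>1/2$ there exists $f\in K$ with $a_2=0$ and $f\notin H^q$; in (ii), for every $\alpha\in(0,2]$ there exist $f\in K$ with $|a_2|=\alpha$ and $f'\notin H^{1/3}$, and $f\in K$ with $|a_2|=\alpha$ and $f\notin H^{1/2}$.
   Context: $\mathbb{D}$ is the open unit disk. $S$ is the class of univalent (injective holomorphic) functions $f(z)=z+\sum_{n=2}^\infty a_nz^n$ in $\mathbb{D}$; for $f\in S$ one has $|a_2|\le2$. $C\subset S$ consists of those functions whose range is a convex set. $K\subset S$ is the class of close-to-convex functions, i.e. those $f\in S$ for which there exist $g\in C$ and $\lambda\in\mathbb{C}$ with $|\lambda|=1$ such that $\mathrm{Re}\left(\lambda\frac{f'(z)}{g'(z)}\right)>0$ for all $z\in\mathbb{D}$. For $0<p<\infty$ the Hardy space $H^p$ is the set of holomorphic $f$ in $\mathbb{D}$ with $\sup_{r<1}\int_0^{2\pi}|f(re^{i\theta})|^p\,d\theta<\infty$. *)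

(* Defs.v *)
From Stdlib Require Import Reals.
From Coquelicot Require Import Coquelicot.
Open Scope R_scope.

Definition unit_disk (z : C) : Prop := Cmod z < 1.

(* Functions on the disk are total functions C -> C of which only the values
   on the disk matter. *)
Definition holomorphic_on_disk (f : C -> C) : Prop :=
  forall z : C, unit_disk z -> ex_derive f z.

Definition injective_on_disk (f : C -> C) : Prop :=
  forall z w : C, unit_disk z -> unit_disk w -> f z = f w -> z = w.

(* f(z) = z + sum_(n >= 2) a_n z^n on the disk. *)
Definition normalized_expansion (f : C -> C) (a : nat -> C) : Prop :=
  a 0%nat = RtoC 0 /\ a 1%nat = RtoC 1 /\
  forall z : C, unit_disk z -> is_pseries a z (f z).

Definition class_S (f : C -> C) : Prop :=
  holomorphic_on_disk f /\ injective_on_disk f /\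
  exists a : nat -> C, normalized_expansion f a.

Definition image_of_disk (f : C -> C) (w : C) : Prop :=
  exists z : C, unit_disk z /\ f z = w.

Definition convex_set (A : C -> Prop) : Prop :=
  forall (u v : C) (t : R), A u -> A v -> 0 <= t <= 1 ->
    A (RtoC (1 - t) * u + RtoC t * v)%C.

Definition class_C (f : C -> C) : Prop :=
  class_S f /\ convex_set (image_of_disk f).

(* [C_derive] takes a limit along the real direction only; it is the complex
   derivative wherever the latter exists ([C_derive_correct]), hence at every
   point of the disk for the holomorphic functions below. *)
Definition class_K (f : C -> C) : Prop :=
  class_S f /\
  exists (g : C -> C) (lam : C),
    class_C g /\ Cmod lam = 1 /\
    forall z : C, unit_disk z ->
      0 < Re (lam * (C_derive f z / C_derive g z))%C.

(* x^p for x >= 0 and p > 0; [Rpower 0 p] is 1 instead of 0. *)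
Definition pow_nonneg (x p : R) : R :=
  if Rlt_dec 0 x then Rpower x p else 0.

Definition polar (r t : R) : C := (r * cos t, r * sin t).

Definition integral_mean (p : R) (f : C -> C) (r : R) : R :=
  RInt (fun t : R => pow_nonneg (Cmod (f (polar r t))) p) 0 (2 * PI).

(* Finiteness of the supremum is boundedness of the means. For f holomorphic,
   p > 0 and 0 <= r < 1 the integrand is continuous, so that [RInt] is a
   genuine integral. *)
Definition hardy (p : R) (f : C -> C) : Prop :=
  holomorphic_on_disk f /\
  exists M : R, forall r : R, 0 <= r < 1 -> integral_mean p f r <= M.

(* Main.v *)
Require Import Defs.
From Stdlib Require Import Reals Lra Lia Classical ClassicalEpsilon.
From Coquelicot Require Import Coquelicot.
Open Scope R_scope.

(** Write [P = f'/g'], [G = g/z], [Q = z g'/g] and [R = f/g], so that [f' = P Q G] and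
    [f = z R G].  Up to a rotation each factor has nonnegative real part: for [P] this is the
    definition, for [R] it follows by integrating [P] over the preimage under [g] of a segment,
    and for [Q] and [G] it is Schwarz's lemma for the self-maps [g^-1 (t g)] and
    [g^-1 ((1-t) g + t g(a))] of the disk.  A function [E] of positive real part satisfies
    [int |E|^s <= 2 pi |E(0)|^s / cos (s pi/2)] for [s < 1] (take the real part of the mean of
    the holomorphic function [E^s]), and [(x y z)^p <= x^(3p) + y^(3p) + z^(3p)] gives (ii).

    If [a_2 = 0], either [G] is in [H^c] for some [c > 1], which makes up for the loss in the
    exponents, or the image of [g] is a half-plane.  Indeed, if the convex image has two
    supporting lines it lies in a sector, to which the same mean value argument applies, or in a
    strip; if it has only one it is a half-plane.  In the latter case [g = z/(1 - m z)],
    [|m| = 1], and [a_2 = 0] is the equality case of the estimate [|P'(0)| <= 2], whence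
    [f' = 1/(1 - m^2 z^2)] has positive real part.

    The extremal functions are [f' = (s w + (1-s)/w) g'] with [w = (1+z)/(1-z)] and
    [g = (w^gamma - 1)/(2 gamma)], for which [a_2 = gamma + 2 s - 1]. *)

(** A function of positive real part has bounded means of every order below 1, but in general not of
    order 1. The three factors of [f'] and the two factors of [f] thus reach every exponent below
    1/3 and 1/2, but not these values. One factor of order [c > 1] is enough to reach them, since
    the orders demanded of the others then drop strictly below 1. [G] is the factor with room: it
    can fail to have such an order only when the convex image is a half-plane, where
    [G = 1/(1 - m z)]. There the vanishing of [a_2] fixes [P'(0) = - 2 m], of the largest possible
    modulus.

    In the extremal functions [w^gamma] opens a sector of angle [gamma pi], and near [z = 1] the
    function [g'] grows like [w^(gamma+1)], hence [f'] like [w^(gamma+2)] and [f] like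
    [w^(gamma+1)], while the means of [w] itself diverge logarithmically. The weight [s] moves [a_2]
    without changing these orders: [gamma < 1] close to 1 leaves room for a positive [s] with
    [a_2 = 0], and [gamma = 1] gives [a_2 = 2 s] with divergence at the critical exponents. *)

(* Continuity and differentiability of a map [T -> C] with respect to a
   "position" [e : T -> C]; this treats functions of a complex variable
   ([e] the identity), of a real variable ([e] the inclusion) and of two real
   variables ([e] the identification of the plane with [C]) at once. *)
Definition cont {T : Type} (e f : T -> C) (x : T) : Prop :=
  forall eps, 0 < eps -> exists d, 0 < d /\
    forall y, Cmod (e y - e x)%C < d -> Cmod (f y - f x)%C < eps.

(** Carathéodory's form: the difference quotient extends to a slope [phi] continuous at [x]. The
    product, chain and inverse rules become identities between slopes, without dividing by an
    increment. *)
Definition der {T : Type} (e f : T -> C) (x : T) (l : C) : Prop :=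
  exists phi : T -> C, cont e phi x /\ phi x = l /\
    exists d, 0 < d /\ forall y, Cmod (e y - e x)%C < d ->
      f y = (f x + phi y * (e y - e x))%C.

Definition idC (z : C) : C := z.
Notation ccont := (cont idC).
Notation cder := (der idC).

Lemma Cmod_minus_rev (x y : C) : Cmod (x - y)%C = Cmod (y - x)%C.
Proof. rewrite <- Cmod_opp; f_equal; ring. Qed.

Lemma Cmod_triangle_minus (x y : C) : Cmod (x - y)%C <= Cmod x + Cmod y.
Proof. unfold Cminus; rewrite <- (Cmod_opp y); apply Cmod_triangle. Qed.

Lemma Cmod_reverse (x y : C) : Cmod x - Cmod y <= Cmod (x - y)%C.
Proof.
  assert (H := Cmod_triangle (x - y)%C y).
  replace (x - y + y)%C with x in H by ring; lra.
Qed.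

Lemma Cmod_neq_0 (z : C) : 0 < Cmod z -> z <> 0.
Proof. intros H; apply Cmod_gt_0; exact H. Qed.

(** * Rules for continuity and differentiation relative to a position map *)

Section Generic.
Context {T : Type} (e : T -> C).

Lemma cont_const (c : C) x : cont e (fun _ => c) x.
Proof.
  intros eps Heps; exists 1; split; [lra|]; intros y _.
  replace (c - c)%C with (RtoC 0) by ring; rewrite Cmod_0; exact Heps.
Qed.

Lemma cont_pos x : cont e e x.
Proof. intros eps Heps; exists eps; auto. Qed.

Lemma cont_ext_loc f g x d : 0 < d ->
  (forall y, Cmod (e y - e x)%C < d -> f y = g y) -> cont e f x -> cont e g x.
Proof.
  intros Hd Hfg Hf eps Heps; destruct (Hf eps Heps) as [d' [Hd' H]].
  exists (Rmin d d'); split; [apply Rmin_pos; assumption|]; intros y Hy.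
  rewrite <- (Hfg y), <- (Hfg x).
  - apply H; apply Rlt_le_trans with (1 := Hy), Rmin_r.
  - replace (e x - e x)%C with (RtoC 0) by ring; rewrite Cmod_0; exact Hd.
  - apply Rlt_le_trans with (1 := Hy), Rmin_l.
Qed.

Lemma cont_ext f g x : (forall y, f y = g y) -> cont e f x -> cont e g x.
Proof. intros H; apply (cont_ext_loc f g x 1); [lra|intros; apply H]. Qed.

Lemma cont_plus f g x : cont e f x -> cont e g x -> cont e (fun y => f y + g y)%C x.
Proof.
  intros Hf Hg eps Heps.
  destruct (Hf (eps / 2)) as [d1 [Hd1 H1]]; [lra|].
  destruct (Hg (eps / 2)) as [d2 [Hd2 H2]]; [lra|].
  exists (Rmin d1 d2); split; [apply Rmin_pos; assumption|]; intros y Hy.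
  assert (A1 := H1 y (Rlt_le_trans _ _ _ Hy (Rmin_l _ _))).
  assert (A2 := H2 y (Rlt_le_trans _ _ _ Hy (Rmin_r _ _))).
  replace (f y + g y - (f x + g x))%C with ((f y - f x) + (g y - g x))%C by ring.
  apply Rle_lt_trans with (1 := Cmod_triangle _ _); lra.
Qed.

Lemma cont_mult f g x : cont e f x -> cont e g x -> cont e (fun y => f y * g y)%C x.
Proof.
  intros Hf Hg eps Heps.
  set (A := Cmod (f x) + Cmod (g x) + 1).
  assert (HA : 0 < A) by (generalize (Cmod_ge_0 (f x)) (Cmod_ge_0 (g x)); unfold A; lra).
  (* With both increments below [h <= 1], the three products of the expansion sum to at most
     [h * A <= eps / 2]. *)
  set (h := Rmin 1 (eps / (2 * A))).
  assert (Hh : 0 < h).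
  { apply Rmin_pos; [lra|]; apply Rdiv_lt_0_compat; lra. }
  assert (Hh1 : h <= 1) by apply Rmin_l.
  assert (Hh2 : h * (2 * A) <= eps).
  { apply Rle_trans with (eps / (2 * A) * (2 * A)).
    - apply Rmult_le_compat_r; [lra|apply Rmin_r].
    - right; field; lra. }
  destruct (Hf h Hh) as [d1 [Hd1 H1]].
  destruct (Hg h Hh) as [d2 [Hd2 H2]].
  exists (Rmin d1 d2); split; [apply Rmin_pos; assumption|]; intros y Hy.
  assert (A1 := H1 y (Rlt_le_trans _ _ _ Hy (Rmin_l _ _))).
  assert (A2 := H2 y (Rlt_le_trans _ _ _ Hy (Rmin_r _ _))).
  replace (f y * g y - f x * g x)%C
    with ((f y - f x) * (g y - g x) + (f x * (g y - g x) + (f y - f x) * g x))%C by ring.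
  apply Rle_lt_trans with (1 := Cmod_triangle _ _).
  apply Rle_lt_trans with (Cmod (f y - f x)%C * Cmod (g y - g x)%C +
    (Cmod (f x) * Cmod (g y - g x)%C + Cmod (f y - f x)%C * Cmod (g x))).
  - rewrite <- !Cmod_mult; apply Rplus_le_compat_l, Cmod_triangle.
  - generalize (Cmod_ge_0 (f x)) (Cmod_ge_0 (g x)) (Cmod_ge_0 (f y - f x)%C)
      (Cmod_ge_0 (g y - g x)%C); unfold A in *; intros.
    nra.
Qed.

Lemma cont_opp f x : cont e f x -> cont e (fun y => - f y)%C x.
Proof.
  intros Hf; apply cont_ext with (fun y => - (1) * f y)%C; [intros; ring|].
  apply cont_mult; [apply cont_const|exact Hf].
Qed.

Lemma cont_minus f g x : cont e f x -> cont e g x -> cont e (fun y => f y - g y)%C x.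
Proof. intros Hf Hg; apply cont_plus; [|apply cont_opp]; assumption. Qed.

Lemma cont_neq_0 f x : cont e f x -> f x <> 0 ->
  exists d, 0 < d /\ forall y, Cmod (e y - e x)%C < d -> Cmod (f x) / 2 < Cmod (f y).
Proof.
  intros Hf Hx; apply Cmod_gt_0 in Hx.
  destruct (Hf (Cmod (f x) / 2)) as [d [Hd H]]; [lra|].
  exists d; split; [exact Hd|]; intros y Hy.
  assert (A := H y Hy); rewrite Cmod_minus_rev in A.
  assert (B := Cmod_reverse (f x) (f y)); lra.
Qed.

Lemma cont_inv f x : cont e f x -> f x <> 0 -> cont e (fun y => / f y)%C x.
Proof.
  intros Hf Hx.
  destruct (cont_neq_0 f x Hf Hx) as [d0 [Hd0 H0]].
  assert (Hp := Hx); apply Cmod_gt_0 in Hp.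
  intros eps Heps.
  destruct (Hf (eps * (Cmod (f x) * Cmod (f x)) / 2)) as [d [Hd H]].
  { assert (0 < eps * (Cmod (f x) * Cmod (f x))) by (repeat apply Rmult_lt_0_compat; assumption).
    lra. }
  exists (Rmin d0 d); split; [apply Rmin_pos; assumption|]; intros y Hy.
  assert (A0 := H0 y (Rlt_le_trans _ _ _ Hy (Rmin_l _ _))).
  assert (A := H y (Rlt_le_trans _ _ _ Hy (Rmin_r _ _))).
  assert (Hy0 : f y <> 0) by (apply Cmod_neq_0; lra).
  replace (/ f y - / f x)%C with ((f x - f y) / (f y * f x))%C by (field; split; assumption).
  rewrite Cmod_div by (apply Cmult_neq_0; assumption).
  rewrite Cmod_mult, Cmod_minus_rev.
  apply Rmult_lt_reg_r with (Cmod (f y) * Cmod (f x)); [apply Rmult_lt_0_compat; lra|].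
  unfold Rdiv; rewrite Rmult_assoc, Rinv_l by (apply Rgt_not_eq, Rmult_lt_0_compat; lra).
  apply Rlt_trans with (1 := eq_ind_r (fun u => u < _) A (Rmult_1_r _)).
  assert (0 < eps * Cmod (f x)) by (apply Rmult_lt_0_compat; lra).
  nra.
Qed.

Lemma cont_div f g x : cont e f x -> cont e g x -> g x <> 0 ->
  cont e (fun y => f y / g y)%C x.
Proof. intros Hf Hg H; apply cont_mult; [|apply cont_inv]; assumption. Qed.

Lemma cont_pow f x n : cont e f x -> cont e (fun y => f y ^ n)%C x.
Proof.
  intros Hf; induction n as [|n IH]; simpl; [apply cont_const|].
  apply cont_mult; assumption.
Qed.

Lemma cont_comp (g : C -> C) f x : cont e f x -> ccont g (f x) ->
  cont e (fun y => g (f y)) x.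
Proof.
  intros Hf Hg eps Heps; destruct (Hg eps Heps) as [d [Hd H]].
  destruct (Hf d Hd) as [d' [Hd' H']]; exists d'; split; [exact Hd'|].
  intros y Hy; apply H, H', Hy.
Qed.

Lemma der_cont f x l : der e f x l -> cont e f x.
Proof.
  intros [phi [Hphi [_ [d [Hd H]]]]].
  apply cont_ext_loc with (fun y => f x + phi y * (e y - e x))%C d; [exact Hd| |].
  - intros y Hy; symmetry; apply H, Hy.
  - apply cont_plus; [apply cont_const|apply cont_mult; [exact Hphi|]].
    apply cont_minus; [apply cont_pos|apply cont_const].
Qed.

Lemma der_ext_loc f g x l d : 0 < d ->
  (forall y, Cmod (e y - e x)%C < d -> f y = g y) -> der e f x l -> der e g x l.
Proof.
  intros Hd Hfg [phi [Hphi [Hl [d' [Hd' H]]]]]; exists phi; do 2 (split; [assumption|]).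
  exists (Rmin d d'); split; [apply Rmin_pos; assumption|]; intros y Hy.
  rewrite <- (Hfg y), <- (Hfg x).
  - apply H; apply Rlt_le_trans with (1 := Hy), Rmin_r.
  - replace (e x - e x)%C with (RtoC 0) by ring; rewrite Cmod_0; exact Hd.
  - apply Rlt_le_trans with (1 := Hy), Rmin_l.
Qed.

Lemma der_ext f g x l : (forall y, f y = g y) -> der e f x l -> der e g x l.
Proof. intros H; apply (der_ext_loc f g x l 1); [lra|intros; apply H]. Qed.

Lemma der_const (c : C) x : der e (fun _ => c) x 0.
Proof.
  exists (fun _ => RtoC 0); split; [apply cont_const|split; [reflexivity|]].
  exists 1; split; [lra|intros; ring].
Qed.

Lemma der_pos x : der e e x 1.
Proof.
  exists (fun _ => RtoC 1); split; [apply cont_const|split; [reflexivity|]].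
  exists 1; split; [lra|intros; ring].
Qed.

Lemma der_plus f g x l m : der e f x l -> der e g x m ->
  der e (fun y => f y + g y)%C x (l + m)%C.
Proof.
  intros [phi [Hphi [<- [d [Hd H]]]]] [psi [Hpsi [<- [d' [Hd' H']]]]].
  exists (fun y => phi y + psi y)%C; split; [apply cont_plus; assumption|].
  split; [reflexivity|]; exists (Rmin d d'); split; [apply Rmin_pos; assumption|].
  intros y Hy; rewrite (H y), (H' y).
  - ring.
  - apply Rlt_le_trans with (1 := Hy), Rmin_r.
  - apply Rlt_le_trans with (1 := Hy), Rmin_l.
Qed.

Lemma der_mult f g x l m : der e f x l -> der e g x m ->
  der e (fun y => f y * g y)%C x (l * g x + f x * m)%C.
Proof.
  intros Hf Hg; assert (Cg := der_cont _ _ _ Hg).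
  destruct Hf as [phi [Hphi [<- [d [Hd H]]]]], Hg as [psi [Hpsi [<- [d' [Hd' H']]]]].
  exists (fun y => phi y * g y + f x * psi y)%C; split.
  { apply cont_plus; apply cont_mult; try assumption; apply cont_const. }
  split; [reflexivity|]; exists (Rmin d d'); split; [apply Rmin_pos; assumption|].
  intros y Hy; rewrite (H y) by (apply Rlt_le_trans with (1 := Hy), Rmin_l).
  transitivity (f x * g y + phi y * (e y - e x) * g y)%C; [ring|].
  rewrite (H' y) at 1 by (apply Rlt_le_trans with (1 := Hy), Rmin_r).
  ring.
Qed.

Lemma der_scal (c : C) f x l : der e f x l -> der e (fun y => c * f y)%C x (c * l)%C.
Proof.
  intros H; replace (c * l)%C with (0 * f x + c * l)%C by ring.
  apply der_mult; [apply der_const|exact H].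
Qed.

Lemma der_opp f x l : der e f x l -> der e (fun y => - f y)%C x (- l)%C.
Proof.
  intros H; apply der_ext with (fun y => - (1) * f y)%C; [intros; ring|].
  replace (- l)%C with (- (1) * l)%C by ring; apply der_scal, H.
Qed.

Lemma der_minus f g x l m : der e f x l -> der e g x m ->
  der e (fun y => f y - g y)%C x (l - m)%C.
Proof. intros Hf Hg; apply der_plus; [|apply der_opp]; assumption. Qed.

Lemma der_comp (g : C -> C) f x l m : der e f x l -> cder g (f x) m ->
  der e (fun y => g (f y)) x (m * l)%C.
Proof.
  intros Hf Hg; assert (Cf := der_cont _ _ _ Hf).
  destruct Hf as [phi [Hphi [<- [d [Hd H]]]]], Hg as [psi [Hpsi [<- [d' [Hd' H']]]]].
  exists (fun y => psi (f y) * phi y)%C; split.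
  { apply cont_mult; [apply cont_comp; assumption|assumption]. }
  split; [reflexivity|]; destruct (Cf d' Hd') as [d2 [Hd2 H2]].
  exists (Rmin d d2); split; [apply Rmin_pos; assumption|]; intros y Hy.
  rewrite (H' (f y)) by (apply H2, Rlt_le_trans with (1 := Hy), Rmin_r).
  unfold idC.
  replace (f y - f x)%C with (phi y * (e y - e x))%C; [ring|].
  rewrite (H y) by (apply Rlt_le_trans with (1 := Hy), Rmin_l); ring.
Qed.

End Generic.

(** * Inverses, quotients and powers *)

Lemma cder_inv_id (z : C) : z <> 0 -> cder (fun w => / w)%C z (- / (z * z))%C.
Proof.
  intros Hz; exists (fun w => - / (z * w))%C; split; [|split; [reflexivity|]].
  { apply cont_opp, cont_inv; [|apply Cmult_neq_0; assumption].
    apply cont_mult; [apply cont_const|apply cont_pos]. }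
  exists (Cmod z); split; [apply Cmod_gt_0, Hz|]; intros w Hw.
  assert (Hw0 : w <> 0).
  { intros ->; unfold idC in Hw; rewrite Cmod_minus_rev in Hw.
    replace (z - 0)%C with z in Hw by ring; lra. }
  unfold idC; field; split; assumption.
Qed.

Lemma der_inv {T} (e : T -> C) f x l : der e f x l -> f x <> 0 ->
  der e (fun y => / f y)%C x (- l / (f x * f x))%C.
Proof.
  intros Hf H0.
  replace (- l / (f x * f x))%C with (- / (f x * f x) * l)%C by (field; assumption).
  apply der_comp with (g := Cinv); [exact Hf|apply cder_inv_id, H0].
Qed.

Lemma der_div {T} (e : T -> C) f g x l m : der e f x l -> der e g x m -> g x <> 0 ->
  der e (fun y => f y / g y)%C x ((l * g x - f x * m) / (g x * g x))%C.
Proof.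
  intros Hf Hg H0.
  replace ((l * g x - f x * m) / (g x * g x))%C
    with (l * / g x + f x * (- m / (g x * g x)))%C by (field; assumption).
  apply (der_mult e f (fun y => / g y)%C); [exact Hf|apply der_inv; assumption].
Qed.

Lemma der_pow {T} (e : T -> C) f x l n : der e f x l ->
  der e (fun y => f y ^ n)%C x (RtoC (INR n) * f x ^ (pred n) * l)%C.
Proof.
  intros Hf; induction n as [|n IH].
  - replace (RtoC (INR 0) * f x ^ Nat.pred 0 * l)%C with (RtoC 0) by (simpl; ring).
    apply (der_const e 1%C).
  - replace (RtoC (INR (S n)) * f x ^ pred (S n) * l)%C
      with (l * f x ^ n + f x * (RtoC (INR n) * f x ^ (pred n) * l))%C.
    + apply (der_mult e f (fun y => f y ^ n)%C); assumption.
    + rewrite S_INR, RtoC_plus; destruct n; simpl; ring.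
Qed.

Lemma der_eq {T} (e : T -> C) f x l l' : der e f x l -> l = l' -> der e f x l'.
Proof. intros H <-; exact H. Qed.

(** If [phi] is the slope of [f] at [g w], then [1 / phi (g u)] is the slope of [g] at [w]; it is
    continuous as soon as [g] is. *)
Lemma cder_inverse (f g : C -> C) (w m : C) d : 0 < d ->
  (forall u, Cmod (u - w)%C < d -> f (g u) = u) -> ccont g w ->
  cder f (g w) m -> m <> 0 -> cder g w (/ m)%C.
Proof.
  intros Hd Hfg Hg [phi [Hphi [<- [d' [Hd' H]]]]] Hm.
  exists (fun u => / phi (g u))%C; split; [|split; [reflexivity|]].
  { apply cont_inv; [apply cont_comp; assumption|exact Hm]. }
  destruct (cont_neq_0 idC (fun u => phi (g u)) w) as [d2 [Hd2 H2]];
    [apply cont_comp; assumption|exact Hm|].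
  destruct (Hg d' Hd') as [d3 [Hd3 H3]].
  exists (Rmin d (Rmin d2 d3)); split; [repeat apply Rmin_pos; assumption|]; intros u Hu.
  assert (Hu1 := Rlt_le_trans _ _ _ Hu (Rmin_l _ _)).
  assert (Hu2 := Rlt_le_trans _ _ _ Hu (Rle_trans _ _ _ (Rmin_r _ _) (Rmin_l _ _))).
  assert (Hu3 := Rlt_le_trans _ _ _ Hu (Rle_trans _ _ _ (Rmin_r _ _) (Rmin_r _ _))).
  assert (A := H _ (H3 _ Hu3)); unfold idC in *.
  rewrite (Hfg u Hu1), (Hfg w) in A.
  2: { replace (w - w)%C with (RtoC 0) by ring; rewrite Cmod_0; exact Hd. }
  assert (B : phi (g u) <> 0).
  { apply Cmod_neq_0; apply Cmod_gt_0 in Hm; assert (C1 := H2 u Hu2); lra. }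
  replace (u - w)%C with (phi (g u) * (g u - g w))%C; [field; exact B|].
  transitivity (w + phi (g u) * (g u - g w) - w)%C; [ring|rewrite <- A; reflexivity].
Qed.

(** Translation to the filter-based derivative behind [holomorphic_on_disk]; it also gives access to
    the value of [C_derive]. Backwards, the slope is the difference quotient completed by [l] at
    [z]. *)
Lemma cder_is_derive (f : C -> C) (z l : C) :
  cder f z l <-> @is_derive C_AbsRing C_NormedModule f z l.
Proof.
  split.
  - intros [phi [Hphi [Hl [d [Hd H]]]]].
    split; [apply is_linear_scal_l|].
    intros x Hx eps.
    assert (E : z = x) by (apply (is_filter_lim_locally_unique (V := AbsRing_NormedModule C_AbsRing) z x), Hx); subst x.
    destruct (Hphi eps (cond_pos eps)) as [d' [Hd' H']].
    assert (Hm : 0 < Rmin d d') by (apply Rmin_pos; assumption).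
    apply (locally_le_locally_norm (V := AbsRing_NormedModule C_AbsRing)).
    exists (mkposreal _ Hm); intros y Hy.
    change (Cmod (y - z)%C < Rmin d d') in Hy.
    change (Cmod (f y - f z - (y - z) * l)%C <= eps * Cmod (y - z)%C).
    rewrite (H y) by (apply Rlt_le_trans with (1 := Hy), Rmin_l).
    unfold idC; subst l.
    replace (f z + phi y * (y - z) - f z - (y - z) * phi z)%C
      with ((phi y - phi z) * (y - z))%C by ring.
    rewrite Cmod_mult; apply Rmult_le_compat_r; [apply Cmod_ge_0|].
    left; apply H', Rlt_le_trans with (1 := Hy), Rmin_r.
  - intros [_ H]; specialize (H z (fun P HP => HP)).
    exists (fun w => match Ceq_dec w z with left _ => l | right _ => ((f w - f z) / (w - z))%C end).
    split; [|split].
    + intros eps Heps.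
      assert (He2 : 0 < eps / 2) by lra.
      specialize (H (mkposreal _ He2)).
      apply (locally_norm_le_locally (V := AbsRing_NormedModule C_AbsRing)) in H.
      destruct H as [d Hd]; exists d; split; [apply cond_pos|].
      intros w Hw; specialize (Hd w Hw); unfold idC in Hw.
      change (Cmod (f w - f z - (w - z) * l)%C <= eps / 2 * Cmod (w - z)%C) in Hd.
      destruct (Ceq_dec z z) as [_|N]; [|congruence].
      destruct (Ceq_dec w z) as [_|N].
      * replace (l - l)%C with (RtoC 0) by ring; rewrite Cmod_0; exact Heps.
      * assert (N' : (w - z)%C <> 0).
        { intros E; apply N; replace w with ((w - z) + z)%C by ring; rewrite E; ring. }
        replace ((f w - f z) / (w - z) - l)%C
          with ((f w - f z - (w - z) * l) / (w - z))%C by (field; exact N').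
        rewrite Cmod_div by exact N'.
        apply Cmod_gt_0 in N'.
        apply Rle_lt_trans with (eps / 2); [|lra].
        apply Rmult_le_reg_r with (Cmod (w - z)%C); [exact N'|].
        unfold Rdiv at 1; rewrite Rmult_assoc, Rinv_l by lra; lra.
    + destruct (Ceq_dec z z); congruence.
    + exists 1; split; [lra|]; intros w _; unfold idC.
      destruct (Ceq_dec w z) as [->|N]; [ring|].
      field; intros E; apply N; replace w with ((w - z) + z)%C by ring; rewrite E; ring.
Qed.

Lemma cder_C_derive (f : C -> C) (z l : C) : cder f z l -> C_derive f z = l.
Proof. intros H; apply is_C_derive_unique, cder_is_derive, H. Qed.

Lemma cont_Cmod {T} (e f : T -> C) x : cont e f x -> cont e (fun y => RtoC (Cmod (f y))) x.
Proof.
  intros H eps Heps; destruct (H eps Heps) as [d [Hd H']]; exists d; split; [exact Hd|].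
  intros y Hy; rewrite <- RtoC_minus, Cmod_R; apply Rle_lt_trans with (2 := H' y Hy).
  apply Rabs_le; split; [|apply Cmod_reverse].
  rewrite Cmod_minus_rev; generalize (Cmod_reverse (f x) (f y)); lra.
Qed.

Lemma RtoC_neq_0 x : x <> 0 -> RtoC x <> 0.
Proof. intros H E; apply H; injection E; auto. Qed.

Lemma Cmod_div_le_1 (a b : C) : b <> 0 -> Cmod a ^ 2 <= Cmod b ^ 2 -> Cmod (a / b)%C <= 1.
Proof.
  intros N H; rewrite Cmod_div by exact N; apply Cmod_gt_0 in N.
  apply Rmult_le_reg_r with (1 := N).
  unfold Rdiv; rewrite Rmult_assoc, Rinv_l, Rmult_1_r, Rmult_1_l by lra.
  apply Rnot_lt_le; intros L; generalize (Cmod_ge_0 b); nra.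
Qed.

Lemma Cmod_div_lt_1 (a b : C) : b <> 0 -> Cmod a ^ 2 < Cmod b ^ 2 -> Cmod (a / b)%C < 1.
Proof.
  intros N H; rewrite Cmod_div by exact N; apply Cmod_gt_0 in N.
  apply Rmult_lt_reg_r with (1 := N).
  unfold Rdiv; rewrite Rmult_assoc, Rinv_l, Rmult_1_r, Rmult_1_l by lra.
  apply Rnot_le_lt; intros L; generalize (Cmod_ge_0 b); nra.
Qed.

Lemma Cmod_Re_Im (z : C) : Cmod z <= Rabs (Re z) + Rabs (Im z).
Proof.
  replace z with (RtoC (Re z) + Ci * RtoC (Im z))%C at 1.
  2: { apply injective_projections; simpl; unfold Re, Im; ring. }
  apply Rle_trans with (1 := Cmod_triangle _ _).
  rewrite Cmod_mult, !Cmod_R, Cmod_Ci; lra.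
Qed.

Lemma Im_le_Cmod (z : C) : Rabs (Im z) <= Cmod z.
Proof. apply Rle_trans with (2 := Rmax_Cmod z), Rmax_r. Qed.

Lemma Re_le_Cmod (z : C) : Re z <= Cmod z.
Proof. apply Rle_trans with (2 := re_le_Cmod z), Rle_abs. Qed.

Lemma Im_Re (z : C) : Im z = Re (- Ci * z)%C.
Proof. unfold Re, Im; simpl; ring. Qed.

Lemma Re_minus (a b : C) : Re (a - b)%C = Re a - Re b.
Proof. unfold Re; simpl; ring. Qed.

Lemma Im_minus (a b : C) : Im (a - b)%C = Im a - Im b.
Proof. unfold Im; simpl; ring. Qed.

(** * Functions of one and two real variables *)

Definition plane (p : R * R) : C := p.
Notation rcont := (cont RtoC).
Notation rder := (der RtoC).

Lemma rcont_Re h t : rcont h t -> continuity_pt (fun s => Re (h s)) t.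
Proof.
  intros H eps Heps; destruct (H eps Heps) as [d [Hd H']].
  exists d; split; [exact Hd|]; intros s [_ Hs]; simpl in *; unfold R_dist in *.
  rewrite <- Re_minus; apply Rle_lt_trans with (1 := re_le_Cmod _).
  apply H'; rewrite <- RtoC_minus, Cmod_R; exact Hs.
Qed.

Lemma continuity_rcont h t : continuity_pt h t -> rcont (fun s => RtoC (h s)) t.
Proof.
  intros H eps Heps; destruct (H eps Heps) as [d [Hd H']].
  exists d; split; [exact Hd|]; intros s Hs; rewrite <- RtoC_minus, Cmod_R in *.
  destruct (Req_dec t s) as [->|N].
  - rewrite Rminus_diag, Rabs_R0; exact Heps.
  - apply H'; split; [split; [exact I|exact N]|exact Hs].
Qed.

Lemma rcont_pair (f g : R -> R) t : rcont (fun s => RtoC (f s)) t -> rcont (fun s => RtoC (g s)) t ->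
  rcont (fun s => (f s, g s)) t.
Proof.
  intros Hf Hg; apply cont_ext with (fun s => RtoC (f s) + Ci * RtoC (g s))%C.
  - intros s; apply injective_projections; simpl; ring.
  - apply cont_plus; [exact Hf|apply cont_mult; [apply cont_const|exact Hg]].
Qed.

Lemma plane_cont_Re h s t : cont plane h (s, t) ->
  continuity_2d_pt (fun u v => Re (h (u, v))) s t.
Proof.
  intros H eps; destruct (H eps (cond_pos eps)) as [d [Hd H']].
  assert (Hd2 : 0 < d / 2) by lra.
  exists (mkposreal _ Hd2); intros u v Hu Hv; simpl in Hu, Hv.
  rewrite <- Re_minus; apply Rle_lt_trans with (1 := re_le_Cmod _), H'.
  apply Rle_lt_trans with (1 := Cmod_Re_Im _); unfold plane; simpl; unfold Rminus in *; lra.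
Qed.

Lemma rder_Re h t l : rder h t l -> is_derive (fun s => Re (h s)) t (Re l).
Proof.
  intros [phi [Hphi [Hl [d [Hd H]]]]]; apply is_derive_Reals.
  intros eps Heps; destruct (Hphi eps Heps) as [d' [Hd' H']].
  exists (mkposreal _ (Rmin_pos _ _ Hd Hd')); simpl; intros k Hk Hkd.
  assert (Hk' : Cmod (RtoC (t + k) - RtoC t)%C = Rabs k).
  { rewrite <- RtoC_minus, Cmod_R; f_equal; ring. }
  rewrite (H (t + k)).
  2: { rewrite Hk'; apply Rlt_le_trans with (1 := Hkd), Rmin_l. }
  replace ((Re (h t + phi (t + k)%R * (RtoC (t + k) - RtoC t))%C - Re (h t)) / k - Re l)
    with (Re (phi (t + k)%R - phi t)%C).
  2: { rewrite Hl; unfold Re; simpl; field; exact Hk. }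
  apply Rle_lt_trans with (1 := re_le_Cmod _), H'.
  rewrite Hk'; apply Rlt_le_trans with (1 := Hkd), Rmin_r.
Qed.

Lemma is_derive_rder (f : R -> R) (t l : R) : is_derive f t l -> rder (fun s => RtoC (f s)) t (RtoC l).
Proof.
  intros H; apply is_derive_Reals in H.
  exists (fun s => if Req_EM_T s t then RtoC l else RtoC ((f s - f t) / (s - t))).
  split; [|split].
  - intros eps Heps; destruct (H eps Heps) as [d Hd].
    exists d; split; [apply cond_pos|]; intros s Hs.
    destruct (Req_EM_T t t) as [_|N]; [|congruence].
    rewrite <- RtoC_minus, Cmod_R in Hs.
    destruct (Req_EM_T s t) as [_|N].
    + replace (RtoC l - RtoC l)%C with (RtoC 0) by ring; rewrite Cmod_0; exact Heps.
    + rewrite <- RtoC_minus, Cmod_R.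
      assert (N' : s - t <> 0) by lra.
      specialize (Hd (s - t) N' Hs); replace (t + (s - t)) with s in Hd by ring; exact Hd.
  - destruct (Req_EM_T t t); congruence.
  - exists 1; split; [lra|]; intros s _.
    destruct (Req_EM_T s t) as [->|N]; [ring|].
    rewrite <- RtoC_minus, <- RtoC_mult, <- RtoC_plus; f_equal; field; lra.
Qed.

Lemma rder_pair (f g : R -> R) (t l m : R) : is_derive f t l -> is_derive g t m ->
  rder (fun s => (f s, g s)) t (l, m).
Proof.
  intros Hf Hg; apply der_ext with (fun s => RtoC (f s) + Ci * RtoC (g s))%C.
  - intros s; apply injective_projections; simpl; ring.
  - apply der_eq with (RtoC l + Ci * RtoC m)%C.
    + apply der_plus; [|apply der_scal]; apply is_derive_rder; assumption.
    + apply injective_projections; simpl; ring.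
Qed.

(** Change of position map: it covers inner maps that do not land in [C], such as a projection of
    the plane or the inclusion of a line into it. *)
Lemma cont_pullback {T U} (e : T -> C) (e' : U -> C) (k : T -> U) (f : U -> C) x :
  cont e (fun y => e' (k y)) x -> cont e' f (k x) -> cont e (fun y => f (k y)) x.
Proof.
  intros Hk Hf eps Heps; destruct (Hf eps Heps) as [d [Hd H]].
  destruct (Hk d Hd) as [d' [Hd' H']]; exists d'; split; [exact Hd'|].
  intros y Hy; apply H, H', Hy.
Qed.

(** * Circles and integrals over a full turn *)

Definition eit (t : R) : C := (cos t, sin t).

Lemma polar_eit r t : polar r t = (RtoC r * eit t)%C.
Proof. apply injective_projections; simpl; ring. Qed.

Lemma Cmod_eit t : Cmod (eit t) = 1.
Proof.
  unfold Cmod, eit; simpl; rewrite !Rmult_1_r, Rplus_comm.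
  fold (Rsqr (cos t)) (Rsqr (sin t)); rewrite sin2_cos2; apply sqrt_1.
Qed.

Lemma rder_eit t : rder eit t (Ci * eit t)%C.
Proof.
  apply der_eq with (- sin t, cos t).
  - apply rder_pair; [apply is_derive_cos|apply is_derive_sin].
  - apply injective_projections; simpl; ring.
Qed.

Lemma rcont_eit t : rcont eit t.
Proof. exact (der_cont _ _ _ _ (rder_eit t)). Qed.

Lemma eit_2PI : eit (2 * PI) = eit 0.
Proof. unfold eit; rewrite cos_2PI, sin_2PI, cos_0, sin_0; reflexivity. Qed.

Lemma two_pi_pos : 0 < 2 * PI.
Proof. generalize PI_RGT_0; lra. Qed.

Lemma rcont_ex_RInt h a b : (forall t, rcont h t) -> ex_RInt (fun t => Re (h t)) a b.
Proof.
  intros H; apply (ex_RInt_continuous (V := R_CompleteNormedModule)); intros t _.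
  apply continuity_pt_filterlim, rcont_Re, H.
Qed.

Lemma rcont_ex_RInt_Cmod h a b : (forall t, rcont h t) -> ex_RInt (fun t => Cmod (h t)) a b.
Proof.
  intros H; apply (rcont_ex_RInt (fun t => RtoC (Cmod (h t)))); intros t; apply cont_Cmod, H.
Qed.

Definition cint (h : R -> C) : C :=
  (RInt (fun t => Re (h t)) 0 (2 * PI), RInt (fun t => Im (h t)) 0 (2 * PI)).

Lemma rcont_scal c h t : rcont h t -> rcont (fun s => c * h s)%C t.
Proof. intros H; apply cont_mult; [apply cont_const|exact H]. Qed.

Lemma rcont_ex_RInt_Im h a b : (forall t, rcont h t) -> ex_RInt (fun t => Im (h t)) a b.
Proof.
  intros H; apply ex_RInt_ext with (fun t => Re (- Ci * h t)%C).
  - intros; symmetry; apply Im_Re.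
  - apply rcont_ex_RInt; intros; apply rcont_scal, H.
Qed.

Lemma cint_ext f g : (forall t, f t = g t) -> cint f = cint g.
Proof. intros H; unfold cint; f_equal; apply RInt_ext; intros; rewrite H; reflexivity. Qed.

Lemma RInt_lin (f g : R -> R) a b x y : ex_RInt f a b -> ex_RInt g a b ->
  RInt (fun t => x * f t + y * g t) a b = x * RInt f a b + y * RInt g a b.
Proof.
  intros Hf Hg.
  assert (Sf := ex_RInt_scal (V := R_NormedModule) f a b x Hf).
  assert (Sg := ex_RInt_scal (V := R_NormedModule) g a b y Hg).
  etransitivity; [exact (RInt_plus (V := R_CompleteNormedModule) _ _ a b Sf Sg)|].
  exact (f_equal2 Rplus (RInt_scal (V := R_CompleteNormedModule) f a b x Hf)
    (RInt_scal (V := R_CompleteNormedModule) g a b y Hg)).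
Qed.

Lemma cint_scal c h : (forall t, rcont h t) -> cint (fun t => c * h t)%C = (c * cint h)%C.
Proof.
  intros H; unfold cint, Cmult at 3; cbn [fst snd]; f_equal.
  - rewrite (RInt_ext _ (fun t => Re c * Re (h t) + (- Im c) * Im (h t)))
      by (intros; unfold Re, Im; simpl; ring).
    rewrite (RInt_lin (fun t => Re (h t)) (fun t => Im (h t)));
      [|apply (rcont_ex_RInt h), H|apply (rcont_ex_RInt_Im h), H].
    unfold Rminus; rewrite Ropp_mult_distr_l; reflexivity.
  - rewrite (RInt_ext _ (fun t => Re c * Im (h t) + Im c * Re (h t)))
      by (intros; unfold Re, Im; simpl; ring).
    rewrite (RInt_lin (fun t => Im (h t)) (fun t => Re (h t)));
      [reflexivity|apply (rcont_ex_RInt_Im h), H|apply (rcont_ex_RInt h), H].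
Qed.

Lemma cint_plus f g : (forall t, rcont f t) -> (forall t, rcont g t) ->
  cint (fun t => f t + g t)%C = (cint f + cint g)%C.
Proof.
  intros Hf Hg; unfold cint, Cplus at 3; cbn [fst snd]; f_equal.
  - rewrite (RInt_ext _ (fun t => 1 * Re (f t) + 1 * Re (g t))) by (intros; unfold Re; simpl; ring).
    rewrite (RInt_lin (fun t => Re (f t)) (fun t => Re (g t)));
      [rewrite !Rmult_1_l; reflexivity|apply (rcont_ex_RInt f), Hf|apply (rcont_ex_RInt g), Hg].
  - rewrite (RInt_ext _ (fun t => 1 * Im (f t) + 1 * Im (g t))) by (intros; unfold Im; simpl; ring).
    rewrite (RInt_lin (fun t => Im (f t)) (fun t => Im (g t)));
      [rewrite !Rmult_1_l; reflexivity|apply (rcont_ex_RInt_Im f), Hf|apply (rcont_ex_RInt_Im g), Hg].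
Qed.

Lemma RInt_const_R (a b c : R) : @eq R (RInt (fun _ : R => c) a b) ((b - a) * c).
Proof. rewrite RInt_const; reflexivity. Qed.

Lemma cint_const c : cint (fun _ => c) = (RtoC (2 * PI) * c)%C.
Proof.
  apply injective_projections; simpl; rewrite RInt_const_R; unfold Re, Im; ring.
Qed.

Lemma cint_minus f g : (forall t, rcont f t) -> (forall t, rcont g t) ->
  cint (fun t => f t - g t)%C = (cint f - cint g)%C.
Proof.
  intros Hf Hg; rewrite (cint_ext _ (fun t => f t + - (1) * g t)%C) by (intros; ring).
  rewrite cint_plus, cint_scal; [ring|assumption|assumption|intros; apply rcont_scal, Hg].
Qed.

(** Multiplying [h] by a unimodular [u] turns the integral into its modulus, a real number; what
    remains is the comparison of the real integrands [Re (u * h)] and [|h|]. *)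
Lemma Cmod_cint_le h : (forall t, rcont h t) ->
  Cmod (cint h) <= RInt (fun t => Cmod (h t)) 0 (2 * PI).
Proof.
  intros H.
  assert (Hex : ex_RInt (fun t => Cmod (h t)) 0 (2 * PI))
    by apply rcont_ex_RInt_Cmod, H.
  destruct (Ceq_dec (cint h) 0) as [E|N].
  - rewrite E, Cmod_0; apply RInt_ge_0; [left; apply two_pi_pos|exact Hex|intros; apply Cmod_ge_0].
  - assert (Hp := proj1 (Cmod_gt_0 _) N).
    set (u := (Cconj (cint h) / RtoC (Cmod (cint h)))%C).
    assert (Hu : Cmod u = 1).
    { unfold u; rewrite Cmod_div by (apply RtoC_neq_0; lra).
      rewrite Cmod_conj, Cmod_R, Rabs_pos_eq by lra; field; lra. }
    replace (Cmod (cint h)) with (Re (cint (fun t => u * h t)%C)).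
    + apply RInt_le; [left; apply two_pi_pos| |exact Hex|].
      * apply (rcont_ex_RInt (fun t => u * h t)%C); intros; apply rcont_scal, H.
      * intros t _; apply Rle_trans with (1 := Re_le_Cmod _).
        rewrite Cmod_mult, Hu; lra.
    + rewrite cint_scal by exact H; unfold u.
      replace (Cconj (cint h) / RtoC (Cmod (cint h)) * cint h)%C
        with (cint h * Cconj (cint h) / RtoC (Cmod (cint h)))%C
        by (field; apply RtoC_neq_0; lra).
      rewrite <- Cmod2_conj, <- RtoC_div by lra.
      rewrite re_RtoC; field; lra.
Qed.

Lemma Cmod_cint_le_const h M : (forall t, rcont h t) -> (forall t, Cmod (h t) <= M) ->
  Cmod (cint h) <= 2 * PI * M.
Proof.
  intros H HM; apply Rle_trans with (1 := Cmod_cint_le h H).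
  replace (2 * PI * M) with ((2 * PI - 0) * M) by ring; rewrite <- RInt_const_R.
  apply RInt_le; [left; apply two_pi_pos| |apply ex_RInt_const|intros; apply HM].
  apply rcont_ex_RInt_Cmod, H.
Qed.

Lemma rder_affine (c d : C) s : rder (fun s => c + RtoC s * d)%C s d.
Proof.
  apply der_eq with (0 + (1 * d + RtoC s * 0))%C; [|ring].
  apply der_plus; [apply der_const|].
  apply (der_mult RtoC RtoC (fun _ => d)); [apply der_pos|apply der_const].
Qed.

(** * Deformation of circles and the Cauchy formula *)

Section Deform.
Variables (F F' : C -> C) (c0 c1 : C) (r0 r1 a b : R).

(** A family of circles whose centre and radius are both affine in [s]: it contains concentric
    circles as well as circles contracting to an interior point. [Phi] is [F] times the
    [t]-derivative of [Z] divided by [Ci], so its integral over [t] is, up to that factor, the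
    contour integral of [F]. [DPhi] is the [s]-derivative of [Phi]. *)
Let Z (s t : R) : C := (c0 + RtoC s * c1 + (RtoC r0 + RtoC s * RtoC r1) * eit t)%C.
Let Phi (s t : R) : C := (F (Z s t) * ((RtoC r0 + RtoC s * RtoC r1) * eit t))%C.
Let DPhi (s t : R) : C :=
  (F' (Z s t) * (c1 + RtoC r1 * eit t) * ((RtoC r0 + RtoC s * RtoC r1) * eit t)
   + F (Z s t) * (RtoC r1 * eit t))%C.

Hypothesis HF : forall s t, a < s < b ->
  cder F (Z s t) (F' (Z s t)) /\ ccont F' (Z s t).

Lemma deform_der_s s t : a < s < b -> rder (fun s => Phi s t) s (DPhi s t).
Proof.
  intros Hs; destruct (HF s t Hs) as [H1 _].
  assert (A : rder (fun s => RtoC r0 + RtoC s * RtoC r1)%C s (RtoC r1))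
    by apply rder_affine.
  assert (B : rder (fun s => (RtoC r0 + RtoC s * RtoC r1) * eit t)%C s (RtoC r1 * eit t)%C).
  { apply der_eq with (RtoC r1 * eit t + (RtoC r0 + RtoC s * RtoC r1) * 0)%C; [|ring].
    apply (der_mult RtoC (fun s => RtoC r0 + RtoC s * RtoC r1)%C (fun _ => eit t)); [exact A|apply der_const]. }
  assert (D : rder (fun s => Z s t) s (c1 + RtoC r1 * eit t)%C).
  { unfold Z; apply der_plus; [apply rder_affine|exact B]. }
  apply (der_mult RtoC (fun s => F (Z s t)) (fun s => (RtoC r0 + RtoC s * RtoC r1) * eit t)%C); [|exact B].
  apply (der_comp RtoC F (fun s => Z s t)); assumption.
Qed.

(* The [s]-derivative of the integrand is an exact [t]-derivative. *)
Lemma deform_der_t s t : a < s < b ->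
  rder (fun t => - Ci * (F (Z s t) * (c1 + RtoC r1 * eit t)))%C t (DPhi s t).
Proof.
  intros Hs; destruct (HF s t Hs) as [H1 _].
  set (rho := (RtoC r0 + RtoC s * RtoC r1)%C).
  assert (D : rder (fun t => Z s t) t (rho * (Ci * eit t))%C).
  { unfold Z; fold rho; apply der_eq with (0 + rho * (Ci * eit t))%C; [|ring].
    apply der_plus; [apply der_const|apply der_scal, rder_eit]. }
  apply der_eq with (- Ci * (F' (Z s t) * (rho * (Ci * eit t)) * (c1 + RtoC r1 * eit t)
    + F (Z s t) * (RtoC r1 * (Ci * eit t))))%C.
  - apply der_scal, (der_mult RtoC (fun t => F (Z s t)) (fun t => c1 + RtoC r1 * eit t)%C).
    + apply (der_comp RtoC F (fun t => Z s t)); assumption.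
    + apply der_eq with (0 + RtoC r1 * (Ci * eit t))%C; [|ring].
      apply der_plus; [apply der_const|apply der_scal, rder_eit].
  - unfold DPhi; fold rho.
    transitivity ((- (Ci * Ci)) * (F' (Z s t) * (c1 + RtoC r1 * eit t) * (rho * eit t)
      + F (Z s t) * (RtoC r1 * eit t)))%C; [ring|].
    replace (- (Ci * Ci))%C with (RtoC 1) by (apply injective_projections; simpl; ring).
    ring.
Qed.

Lemma plane_fst p : cont plane (fun p => RtoC (fst p)) p.
Proof.
  intros eps Heps; exists eps; split; [exact Heps|]; intros y Hy.
  rewrite <- RtoC_minus, Cmod_R; apply Rle_lt_trans with (2 := Hy).
  exact (re_le_Cmod (plane y - plane p)%C).
Qed.

Lemma plane_snd p : cont plane (fun p => RtoC (snd p)) p.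
Proof.
  intros eps Heps; exists eps; split; [exact Heps|]; intros y Hy.
  rewrite <- RtoC_minus, Cmod_R; apply Rle_lt_trans with (2 := Hy).
  exact (Im_le_Cmod (plane y - plane p)%C).
Qed.

Lemma deform_cont s t : a < s < b -> cont plane (fun p => DPhi (fst p) (snd p)) (s, t).
Proof.
  intros Hs; destruct (HF s t Hs) as [H1 H2].
  assert (E : cont plane (fun p => eit (snd p)) (s, t)).
  { apply (cont_pullback plane RtoC snd eit); [apply plane_snd|apply rcont_eit]. }
  assert (K : forall c, cont plane (fun _ : R * R => c) (s, t)) by (intros; apply cont_const).
  assert (Q : cont plane (fun p => (RtoC r0 + RtoC (fst p) * RtoC r1) * eit (snd p))%C (s, t)).
  { repeat (apply cont_mult || apply cont_plus); try apply plane_fst; try apply K; exact E. }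
  assert (D : cont plane (fun p => Z (fst p) (snd p)) (s, t)).
  { apply cont_plus; [|exact Q].
    repeat (apply cont_mult || apply cont_plus); try apply plane_fst; apply K. }
  unfold DPhi; apply cont_plus; apply cont_mult; try exact Q.
  - apply cont_mult.
    + apply (cont_comp plane F' (fun p => Z (fst p) (snd p))); assumption.
    + apply cont_plus; [apply K|apply cont_mult; [apply K|exact E]].
  - apply (cont_comp plane F (fun p => Z (fst p) (snd p))); [exact D|].
    exact (der_cont _ _ _ _ H1).
  - apply cont_mult; [apply K|exact E].
Qed.

Lemma deform_rcont s t : a < s < b -> rcont (Phi s) t.
Proof.
  intros Hs; destruct (HF s t Hs) as [H1 _].
  assert (Q : rcont (fun t => (RtoC r0 + RtoC s * RtoC r1) * eit t)%C t)
    by (apply rcont_scal, rcont_eit).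
  apply cont_mult; [|exact Q].
  apply (cont_comp RtoC F (Z s)); [|exact (der_cont _ _ _ _ H1)].
  apply cont_plus; [apply cont_const|exact Q].
Qed.

(** Cauchy's theorem for the family: differentiating under the integral sign leaves the integral of
    the exact [t]-derivative of a function of period [2 * PI], which is zero, so the contour
    integral does not depend on [s]. *)
Lemma deform_Re s s' : a < s < b -> a < s' < b ->
  RInt (fun t => Re (Phi s t)) 0 (2 * PI) = RInt (fun t => Re (Phi s' t)) 0 (2 * PI).
Proof.
  assert (Hloc : forall x, a < x < b -> locally x (fun y => a < y < b)).
  { intros x Hx; assert (Hm : 0 < Rmin (x - a) (b - x)) by (apply Rmin_pos; lra).
    exists (mkposreal _ Hm); intros y Hy; apply Rabs_lt_between in Hy; simpl in Hy.
    assert (L := Rmin_l (x - a) (b - x)); assert (L' := Rmin_r (x - a) (b - x)).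
    unfold minus, plus, opp in Hy; simpl in Hy; lra. }
  assert (Hd : forall x t, a < x < b -> is_derive (fun u => Re (Phi u t)) x (Re (DPhi x t))).
  { intros x t Hx; apply rder_Re, deform_der_s, Hx. }
  assert (HD : forall x, a < x < b ->
    is_derive (fun u => RInt (fun t => Re (Phi u t)) 0 (2 * PI)) x 0).
  { intros x Hx.
    assert (E : @eq R (RInt (fun t => Derive (fun u => Re (Phi u t)) x) 0 (2 * PI)) 0).
    2: { refine (eq_rect _ (fun l : R => is_derive _ x l) _ _ E); clear E; apply (is_derive_RInt_param (fun u t => Re (Phi u t))).
      + apply (filter_imp (fun y => a < y < b)); [|apply Hloc, Hx].
        intros y Hy t _; eexists; apply Hd, Hy.
      + intros t _.
        apply continuity_2d_pt_ext_loc with (fun u v => Re (DPhi u v)).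
        * destruct (Hloc x Hx) as [d H]; exists d; intros u v Hu Hv.
          symmetry; apply is_derive_unique, Hd, H; exact Hu.
        * apply (plane_cont_Re (fun p => DPhi (fst p) (snd p))), deform_cont, Hx.
      + apply (filter_imp (fun y => a < y < b)); [|apply Hloc, Hx].
        intros y Hy; apply rcont_ex_RInt; intros; apply deform_rcont, Hy. }
    rewrite (RInt_ext _ (fun t => Re (DPhi x t))) by (intros; apply is_derive_unique, Hd, Hx).
    apply is_RInt_unique.
    set (Psi := fun t => (- Ci * (F (Z x t) * (c1 + RtoC r1 * eit t)))%C).
    assert (E : minus (Re (Psi (2 * PI))) (Re (Psi 0)) = 0).
    { unfold Psi, Z; rewrite eit_2PI; apply (minus_eq_zero (G := R_AbelianGroup)). }
    refine (eq_rect _ (fun l : R => is_RInt _ 0 (2 * PI) l) _ _ E); clear E; apply (is_RInt_derive (fun t => Re (Psi t))).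
        * intros t _; apply rder_Re, deform_der_t, Hx.
        * intros t _; apply continuity_pt_filterlim, rcont_Re.
          apply (cont_pullback RtoC plane (fun t => (x, t)) (fun p => DPhi (fst p) (snd p)));
            [|apply deform_cont, Hx].
          unfold plane; apply rcont_pair; [apply cont_const|apply cont_pos]. }
  assert (Hlt : forall x y, a < x -> y < b -> x < y ->
    RInt (fun t => Re (Phi x t)) 0 (2 * PI) = RInt (fun t => Re (Phi y t)) 0 (2 * PI)).
  { intros x y Hx Hy Hxy.
    apply (eq_is_derive (fun u => RInt (fun t => Re (Phi u t)) 0 (2 * PI)) x y); [|exact Hxy].
    intros t Ht; apply HD; lra. }
  intros H1 H2; destruct (Rtotal_order s s') as [L|[->|L]]; [|reflexivity|].
  - apply Hlt; lra.
  - symmetry; apply Hlt; lra.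
Qed.

End Deform.

Lemma circle_deform (F F' : C -> C) (c0 c1 : C) (r0 r1 a b s s' : R) :
  (forall s t, a < s < b ->
    let z := (c0 + RtoC s * c1 + (RtoC r0 + RtoC s * RtoC r1) * eit t)%C in
    cder F z (F' z) /\ ccont F' z) ->
  a < s < b -> a < s' < b ->
  cint (fun t => F (c0 + RtoC s * c1 + (RtoC r0 + RtoC s * RtoC r1) * eit t)
     * ((RtoC r0 + RtoC s * RtoC r1) * eit t))%C
  = cint (fun t => F (c0 + RtoC s' * c1 + (RtoC r0 + RtoC s' * RtoC r1) * eit t)
     * ((RtoC r0 + RtoC s' * RtoC r1) * eit t))%C.
Proof.
  intros HF Hs Hs'; unfold cint; f_equal.
  - apply (deform_Re F F' c0 c1 r0 r1 a b); assumption.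
  (* The imaginary part is the real part for the function [- Ci * F]. *)
  - assert (H : forall s t, a < s < b ->
      let z := (c0 + RtoC s * c1 + (RtoC r0 + RtoC s * RtoC r1) * eit t)%C in
      cder (fun z => - Ci * F z)%C z (- Ci * F' z)%C /\ ccont (fun z => - Ci * F' z)%C z).
    { intros u t Hu z; destruct (HF u t Hu) as [H1 H2]; split.
      - apply der_scal, H1.
      - apply cont_mult; [apply cont_const|exact H2]. }
    assert (E := deform_Re _ _ c0 c1 r0 r1 a b H s s' Hs Hs').
    etransitivity; [|etransitivity; [exact E|]]; apply RInt_ext; intros t _;
      rewrite Im_Re; apply (f_equal Re); ring.
Qed.

(** * Holomorphic functions on the disk *)

(* The continuity of the derivative is part of the definition because Cauchy's theorem
   is obtained below by differentiating under the integral sign. *)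
Definition hol (f : C -> C) : Prop :=
  forall z, unit_disk z -> cder f z (C_derive f z) /\ ccont (C_derive f) z.

Lemma unit_disk_open z : unit_disk z ->
  exists d, 0 < d /\ forall w, Cmod (w - z)%C < d -> unit_disk w.
Proof.
  intros Hz; exists (1 - Cmod z); unfold unit_disk in *; split; [lra|].
  intros w Hw; generalize (Cmod_reverse w z); lra.
Qed.

Lemma unit_disk_0 : unit_disk 0.
Proof. unfold unit_disk; rewrite Cmod_0; lra. Qed.

Lemma one_minus_neq_0 z : unit_disk z -> (1 - z)%C <> 0.
Proof.
  intros Hz E; unfold unit_disk in Hz; replace z with (RtoC 1) in Hz; [rewrite Cmod_1 in Hz; lra|].
  symmetry; replace z with (1 - (1 - z))%C by ring; rewrite E; ring.
Qed.

Lemma one_plus_neq_0 z : unit_disk z -> (1 + z)%C <> 0.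
Proof.
  intros Hz; replace (1 + z)%C with (1 - - z)%C by ring; apply one_minus_neq_0.
  unfold unit_disk; rewrite Cmod_opp; exact Hz.
Qed.

Lemma Re_one_minus_pos z : unit_disk z -> 0 < Re (1 - z)%C.
Proof.
  intros Hz; unfold unit_disk in Hz; rewrite Re_minus, re_RtoC; generalize (Re_le_Cmod z); lra.
Qed.

Lemma unit_disk_mult a z : Cmod a <= 1 -> unit_disk z -> unit_disk (a * z)%C.
Proof.
  unfold unit_disk; intros Ha Hz; rewrite Cmod_mult; generalize (Cmod_ge_0 a) (Cmod_ge_0 z); nra.
Qed.

Lemma hol_intro f f' : (forall z, unit_disk z -> cder f z (f' z)) ->
  (forall z, unit_disk z -> ccont f' z) -> hol f.
Proof.
  intros H H' z Hz; split.
  - rewrite (cder_C_derive _ _ _ (H z Hz)); exact (H z Hz).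
  - destruct (unit_disk_open z Hz) as [d [Hd Ho]].
    apply cont_ext_loc with f' d; [exact Hd| |exact (H' z Hz)].
    intros w Hw; symmetry; apply cder_C_derive, H, Ho, Hw.
Qed.

Lemma hol_ext f g : (forall z, unit_disk z -> f z = g z) -> hol f -> hol g.
Proof.
  intros E H; apply hol_intro with (C_derive f); intros z Hz.
  - destruct (unit_disk_open z Hz) as [d [Hd Ho]].
    apply der_ext_loc with f d; [exact Hd|intros; apply E, Ho; assumption|apply H, Hz].
  - apply H, Hz.
Qed.

Lemma hol_der f z : hol f -> unit_disk z -> cder f z (C_derive f z).
Proof. intros H Hz; apply H, Hz. Qed.

Lemma hol_cont f z : hol f -> unit_disk z -> ccont f z.
Proof. intros H Hz; exact (der_cont _ _ _ _ (hol_der f z H Hz)). Qed.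

Lemma hol_const c : hol (fun _ => c).
Proof. apply hol_intro with (fun _ => RtoC 0); intros; [apply der_const|apply cont_const]. Qed.

Lemma hol_id : hol (fun z => z).
Proof. apply hol_intro with (fun _ => RtoC 1); intros; [apply (der_pos idC)|apply cont_const]. Qed.

Lemma hol_plus f g : hol f -> hol g -> hol (fun z => f z + g z)%C.
Proof.
  intros Hf Hg; apply hol_intro with (fun z => C_derive f z + C_derive g z)%C; intros z Hz.
  - apply der_plus; apply hol_der; assumption.
  - apply cont_plus; [apply Hf|apply Hg]; assumption.
Qed.

Lemma hol_mult f g : hol f -> hol g -> hol (fun z => f z * g z)%C.
Proof.
  intros Hf Hg; apply hol_intro with (fun z => C_derive f z * g z + f z * C_derive g z)%C; intros z Hz.
  - apply der_mult; apply hol_der; assumption.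
  - apply cont_plus; apply cont_mult; try (apply hol_cont; assumption); [apply Hf|apply Hg]; assumption.
Qed.

Lemma hol_scal c f : hol f -> hol (fun z => c * f z)%C.
Proof. intros H; apply (hol_mult (fun _ => c)); [apply hol_const|exact H]. Qed.

Lemma hol_opp f : hol f -> hol (fun z => - f z)%C.
Proof.
  intros H; apply hol_ext with (fun z => - (1) * f z)%C; [intros; ring|apply hol_scal, H].
Qed.

Lemma hol_minus f g : hol f -> hol g -> hol (fun z => f z - g z)%C.
Proof. intros Hf Hg; apply hol_plus; [|apply hol_opp]; assumption. Qed.

(** [h] has to be differentiable only at the values of [f]. This serves outer functions that do not
    live on the disk: the reciprocal, powers on the right half-plane, and the inverse of [g] on its
    image. *)
Lemma hol_comp_image h h' f : hol f ->
  (forall z, unit_disk z -> cder h (f z) (h' (f z)) /\ ccont h' (f z)) ->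
  hol (fun z => h (f z)).
Proof.
  intros Hf Hh; apply hol_intro with (fun z => h' (f z) * C_derive f z)%C; intros z Hz.
  - apply (der_comp idC h f); [apply hol_der|apply Hh]; assumption.
  - apply cont_mult; [|apply Hf, Hz].
    apply (cont_comp idC h' f); [apply hol_cont|apply Hh]; assumption.
Qed.

Lemma hol_comp g f : hol g -> hol f -> (forall z, unit_disk z -> unit_disk (f z)) ->
  hol (fun z => g (f z)).
Proof. intros Hg Hf Hd; apply hol_comp_image with (C_derive g); [exact Hf|intros; apply Hg, Hd; assumption]. Qed.

Lemma cder_Cinv (z : C) : z <> 0 -> cder Cinv z (- / (z * z))%C /\ ccont (fun w => - / (w * w))%C z.
Proof.
  intros Hz; split; [apply cder_inv_id, Hz|].
  apply cont_opp, cont_inv; [|apply Cmult_neq_0; assumption].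
  apply cont_mult; apply cont_pos.
Qed.

Lemma hol_inv f : hol f -> (forall z, unit_disk z -> f z <> 0) -> hol (fun z => / f z)%C.
Proof.
  intros Hf H0; apply (hol_comp_image Cinv (fun w => - / (w * w))%C); [exact Hf|].
  intros z Hz; apply cder_Cinv, H0, Hz.
Qed.

Lemma hol_div f g : hol f -> hol g -> (forall z, unit_disk z -> g z <> 0) ->
  hol (fun z => f z / g z)%C.
Proof. intros Hf Hg H0; apply hol_mult; [|apply hol_inv]; assumption. Qed.

Lemma hol_pow f n : hol f -> hol (fun z => f z ^ n)%C.
Proof.
  intros Hf; induction n as [|n IH]; simpl; [apply hol_const|apply hol_mult; assumption].
Qed.

Lemma Cmod_circle r t : 0 <= r -> Cmod (RtoC r * eit t)%C = r.
Proof. intros Hr; rewrite Cmod_mult, Cmod_R, Cmod_eit, Rabs_pos_eq; lra. Qed.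

Lemma circle_in_disk r t : 0 <= r < 1 -> unit_disk (RtoC r * eit t)%C.
Proof. intros Hr; unfold unit_disk; rewrite Cmod_circle; lra. Qed.

Lemma rcont_circle r t : rcont (fun t => RtoC r * eit t)%C t.
Proof. apply rcont_scal, rcont_eit. Qed.

Lemma hol_rcont f r t : hol f -> 0 <= r < 1 -> rcont (fun t => f (RtoC r * eit t))%C t.
Proof.
  intros Hf Hr; apply (cont_comp RtoC f (fun t => RtoC r * eit t)%C); [apply rcont_circle|].
  apply hol_cont; [exact Hf|apply circle_in_disk, Hr].
Qed.

Lemma circle_minus_neq r t (a : C) : Cmod a < r -> (RtoC r * eit t - a)%C <> 0.
Proof.
  intros Ha; apply Cmod_neq_0.
  assert (H := Cmod_reverse (RtoC r * eit t) a); assert (H' := Cmod_ge_0 a).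
  rewrite Cmod_circle in H by lra; lra.
Qed.

Lemma circle_neq r t : 0 < r -> (RtoC r * eit t)%C <> 0.
Proof. intros Hr; apply Cmod_neq_0; rewrite Cmod_circle; lra. Qed.

Lemma C_eq_of_small (x y : C) (k : R) :
  (forall eps, 0 < eps -> Cmod (x - y)%C <= k * eps) -> x = y.
Proof.
  intros H; apply Ceq_minus, Cmod_eq_0; apply Rle_antisym; [|apply Cmod_ge_0].
  apply Rnot_lt_le; intros Hp.
  assert (Hk : 0 < 2 * (Rabs k + 1)) by (generalize (Rabs_pos k); lra).
  specialize (H (Cmod (x - y)%C / (2 * (Rabs k + 1))) (Rdiv_lt_0_compat _ _ Hp Hk)).
  assert (L : k <= Rabs k + 1) by (generalize (Rle_abs k); lra).
  assert (E : (Rabs k + 1) * (Cmod (x - y)%C / (2 * (Rabs k + 1))) = Cmod (x - y)%C / 2)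
    by (field; lra).
  assert (0 < Cmod (x - y)%C / (2 * (Rabs k + 1))) by (apply Rdiv_lt_0_compat; assumption).
  nra.
Qed.

(** The circle of radius [r] about 0 is deformed into one of small radius [e] about [a], where the
    kernel cancels and the integral becomes that of [f] over the small circle. By continuity it
    differs from [2 * PI * f a] by at most [2 * PI * eps]. *)
Lemma cauchy_formula f a r : hol f -> Cmod a < r < 1 ->
  cint (fun t => f (RtoC r * eit t) * (RtoC r * eit t / (RtoC r * eit t - a)))%C
  = (RtoC (2 * PI) * f a)%C.
Proof.
  intros Hf Hr; assert (Ha := Cmod_ge_0 a).
  assert (HaD : unit_disk a) by (unfold unit_disk; lra).
  apply C_eq_of_small with (2 * PI); intros eps Heps.
  destruct (hol_cont f a Hf HaD eps Heps) as [d [Hd Hcont]].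
  set (e := Rmin (d / 2) ((r - Cmod a) / 2)).
  assert (He : 0 < e) by (apply Rmin_pos; lra).
  assert (Hed : e < d) by (apply Rle_lt_trans with (1 := Rmin_l _ _); lra).
  assert (Her : e < r - Cmod a) by (apply Rle_lt_trans with (1 := Rmin_r _ _); lra).
  (* The deformation needs an open interval around [[0, 1]]; [eta] is small enough for the radius to
     stay positive and for the circles to stay in the disk and off [a]. *)
  set (eta := Rmin ((1 - r) / 4) (e / 4)).
  assert (Heta : 0 < eta) by (apply Rmin_pos; lra).
  assert (Heta1 : eta <= (1 - r) / 4) by apply Rmin_l.
  assert (Heta2 : eta <= e / 4) by apply Rmin_r.
  replace (cint _) with (cint (fun t => f (a + RtoC e * eit t)%C)).
  - rewrite <- cint_const, <- cint_minus.
    + apply Cmod_cint_le_const.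
      * intros t; apply cont_minus; [|apply cont_const].
        apply (cont_comp RtoC f (fun t => a + RtoC e * eit t)%C).
        { apply cont_plus; [apply cont_const|apply rcont_circle]. }
        apply hol_cont; [exact Hf|]; unfold unit_disk.
        apply Rle_lt_trans with (1 := Cmod_triangle _ _); rewrite Cmod_circle; lra.
      * intros t; left; apply Hcont; unfold idC.
        replace (a + RtoC e * eit t - a)%C with (RtoC e * eit t)%C by ring.
        rewrite Cmod_circle; lra.
    + intros t; apply (cont_comp RtoC f (fun t => a + RtoC e * eit t)%C).
      { apply cont_plus; [apply cont_const|apply rcont_circle]. }
      apply hol_cont; [exact Hf|]; unfold unit_disk.
      apply Rle_lt_trans with (1 := Cmod_triangle _ _); rewrite Cmod_circle; lra.
    + intros; apply cont_const.
  - assert (E := circle_deform (fun z => f z / (z - a))%C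
      (fun z => (C_derive f z * (z - a) - f z * 1) / ((z - a) * (z - a)))%C
      0 a r (e - r) (- eta) (1 + eta) 1 0).
    etransitivity; [|etransitivity; [apply E|]].
    + apply cint_ext; intros t.
      replace (RtoC r + RtoC 1 * RtoC (e - r))%C with (RtoC e) by (rewrite RtoC_minus; ring).
      replace (0 + RtoC 1 * a + RtoC e * eit t)%C with (a + RtoC e * eit t)%C by ring.
      field; replace (a + RtoC e * eit t - a)%C with (RtoC e * eit t)%C by ring.
      apply circle_neq, He.
    + intros s t Hs z.
      assert (Hz : z = (RtoC s * a + RtoC (r + s * (e - r)) * eit t)%C).
      { unfold z; rewrite RtoC_plus, RtoC_mult; ring. }
      assert (Hrho : 0 < r + s * (e - r)) by (destruct (Rle_dec s 1); nra).
      assert (HzD : unit_disk z).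
      { rewrite Hz; unfold unit_disk; apply Rle_lt_trans with (1 := Cmod_triangle _ _).
        rewrite Cmod_circle, Cmod_mult, Cmod_R by lra.
        destruct (Rle_dec 0 s) as [P|P].
        - rewrite Rabs_pos_eq by assumption; nra.
        - rewrite Rabs_left by lra; nra. }
      assert (Hza : (z - a)%C <> 0).
      { rewrite Hz; apply Cmod_neq_0.
        replace (RtoC s * a + RtoC (r + s * (e - r)) * eit t - a)%C
          with (RtoC (r + s * (e - r)) * eit t - RtoC (1 - s) * a)%C
          by (rewrite RtoC_minus; ring).
        apply Rlt_le_trans with (2 := Cmod_reverse _ _).
        rewrite Cmod_circle, Cmod_mult, Cmod_R by lra.
        destruct (Rle_dec s 1) as [P|P].
        - rewrite Rabs_pos_eq by lra; destruct (Rle_dec 0 s); nra.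
        - rewrite Rabs_left by lra; nra. }
      assert (Hdz : forall w, cder (fun z => z - a)%C w 1).
      { intros w; apply der_eq with (1 - 0)%C; [|ring].
        apply der_minus; [apply (der_pos idC)|apply der_const]. }
      split.
      * apply (der_div idC f (fun z => z - a)%C); [apply hol_der; assumption|apply Hdz|exact Hza].
      * apply cont_div.
        -- apply cont_minus; apply cont_mult; try (apply cont_const).
           ++ apply Hf, HzD.
           ++ exact (der_cont _ _ _ _ (Hdz z)).
           ++ apply hol_cont; assumption.
        -- apply cont_mult; exact (der_cont _ _ _ _ (Hdz z)).
        -- apply Cmult_neq_0; exact Hza.
    + lra.
    + lra.
    + apply cint_ext; intros t.
      replace (RtoC r + RtoC 0 * RtoC (e - r))%C with (RtoC r) by ring.
      replace (0 + RtoC 0 * a + RtoC r * eit t)%C with (RtoC r * eit t)%C by ring.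
      field; apply circle_minus_neq; lra.
Qed.

Lemma mean_value f r : hol f -> 0 <= r < 1 ->
  cint (fun t => f (RtoC r * eit t))%C = (RtoC (2 * PI) * f 0)%C.
Proof.
  intros Hf [Hr0 Hr]; destruct Hr0 as [Hr0|<-].
  - rewrite <- (cauchy_formula f 0 r Hf) by (rewrite Cmod_0; lra).
    apply cint_ext; intros t; assert (N := circle_neq r t Hr0).
    set (w := (RtoC r * eit t)%C) in *; replace (w - 0)%C with w by ring; field; exact N.
  - rewrite <- cint_const; apply cint_ext; intros t; f_equal; ring.
Qed.

(** * Taylor expansions *)

(** The terms of index below [n], so that remainder identities start from an empty sum; [sum_n]
    includes the index [n], whence the shift in [sum_n_psum]. *)
Fixpoint psum (a : nat -> C) (z : C) (n : nat) : C :=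
  match n with O => RtoC 0 | S m => (psum a z m + a m * z ^ m)%C end.

Lemma pow_n_Cpow (z : C) n : pow_n (K := C_Ring) z n = (z ^ n)%C.
Proof. induction n as [|n IH]; simpl; [reflexivity|rewrite IH; reflexivity]. Qed.

Lemma sum_n_psum a z n :
  sum_n (fun k => scal (K := C_Ring) (V := C_ModuleSpace) (pow_n (K := C_Ring) z k) (a k)) n = psum a z (S n).
Proof.
  induction n as [|n IH].
  - rewrite sum_O; simpl; unfold scal; simpl; unfold mult, one; simpl; ring.
  - rewrite sum_Sn, IH, pow_n_Cpow; change (psum a z (S (S n))) with (psum a z (S n) + a (S n) * z ^ S n)%C.
    unfold plus, scal; simpl; unfold mult; simpl; ring.
Qed.

Lemma is_pseries_psum (a : nat -> C) (z l : C) :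
  @is_pseries C_AbsRing C_NormedModule a z l <->
  forall eps, 0 < eps -> exists N, forall n, (N <= n)%nat -> Cmod (psum a z n - l)%C < eps.
Proof.
  split.
  - intros H eps Heps.
    assert (L : locally_norm (V := C_NormedModule) l (fun y => Cmod (y - l)%C < eps)).
    { exists (mkposreal _ Heps); intros y Hy; exact Hy. }
    apply (locally_le_locally_norm (V := C_NormedModule)) in L.
    destruct (H _ L) as [N HN]; exists (S N); intros n Hn.
    destruct n as [|n]; [lia|]; rewrite <- sum_n_psum.
    apply (HN n); lia.
  - intros H P HP.
    apply (locally_norm_le_locally (V := C_NormedModule)) in HP.
    destruct HP as [d Hd]; destruct (H d (cond_pos d)) as [N HN].
    exists N; intros n Hn; apply Hd.
    change (Cmod (sum_n (fun k => scal (K := C_Ring) (V := C_ModuleSpace) (pow_n (K := C_Ring) z k) (a k)) n - l)%C < d).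
    rewrite sum_n_psum; apply HN; lia.
Qed.

(** Cauchy's coefficient integral on the circle of radius 1/2; any radius in [(0, 1)] gives the same
    value. *)
Definition taylor_coef (f : C -> C) (n : nat) : C :=
  (/ RtoC (2 * PI) * cint (fun t => f (RtoC (1 / 2) * eit t) * / (RtoC (1 / 2) * eit t) ^ n))%C.

Lemma RtoC_2PI_neq : RtoC (2 * PI) <> 0.
Proof. apply RtoC_neq_0; generalize two_pi_pos; lra. Qed.

Lemma taylor_coef_radius f n r : hol f -> 0 < r < 1 ->
  cint (fun t => f (RtoC r * eit t) * / (RtoC r * eit t) ^ n)%C
  = (RtoC (2 * PI) * taylor_coef f n)%C.
Proof.
  intros Hf Hr; unfold taylor_coef.
  rewrite Cmult_assoc, Cinv_r, Cmult_1_l by apply RtoC_2PI_neq.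
  (* With [c0 = c1 = r0 = 0] and [r1 = 1] the parameter [s] is itself the radius. The exponent [S n]
     makes up for the factor [z] in the integrand of [circle_deform]. *)
  assert (E := circle_deform (fun z => f z / z ^ S n)%C
    (fun z => (C_derive f z * z ^ S n - f z * (RtoC (INR (S n)) * z ^ n * 1)) / (z ^ S n * z ^ S n))%C
    0 0 0 1 0 1 r (1 / 2)).
  assert (Hc : forall s t, (0 + RtoC s * 0 + (0 + RtoC s * 1) * eit t)%C = (RtoC s * eit t)%C)
    by (intros; ring).
  assert (Hc' : forall s, (0 + RtoC s * 1)%C = RtoC s) by (intros; ring).
  assert (Hs : forall s t, 0 < s < 1 ->
    (f (RtoC s * eit t) * / (RtoC s * eit t) ^ n)%C
    = (f (0 + RtoC s * 0 + (0 + RtoC s * 1) * eit t) / (0 + RtoC s * 0 + (0 + RtoC s * 1) * eit t) ^ S n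
        * ((0 + RtoC s * 1) * eit t))%C).
  { intros s t Hs; rewrite Hc, Hc'; simpl.
    assert (N := circle_neq s t (proj1 Hs)); set (w := (RtoC s * eit t)%C) in *.
    field; split; [apply Cpow_nz, N|exact N]. }
  etransitivity; [|etransitivity; [apply E|]].
  - apply cint_ext; intros t; apply Hs, Hr.
  - intros s t Hst; cbv zeta; rewrite Hc.
    assert (N := circle_neq s t (proj1 Hst)).
    assert (HD := circle_in_disk s t (conj (Rlt_le _ _ (proj1 Hst)) (proj2 Hst))).
    assert (P := der_pow idC idC (RtoC s * eit t)%C 1 (S n) (der_pos idC _)).
    assert (N' : ((RtoC s * eit t) ^ S n)%C <> 0) by apply Cpow_nz, N.
    split.
    + apply (der_div idC f (fun z => z ^ S n)%C); [apply hol_der; assumption|exact P|exact N'].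
    + apply cont_div; [|apply cont_mult; exact (cont_pow idC idC _ (S n) (cont_pos idC _))
        |apply Cmult_neq_0; exact N'].
      apply cont_minus; apply cont_mult.
      * apply Hf, HD.
      * exact (cont_pow idC idC _ (S n) (cont_pos idC _)).
      * apply hol_cont; assumption.
      * apply cont_mult; [|apply cont_const].
        apply cont_mult; [apply cont_const|exact (cont_pow idC idC _ n (cont_pos idC _))].
  - exact Hr.
  - lra.
  - apply cint_ext; intros t; symmetry; apply Hs; lra.
Qed.

Lemma Cpow_div_mult (a z : C) n : z <> 0 -> ((a / z) ^ n)%C = (a ^ n * / z ^ n)%C.
Proof.
  intros Hz; induction n as [|n IH]; simpl; [field; intros E; injection E; lra|].
  rewrite IH; field; split; [apply Cpow_nz, Hz|exact Hz].
Qed.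

(** Each induction step in [Hrem] splits one term of the geometric series off the Cauchy kernel and
    keeps the remainder exact, as the integral of [k * q^n]. Since [|q| = |z| / r < 1], the
    remainder decays geometrically; sum and integral are never interchanged. *)
Lemma taylor f z : hol f -> unit_disk z ->
  @is_pseries C_AbsRing C_NormedModule (taylor_coef f) z (f z).
Proof.
  intros Hf Hz; unfold unit_disk in Hz; assert (Hz0 := Cmod_ge_0 z).
  set (r := (1 + Cmod z) / 2).
  assert (Hr : Cmod z < r < 1) by (unfold r; lra).
  assert (Hr' : 0 <= r < 1) by lra.
  set (q := fun t => (z / (RtoC r * eit t))%C).
  set (k := fun t => (f (RtoC r * eit t) * (RtoC r * eit t / (RtoC r * eit t - z)))%C).
  assert (Hq : forall t, rcont q t).
  { intros t; apply cont_div; [apply cont_const|apply rcont_circle|apply circle_neq; lra]. }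
  assert (Hk : forall t, rcont k t).
  { intros t; apply cont_mult; [apply hol_rcont; assumption|].
    apply cont_div; [apply rcont_circle| |apply circle_minus_neq; lra].
    apply cont_minus; [apply rcont_circle|apply cont_const]. }
  assert (Hrem : forall n, (RtoC (2 * PI) * f z = RtoC (2 * PI) * psum (taylor_coef f) z n
    + cint (fun t => k t * q t ^ n))%C).
  { induction n as [|n IH].
    - simpl; rewrite (cint_ext _ k) by (intros; ring).
      unfold k; rewrite (cauchy_formula f z r Hf Hr); ring.
    - rewrite IH; change (psum (taylor_coef f) z (S n)) with (psum (taylor_coef f) z n + taylor_coef f n * z ^ n)%C.
      rewrite (cint_ext (fun t => k t * q t ^ n)%C
        (fun t => z ^ n * (f (RtoC r * eit t) * / (RtoC r * eit t) ^ n) + k t * q t ^ S n)%C).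
      + rewrite cint_plus, cint_scal, (taylor_coef_radius f n r Hf); [ring|lra| | |].
        * intros t; apply cont_mult; [apply hol_rcont; assumption|].
          apply cont_inv; [apply cont_pow, rcont_circle|apply Cpow_nz, circle_neq; lra].
        * intros t; apply cont_mult; [apply cont_const|].
          apply cont_mult; [apply hol_rcont; assumption|].
          apply cont_inv; [apply cont_pow, rcont_circle|apply Cpow_nz, circle_neq; lra].
        * intros t; apply cont_mult; [apply Hk|apply cont_pow, Hq].
      + intros t; unfold k, q; assert (N : (RtoC r * eit t)%C <> 0) by (apply circle_neq; lra).
        assert (N' : (RtoC r * eit t - z)%C <> 0) by (apply circle_minus_neq; lra).
        set (w := (RtoC r * eit t)%C) in *.
        rewrite !Cpow_div_mult by exact N; simpl; field.
        repeat split; try assumption; apply Cpow_nz; assumption. }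
  set (B := RInt (fun t => Cmod (k t)) 0 (2 * PI)).
  assert (HB : 0 <= B).
  { apply RInt_ge_0; [left; apply two_pi_pos| |intros; apply Cmod_ge_0].
    apply rcont_ex_RInt_Cmod, Hk. }
  assert (Hbound : forall n, Cmod (psum (taylor_coef f) z n - f z)%C <= B * (Cmod z / r) ^ n).
  { intros n; apply Rmult_le_reg_l with (2 * PI); [apply two_pi_pos|].
    apply Rle_trans with (B * (Cmod z / r) ^ n).
    2: { rewrite <- (Rmult_1_l (B * _)) at 1; apply Rmult_le_compat_r; [|generalize PI2_1; lra].
      apply Rmult_le_pos; [exact HB|apply pow_le, Rmult_le_pos; [exact Hz0|]].
      left; apply Rinv_0_lt_compat; lra. }
    rewrite <- (Rabs_pos_eq (2 * PI)) by (left; apply two_pi_pos).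
    rewrite <- Cmod_R, <- Cmod_mult.
    replace (RtoC (2 * PI) * (psum (taylor_coef f) z n - f z))%C
      with (- cint (fun t => k t * q t ^ n))%C.
    2: { transitivity (RtoC (2 * PI) * psum (taylor_coef f) z n - RtoC (2 * PI) * f z)%C; [|ring].
      rewrite (Hrem n); ring. }
    rewrite Cmod_opp.
    assert (Hc : forall t, rcont (fun t => k t * q t ^ n)%C t)
      by (intros t; apply cont_mult; [apply Hk|apply cont_pow, Hq]).
    apply Rle_trans with (1 := Cmod_cint_le _ Hc).
    rewrite (Rmult_comm B); right.
    assert (Ek := RInt_scal (V := R_CompleteNormedModule) (fun t => Cmod (k t)) 0 (2 * PI) ((Cmod z / r) ^ n)
      (rcont_ex_RInt_Cmod k _ _ Hk)).
    etransitivity; [|exact Ek].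
    apply RInt_ext; intros t _; unfold scal; simpl; unfold mult; simpl.
    rewrite Cmod_mult, Cmod_pow; unfold q; rewrite Cmod_div by (apply circle_neq; lra).
    rewrite Cmod_circle by lra; apply Rmult_comm. }
  apply is_pseries_psum; intros eps Heps.
  assert (Hq1 : Rabs (Cmod z / r) < 1).
  { rewrite Rabs_pos_eq.
    - apply Rmult_lt_reg_r with r; [lra|]; unfold Rdiv; rewrite Rmult_assoc, Rinv_l; lra.
    - apply Rmult_le_pos; [exact Hz0|left; apply Rinv_0_lt_compat; lra]. }
  destruct (pow_lt_1_zero _ Hq1 (eps / (B + 1))) as [N HN]; [apply Rdiv_lt_0_compat; lra|].
  exists N; intros n Hn; apply Rle_lt_trans with (1 := Hbound n).
  specialize (HN n Hn); apply Rle_lt_trans with (B * (eps / (B + 1))).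
  - apply Rmult_le_compat_l; [exact HB|left; apply Rle_lt_trans with (2 := HN), Rle_abs].
  - apply Rmult_lt_reg_r with (B + 1); [lra|].
    replace (B * (eps / (B + 1)) * (B + 1)) with (B * eps) by (field; lra); nra.
Qed.

(** * Termwise differentiation of power series *)

Fixpoint csum (u : nat -> C) (n : nat) : C :=
  match n with O => RtoC 0 | S m => (csum u m + u m)%C end.

(** The sum taken componentwise. [Series] is total, so the value is meaningful only with a majorant,
    as in [csum_clim]. *)
Definition clim (u : nat -> C) : C :=
  (Series (fun n => Re (u n)), Series (fun n => Im (u n))).

Lemma csum_Re u n : Re (csum u (S n)) = sum_n (fun k => Re (u k)) n.
Proof.
  induction n as [|n IH].
  - rewrite sum_O; unfold Re; simpl; ring.
  - rewrite sum_Sn, <- IH; unfold Re; simpl; reflexivity.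
Qed.

Lemma csum_Im u n : Im (csum u (S n)) = sum_n (fun k => Im (u k)) n.
Proof.
  induction n as [|n IH].
  - rewrite sum_O; unfold Im; simpl; ring.
  - rewrite sum_Sn, <- IH; unfold Im; simpl; reflexivity.
Qed.

Lemma csum_tail u K q N k : (forall n, Cmod (u n) <= K * q ^ n) -> 0 <= q < 1 ->
  Cmod (csum u (k + N) - csum u N)%C <= K * q ^ N * (1 - q ^ k) / (1 - q).
Proof.
  intros Hu Hq; induction k as [|k IH].
  - simpl; replace (csum u N - csum u N)%C with (RtoC 0) by ring; rewrite Cmod_0; right; field; lra.
  - change (csum u (S k + N)) with (csum u (k + N) + u (k + N)%nat)%C.
    replace (csum u (k + N) + u (k + N)%nat - csum u N)%C
      with ((csum u (k + N) - csum u N) + u (k + N)%nat)%C by ring.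
    apply Rle_trans with (1 := Cmod_triangle _ _).
    apply Rle_trans with (1 := Rplus_le_compat _ _ _ _ IH (Hu (k + N)%nat)).
    rewrite pow_add; right; simpl; field; lra.
Qed.

Lemma csum_clim u K q N : (forall n, Cmod (u n) <= K * q ^ n) -> 0 <= q < 1 ->
  Cmod (csum u N - clim u)%C <= K * q ^ N / (1 - q).
Proof.
  intros Hu Hq.
  assert (HK : 0 <= K).
  { specialize (Hu 0%nat); simpl in Hu; generalize (Cmod_ge_0 (u 0%nat)); lra. }
  assert (Hg : ex_series (fun n => K * q ^ n)).
  { apply (ex_series_scal_l (K := R_AbsRing) K (fun n => q ^ n)).
    exists (/ (1 - q)); apply is_series_geom; rewrite Rabs_pos_eq; lra. }
  assert (HR : ex_series (fun n => Re (u n))).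
  { apply (ex_series_le (K := R_AbsRing) (V := R_CompleteNormedModule)) with (2 := Hg).
    intros n; apply Rle_trans with (2 := Hu n), re_le_Cmod. }
  assert (HI : ex_series (fun n => Im (u n))).
  { apply (ex_series_le (K := R_AbsRing) (V := R_CompleteNormedModule)) with (2 := Hg).
    intros n; apply Rle_trans with (2 := Hu n), Im_le_Cmod. }
  apply Series_correct in HR; apply Series_correct in HI.
  apply le_epsilon; intros eps Heps.
  assert (He : 0 < eps / 2) by lra.
  assert (LR : locally (Series (fun n => Re (u n))) (fun y => Rabs (y - Series (fun n => Re (u n))) < eps / 2)).
  { exists (mkposreal _ He); intros y Hy; exact Hy. }
  assert (LI : locally (Series (fun n => Im (u n))) (fun y => Rabs (y - Series (fun n => Im (u n))) < eps / 2)).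
  { exists (mkposreal _ He); intros y Hy; exact Hy. }
  destruct (HR _ LR) as [N1 H1], (HI _ LI) as [N2 H2].
  set (k := (S (N1 + N2))%nat).
  assert (A := csum_tail u K q N k Hu Hq).
  assert (B : Cmod (csum u (k + N) - clim u)%C < eps).
  { apply Rle_lt_trans with (1 := Cmod_Re_Im _).
    rewrite Re_minus, Im_minus; unfold k; rewrite Nat.add_succ_l, csum_Re, csum_Im.
    assert (B1 := H1 (N1 + N2 + N)%nat ltac:(lia)); assert (B2 := H2 (N1 + N2 + N)%nat ltac:(lia)).
    cbv beta in B1, B2; unfold clim, Re, Im in *; cbn [fst snd] in *.
    apply Rlt_le_trans with (1 := Rplus_lt_compat _ _ _ _ B1 B2); lra. }
  replace (csum u N - clim u)%C with ((csum u (k + N) - clim u) - (csum u (k + N) - csum u N))%C by ring.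
  apply Rle_trans with (1 := Cmod_triangle_minus _ _).
  assert (D : K * q ^ N * (1 - q ^ k) / (1 - q) <= K * q ^ N / (1 - q)).
  { apply Rmult_le_compat_r; [left; apply Rinv_0_lt_compat; lra|].
    rewrite <- (Rmult_1_r (K * q ^ N)) at 2; apply Rmult_le_compat_l.
    - apply Rmult_le_pos; [exact HK|apply pow_le; lra].
    - assert (0 <= q ^ k) by (apply pow_le; lra); lra. }
  lra.
Qed.

Lemma pseries_unique (a : nat -> C) (z l l' : C) :
  @is_pseries C_AbsRing C_NormedModule a z l -> @is_pseries C_AbsRing C_NormedModule a z l' -> l = l'.
Proof.
  intros H H'; rewrite is_pseries_psum in H, H'.
  apply C_eq_of_small with 2; intros eps Heps.
  destruct (H eps Heps) as [N HN], (H' eps Heps) as [N' HN'].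
  specialize (HN (N + N')%nat ltac:(lia)); specialize (HN' (N + N')%nat ltac:(lia)).
  replace (l - l')%C with ((psum a z (N + N') - l') - (psum a z (N + N') - l))%C by ring.
  apply Rle_trans with (1 := Cmod_triangle_minus _ _); lra.
Qed.

Lemma psum_0 a n : psum a 0 (S n) = a 0%nat.
Proof.
  induction n as [|n IH]; [simpl; ring|].
  change (psum a 0 (S (S n))) with (psum a 0 (S n) + a (S n) * 0 ^ S n)%C; rewrite IH; simpl; ring.
Qed.

Lemma pseries_0 (a : nat -> C) : @is_pseries C_AbsRing C_NormedModule a (RtoC 0) (a 0%nat).
Proof.
  apply is_pseries_psum; intros eps Heps; exists 1%nat; intros [|n] Hn; [lia|].
  rewrite psum_0; replace (a 0%nat - a 0%nat)%C with (RtoC 0) by ring; rewrite Cmod_0; exact Heps.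
Qed.

Lemma pseries_coef_bound (a : nat -> C) (r : R) (l : C) : 0 <= r ->
  @is_pseries C_AbsRing C_NormedModule a (RtoC r) l -> exists B, forall n, Cmod (a n) * r ^ n <= B.
Proof.
  intros Hr H; rewrite is_pseries_psum in H; destruct (H 1 Rlt_0_1) as [N HN].
  assert (Hfin : forall n, exists B, forall k, (k < n)%nat -> Cmod (a k) * r ^ k <= B).
  { induction n as [|n [B HB]]; [exists 0; intros; lia|].
    exists (Rmax B (Cmod (a n) * r ^ n)); intros k Hk.
    destruct (Nat.eq_dec k n) as [->|Hn]; [apply Rmax_r|].
    apply Rle_trans with (2 := Rmax_l _ _), HB; lia. }
  destruct (Hfin N) as [B HB]; exists (Rmax B 2); intros n.
  destruct (Nat.lt_ge_cases n N) as [L|L].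
  - apply Rle_trans with (2 := Rmax_l _ _), HB, L.
  - apply Rle_trans with (2 := Rmax_r _ _).
    replace (Cmod (a n) * r ^ n) with (Cmod ((psum a (RtoC r) (S n) - l) - (psum a (RtoC r) n - l))%C).
    + apply Rle_trans with (1 := Cmod_triangle_minus _ _).
      assert (A := HN n L); assert (A' := HN (S n) ltac:(lia)); lra.
    + simpl psum; replace (psum a (RtoC r) n + a n * RtoC r ^ n - l - (psum a (RtoC r) n - l))%C
        with (a n * RtoC r ^ n)%C by ring.
      rewrite Cmod_mult, Cmod_pow, Cmod_R, Rabs_pos_eq by assumption; reflexivity.
Qed.

Definition dcoef (a : nat -> C) (n : nat) : C := (RtoC (INR (S n)) * a (S n))%C.

(** The divided difference [(w^n - z^n) / (w - z)] written as a polynomial, hence defined and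
    continuous at [w = z] too. *)
Fixpoint diffq (z w : C) (n : nat) : C :=
  match n with O => RtoC 0 | S m => (z ^ m + w * diffq z w m)%C end.

Lemma diffq_spec z w n : ((w - z) * diffq z w n = w ^ n - z ^ n)%C.
Proof.
  induction n as [|n IH]; simpl; [ring|].
  transitivity ((w - z) * z ^ n + w * ((w - z) * diffq z w n))%C; [ring|rewrite IH; ring].
Qed.

Lemma diffq_bound z w r n : Cmod z <= r -> Cmod w <= r -> Cmod (diffq z w (S n)) <= INR (S n) * r ^ n.
Proof.
  intros Hz Hw; assert (Hr : 0 <= r) by (generalize (Cmod_ge_0 z); lra).
  induction n as [|n IH].
  - simpl; replace (1 + w * 0)%C with (RtoC 1) by ring; rewrite Cmod_1; lra.
  - change (diffq z w (S (S n))) with (z ^ S n + w * diffq z w (S n))%C.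
    apply Rle_trans with (1 := Cmod_triangle _ _); rewrite Cmod_mult, Cmod_pow.
    apply Rle_trans with (r ^ S n + r * (INR (S n) * r ^ n)).
    + apply Rplus_le_compat; [apply pow_incr; split; [apply Cmod_ge_0|exact Hz]|].
      apply Rmult_le_compat; [apply Cmod_ge_0|apply Cmod_ge_0|exact Hw|exact IH].
    + rewrite (S_INR (S n)); right; simpl pow; ring.
Qed.

Lemma diffq_diag z n : diffq z z (S n) = (RtoC (INR (S n)) * z ^ n)%C.
Proof.
  induction n as [|n IH]; [simpl; ring|].
  change (diffq z z (S (S n))) with (z ^ S n + z * diffq z z (S n))%C.
  rewrite IH, (S_INR (S n)), RtoC_plus; simpl Cpow; ring.
Qed.

Lemma diffq_cont z n w : ccont (fun w => diffq z w n) w.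
Proof.
  induction n as [|n IH]; simpl; [apply cont_const|].
  apply cont_plus; [apply cont_const|apply cont_mult; [apply (cont_pos idC)|exact IH]].
Qed.

Lemma pow_ge_linear x n : 0 < x -> 1 + INR n * x <= (1 + x) ^ n.
Proof. intros Hx; apply poly, Hx. Qed.

(** The factor [n + 1] produced by differentiation is traded for a slightly larger radius, by
    Bernoulli's inequality for [(r2 / r1)^(n+1)]. *)
Lemma nat_pow_geom_bound r1 r2 n : 0 < r1 < r2 ->
  INR (S n) * r1 ^ n <= r2 / (r1 * (r2 / r1 - 1)) * r2 ^ n.
Proof.
  intros Hr; set (x := r2 / r1 - 1).
  assert (Hx : 0 < x).
  { unfold x; apply Rmult_lt_reg_r with r1; [lra|].
    replace ((r2 / r1 - 1) * r1) with (r2 - r1) by (field; lra); lra. }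
  assert (E : r2 = r1 * (1 + x)) by (unfold x; field; lra).
  assert (A := pow_ge_linear x (S n) Hx).
  assert (B : INR (S n) <= (1 + x) ^ S n / x).
  { apply Rmult_le_reg_r with x; [exact Hx|].
    replace ((1 + x) ^ S n / x * x) with ((1 + x) ^ S n) by (field; lra); lra. }
  rewrite E, Rpow_mult_distr.
  replace (r1 * (1 + x) / (r1 * x) * (r1 ^ n * (1 + x) ^ n))
    with ((1 + x) ^ S n / x * r1 ^ n) by (simpl; field; lra).
  apply Rmult_le_compat_r; [apply pow_le; lra|exact B].
Qed.

(** The slope of [f] at [z] is the series of [a n * diffq z w n]. It has a geometric majorant
    uniform for [w] near [z], so it is continuous at [w = z], where it becomes the differentiated
    series. *)
Lemma pseries_der (a : nat -> C) (f : C -> C) (z : C) : (forall z, unit_disk z -> @is_pseries C_AbsRing C_NormedModule a z (f z)) ->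
  unit_disk z -> exists l, cder f z l /\ @is_pseries C_AbsRing C_NormedModule (dcoef a) z l.
Proof.
  intros Hf Hz; unfold unit_disk in Hz; assert (Hz0 := Cmod_ge_0 z).
  set (d := (1 - Cmod z) / 4).
  (* Three radii between [|z|] and 1: [w] stays within [r1], the factor [n] is absorbed in passing
     to [r2], and the coefficients are bounded on radius [r]. *)
  set (r1 := Cmod z + d); set (r2 := r1 + d); set (r := r2 + d).
  assert (Hd : 0 < d) by (unfold d; lra).
  assert (Hr : r < 1) by (unfold r, r2, r1, d; lra).
  assert (Hr1 : 0 < r1) by (unfold r1; lra).
  assert (Hr2 : r1 < r2) by (unfold r2; lra).
  assert (Hr3 : r2 < r) by (unfold r; lra).
  destruct (pseries_coef_bound a r (f (RtoC r)) ltac:(lra)) as [B HB].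
  { apply Hf; unfold unit_disk; rewrite Cmod_R, Rabs_pos_eq; lra. }
  assert (HB0 : 0 <= B).
  { apply Rle_trans with (2 := HB 0%nat), Rmult_le_pos; [apply Cmod_ge_0|apply pow_le; lra]. }
  set (u := fun w n => (a n * diffq z w n)%C).
  set (L := r2 / (r1 * (r2 / r1 - 1))).
  assert (HL : 0 <= L).
  { assert (A := nat_pow_geom_bound r1 r2 0 (conj Hr1 Hr2)); fold L in A; simpl in A; lra. }
  set (q := r2 / r).
  assert (Hq : 0 < q < 1).
  { unfold q; split; [apply Rdiv_lt_0_compat; lra|].
    apply Rmult_lt_reg_r with r; [lra|]; unfold Rdiv; rewrite Rmult_assoc, Rinv_l; lra. }
  set (K := B * (L / r2)).
  assert (HK : 0 <= K).
  { apply Rmult_le_pos; [exact HB0|]; apply Rmult_le_pos; [exact HL|left; apply Rinv_0_lt_compat; lra]. }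
  assert (Hu : forall w, Cmod w <= r1 -> forall n, Cmod (u w n) <= K * q ^ n).
  { intros w Hw [|n]; unfold u.
    - simpl; rewrite Cmult_0_r, Cmod_0; lra.
    - rewrite Cmod_mult.
      assert (A := diffq_bound z w r1 n ltac:(unfold r1; lra) Hw).
      assert (A' := nat_pow_geom_bound r1 r2 n (conj Hr1 Hr2)); fold L in A'.
      apply Rle_trans with (Cmod (a (S n)) * (L * r2 ^ n)).
      { apply Rmult_le_compat_l; [apply Cmod_ge_0|lra]. }
      replace (Cmod (a (S n)) * (L * r2 ^ n)) with (Cmod (a (S n)) * r ^ S n * (L / r2 * q ^ S n)).
      2: { unfold q, Rdiv; rewrite Rpow_mult_distr, pow_inv; simpl; field.
           repeat split; try lra; apply pow_nonzero; lra. }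
      replace (K * q ^ S n) with (B * (L / r2 * q ^ S n)) by (unfold K; ring).
      apply Rmult_le_compat_r; [|apply HB].
      apply Rmult_le_pos; [apply Rmult_le_pos; [exact HL|left; apply Rinv_0_lt_compat; lra]|apply pow_le; lra]. }
  assert (Hq0 : 0 <= q < 1) by lra.
  assert (HT : forall eps, 0 < eps -> exists N, forall n, (N <= n)%nat -> K * q ^ n / (1 - q) < eps).
  { intros eps Heps.
    assert (Hq1 : Rabs q < 1) by (rewrite Rabs_pos_eq; lra).
    assert (He : 0 < eps * (1 - q) / (K + 1)) by (apply Rdiv_lt_0_compat; [apply Rmult_lt_0_compat|]; lra).
    destruct (pow_lt_1_zero q Hq1 _ He) as [N HN]; exists N; intros n Hn; specialize (HN n Hn).
    rewrite Rabs_pos_eq in HN by (apply pow_le; lra).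
    apply Rmult_lt_reg_r with (1 - q); [lra|].
    replace (K * q ^ n / (1 - q) * (1 - q)) with (K * q ^ n) by (field; lra).
    apply Rle_lt_trans with (K * (eps * (1 - q) / (K + 1))).
    - apply Rmult_le_compat_l; lra.
    - apply Rmult_lt_reg_r with (K + 1); [lra|].
      replace (K * (eps * (1 - q) / (K + 1)) * (K + 1)) with (K * (eps * (1 - q))) by (field; lra).
      assert (0 < eps * (1 - q)) by (apply Rmult_lt_0_compat; lra); nra. }
  assert (Hzr : Cmod z <= r1) by (unfold r1; lra).
  exists (clim (u z)); split.
  - exists (fun w => clim (u w)); split; [|split; [reflexivity|]].
    + intros eps Heps.
      destruct (HT (eps / 3) ltac:(lra)) as [N HN].
      assert (Hc : ccont (fun w => csum (u w) N) z).
      { clear; induction N as [|N IH]; simpl; [apply cont_const|].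
        apply cont_plus; [exact IH|]; unfold u; apply cont_mult; [apply cont_const|apply diffq_cont]. }
      destruct (Hc (eps / 3) ltac:(lra)) as [d' [Hd' Hc']].
      exists (Rmin d d'); split; [apply Rmin_pos; assumption|]; intros w Hw.
      assert (Hw1 : Cmod w <= r1).
      { unfold idC in Hw; assert (A := Rlt_le_trans _ _ _ Hw (Rmin_l _ _)).
        generalize (Cmod_reverse w z); unfold r1; lra. }
      assert (A := Hc' w (Rlt_le_trans _ _ _ Hw (Rmin_r _ _))).
      assert (A1 := csum_clim (u w) K q N (Hu w Hw1) Hq0).
      assert (A2 := csum_clim (u z) K q N (Hu z Hzr) Hq0).
      assert (A3 := HN N (Nat.le_refl N)).
      replace (clim (u w) - clim (u z))%C with
        ((csum (u w) N - csum (u z) N) - (csum (u w) N - clim (u w)) + (csum (u z) N - clim (u z)))%C by ring.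
      apply Rle_lt_trans with (1 := Cmod_triangle _ _).
      apply Rle_lt_trans with (1 := Rplus_le_compat_r _ _ _ (Cmod_triangle_minus _ _)); lra.
    + exists d; split; [exact Hd|]; intros w Hw; unfold idC in *.
      assert (Hw1 : Cmod w <= r1) by (generalize (Cmod_reverse w z); unfold r1; lra).
      apply pseries_unique with a w; [apply Hf; unfold unit_disk; lra|].
      assert (Hfz := Hf z Hz); rewrite is_pseries_psum in Hfz; apply is_pseries_psum.
      intros eps Heps; destruct (Hfz (eps / 2) ltac:(lra)) as [N1 H1].
      assert (Hp : 0 < Cmod (w - z)%C + 1) by (generalize (Cmod_ge_0 (w - z)%C); lra).
      destruct (HT (eps / 2 / (Cmod (w - z)%C + 1))) as [N2 H2]; [apply Rdiv_lt_0_compat; lra|].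
      exists (N1 + N2)%nat; intros n Hn; specialize (H1 n ltac:(lia)); specialize (H2 n ltac:(lia)).
      assert (E : psum a w n = (psum a z n + csum (u w) n * (w - z))%C).
      { clear - n; induction n as [|n IH]; simpl; [ring|].
        rewrite IH; change (u w n) with (a n * diffq z w n)%C.
        transitivity (psum a z n + csum (u w) n * (w - z) + a n * (z ^ n + (w ^ n - z ^ n)))%C; [ring|].
        rewrite <- diffq_spec; ring. }
      rewrite E.
      replace (psum a z n + csum (u w) n * (w - z) - (f z + clim (u w) * (w - z)))%C
        with ((psum a z n - f z) + (csum (u w) n - clim (u w)) * (w - z))%C by ring.
      apply Rle_lt_trans with (1 := Cmod_triangle _ _); rewrite Cmod_mult.
      assert (A := csum_clim (u w) K q n (Hu w Hw1) Hq0).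
      assert (A' : Cmod (csum (u w) n - clim (u w))%C * Cmod (w - z)%C <= eps / 2).
      { apply Rle_trans with (eps / 2 / (Cmod (w - z)%C + 1) * Cmod (w - z)%C).
        - apply Rmult_le_compat_r; [apply Cmod_ge_0|lra].
        - apply Rmult_le_reg_r with (Cmod (w - z)%C + 1); [exact Hp|].
          replace (eps / 2 / (Cmod (w - z)%C + 1) * Cmod (w - z)%C * (Cmod (w - z)%C + 1))
            with (eps / 2 * Cmod (w - z)%C) by (field; lra).
          generalize (Cmod_ge_0 (w - z)%C); nra. }
      lra.
  - apply is_pseries_psum; intros eps Heps; destruct (HT eps Heps) as [N HN].
    exists N; intros n Hn.
    (* [diffq z z 0 = 0], so the first [S n] slope terms are the first [n] terms of the
       differentiated series. *)
    replace (psum (dcoef a) z n) with (csum (u z) (S n)).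
    + apply Rle_lt_trans with (1 := csum_clim (u z) K q (S n) (Hu z Hzr) Hq0).
      apply HN; lia.
    + clear; induction n as [|n IH].
      * simpl; unfold u; simpl; ring.
      * change (csum (u z) (S (S n))) with (csum (u z) (S n) + u z (S n))%C; rewrite IH.
        simpl psum; unfold u; rewrite diffq_diag; unfold dcoef; ring.
Qed.

Definition has_expansion (a : nat -> C) (f : C -> C) : Prop :=
  forall z, unit_disk z -> @is_pseries C_AbsRing C_NormedModule a z (f z).

Lemma expansion_derive a f : has_expansion a f -> has_expansion (dcoef a) (C_derive f).
Proof.
  intros H z Hz; destruct (pseries_der a f z H Hz) as [l [Hl Hs]].
  rewrite (cder_C_derive _ _ _ Hl); exact Hs.
Qed.

Lemma expansion_cder a f z : has_expansion a f -> unit_disk z -> cder f z (C_derive f z).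
Proof.
  intros H Hz; destruct (pseries_der a f z H Hz) as [l [Hl Hs]].
  rewrite (cder_C_derive _ _ _ Hl); exact Hl.
Qed.

Lemma expansion_hol a f : has_expansion a f -> hol f.
Proof.
  intros H z Hz; split; [apply (expansion_cder a); assumption|].
  exact (der_cont _ _ _ _ (expansion_cder _ _ _ (expansion_derive _ _ H) Hz)).
Qed.

Lemma hol_expansion f : hol f -> has_expansion (taylor_coef f) f.
Proof. intros Hf z Hz; apply taylor; assumption. Qed.

Lemma hol_C_derive f : hol f -> hol (C_derive f).
Proof. intros H; apply (expansion_hol _ _ (expansion_derive _ _ (hol_expansion f H))). Qed.

Lemma expansion_0 (a : nat -> C) (f : C -> C) : has_expansion a f -> f 0 = a 0%nat.
Proof. intros H; apply pseries_unique with a (RtoC 0); [apply H, unit_disk_0|apply pseries_0]. Qed.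

Lemma expansion_1 (a : nat -> C) (f : C -> C) : has_expansion a f -> C_derive f 0 = a 1%nat.
Proof.
  intros H; rewrite (expansion_0 _ _ (expansion_derive _ _ H)); unfold dcoef; simpl; ring.
Qed.

Lemma expansion_2 (a : nat -> C) (f : C -> C) : has_expansion a f -> C_derive (C_derive f) 0 = (2 * a 2%nat)%C.
Proof.
  intros H; rewrite (expansion_1 _ _ (expansion_derive _ _ H)); unfold dcoef; simpl.
  rewrite RtoC_plus; ring.
Qed.

(** * Division by z *)

Definition divz (f : C -> C) (z : C) : C :=
  if Ceq_dec z 0 then C_derive f 0 else (f z / z)%C.

Lemma divz_spec (f : C -> C) (z : C) : f 0 = 0 -> f z = (z * divz f z)%C.
Proof.
  intros H0; unfold divz; destruct (Ceq_dec z 0) as [->|N]; [rewrite H0; ring|field; exact N].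
Qed.

Lemma divz_0 (f : C -> C) : divz f 0 = C_derive f 0.
Proof. unfold divz; destruct (Ceq_dec (RtoC 0) (RtoC 0)); congruence. Qed.

Lemma divz_neq (f : C -> C) (z : C) : z <> 0 -> divz f z = (f z / z)%C.
Proof. intros H; unfold divz; destruct (Ceq_dec z 0); congruence. Qed.

(** Dividing by [z] shifts the Taylor coefficients by one, so the filled-in quotient is again the
    sum of a power series. *)
Lemma hol_divz (f : C -> C) : hol f -> f 0 = 0 -> hol (divz f).
Proof.
  intros Hf H0; set (a := taylor_coef f); assert (Ha := hol_expansion f Hf); fold a in Ha.
  apply (expansion_hol (fun n => a (S n))); intros z Hz.
  destruct (Ceq_dec z 0) as [->|N].
  - rewrite divz_0, (expansion_1 a f Ha); apply (pseries_0 (fun n => a (S n))).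
  - rewrite divz_neq by exact N.
    assert (Hs := Ha z Hz); rewrite is_pseries_psum in Hs; apply is_pseries_psum.
    assert (Np := N); apply Cmod_gt_0 in Np.
    intros eps Heps; destruct (Hs (eps * Cmod z)) as [M HM]; [apply Rmult_lt_0_compat; assumption|].
    exists M; intros n Hn; specialize (HM (S n) ltac:(lia)).
    assert (Ea : a 0%nat = 0) by (rewrite <- (expansion_0 a f Ha); exact H0).
    assert (E : psum a z (S n) = (z * psum (fun n => a (S n)) z n)%C).
    { clear - Ea; induction n as [|n IH]; [simpl; rewrite Ea; ring|].
      change (psum a z (S (S n))) with (psum a z (S n) + a (S n) * z ^ S n)%C.
      rewrite IH; simpl; ring. }
    rewrite E in HM.
    replace (z * psum (fun n => a (S n)) z n - f z)%C
      with (z * (psum (fun n => a (S n)) z n - f z / z))%C in HM by (field; exact N).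
    rewrite Cmod_mult, Rmult_comm in HM; apply Rmult_lt_reg_r in HM; assumption.
Qed.

(** * The maximum principle and the Schwarz lemma *)

(** A constant independent of [n] disappears under [n]-th roots; Bernoulli's inequality plays the
    part of the roots. *)
Lemma le_of_pow_bound (x M K : R) : 0 <= x -> 0 <= M ->
  (forall n, x ^ n <= K * M ^ n) -> x <= M.
Proof.
  intros Hx HM H; apply Rnot_lt_le; intros L.
  destruct HM as [HM|<-].
  2: { specialize (H 1%nat); simpl in H; lra. }
  set (h := x / M - 1).
  assert (Hh : 0 < h).
  { unfold h; apply Rmult_lt_reg_r with M; [exact HM|].
    replace ((x / M - 1) * M) with (x - M) by (field; lra); lra. }
  assert (E : x = (1 + h) * M) by (unfold h; field; lra).
  destruct (INR_unbounded (K / h)) as [n Hn].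
  specialize (H n); rewrite E, Rpow_mult_distr in H.
  assert (HMn : 0 < M ^ n) by (apply pow_lt, HM).
  apply Rmult_le_reg_r in H; [|exact HMn].
  assert (A := pow_ge_linear h n Hh).
  assert (B : K < INR n * h).
  { apply Rmult_lt_reg_r with (/ h); [apply Rinv_0_lt_compat, Hh|].
    rewrite Rmult_assoc, Rinv_r by lra; unfold Rdiv in Hn; lra. }
  lra.
Qed.

Lemma circle_kernel_bound r t (z : C) : Cmod z < r ->
  Cmod (RtoC r * eit t / (RtoC r * eit t - z))%C <= r / (r - Cmod z).
Proof.
  intros Hz; assert (H0 := Cmod_ge_0 z).
  rewrite Cmod_div by (apply circle_minus_neq, Hz); rewrite Cmod_circle by lra.
  apply Rmult_le_compat_l; [lra|]; apply Rinv_le_contravar; [lra|].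
  generalize (Cmod_reverse (RtoC r * eit t)%C z); rewrite Cmod_circle by lra; lra.
Qed.

Lemma rcont_kernel r t (z : C) : Cmod z < r ->
  rcont (fun t => RtoC r * eit t / (RtoC r * eit t - z))%C t.
Proof.
  intros Hz; apply cont_div; [apply rcont_circle| |apply circle_minus_neq, Hz].
  apply cont_minus; [apply rcont_circle|apply cont_const].
Qed.

(** The Cauchy formula alone loses the factor [r / (r - |z|)]. Applied to [f^n] it loses the same
    factor for every [n], and [le_of_pow_bound] removes it. *)
Lemma max_principle f r M (z : C) : hol f -> Cmod z < r < 1 ->
  (forall t, Cmod (f (RtoC r * eit t)%C) <= M) -> Cmod (f z) <= M.
Proof.
  intros Hf Hr HM; assert (H0 := Cmod_ge_0 z).
  assert (HM0 : 0 <= M) by (apply Rle_trans with (2 := HM 0), Cmod_ge_0).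
  apply le_of_pow_bound with (r / (r - Cmod z)); [apply Cmod_ge_0|exact HM0|]; intros n.
  apply Rmult_le_reg_l with (2 * PI); [apply two_pi_pos|].
  rewrite <- Cmod_pow.
  rewrite <- (Rabs_pos_eq (2 * PI)) at 1 by (left; apply two_pi_pos).
  rewrite <- Cmod_R, <- Cmod_mult.
  rewrite <- (cauchy_formula (fun z => f z ^ n)%C z r); [|apply hol_pow, Hf|exact Hr].
  apply Cmod_cint_le_const.
  - intros t; apply cont_mult; [|apply rcont_kernel; lra].
    apply (hol_rcont (fun z => f z ^ n)%C); [apply hol_pow, Hf|lra].
  - intros t; rewrite Cmod_mult, Cmod_pow, Rmult_comm.
    apply Rmult_le_compat; [apply Cmod_ge_0|apply pow_le, Cmod_ge_0| |].
    + apply circle_kernel_bound; lra.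
    + apply pow_incr; split; [apply Cmod_ge_0|apply HM].
Qed.

Lemma mean_value_Re f r : hol f -> 0 <= r < 1 ->
  @eq R (RInt (fun t => Re (f (RtoC r * eit t)%C)) 0 (2 * PI)) (2 * PI * Re (f 0)).
Proof.
  intros Hf Hr; assert (E := f_equal Re (mean_value f r Hf Hr)).
  rewrite re_scal_l in E; exact E.
Qed.

(** The real part of [1 - f] is nonnegative and has mean zero on every circle, which makes [1 - f]
    small in mean; the Cauchy formula carries this to the point [z]. *)
Lemma max_modulus_rigidity f : hol f -> (forall z, unit_disk z -> Cmod (f z) <= 1) ->
  f 0 = 1 -> forall z, unit_disk z -> f z = 1.
Proof.
  intros Hf H1 H0 z Hz; unfold unit_disk in Hz; assert (Hz0 := Cmod_ge_0 z).
  set (r := (1 + Cmod z) / 2); assert (Hr : Cmod z < r < 1) by (unfold r; lra).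
  set (g := fun z => (1 - f z)%C).
  assert (Hg : hol g) by (apply hol_minus; [apply hol_const|exact Hf]).
  set (K := r / (r - Cmod z)).
  assert (HK : 0 < K) by (apply Rdiv_lt_0_compat; lra).
  apply C_eq_of_small with (K / 2); intros eps Heps.
  rewrite Cmod_minus_rev.
  apply Rmult_le_reg_l with (2 * PI); [apply two_pi_pos|].
  rewrite <- (Rabs_pos_eq (2 * PI)) at 1 by (left; apply two_pi_pos).
  rewrite <- Cmod_R, <- Cmod_mult.
  change (1 - f z)%C with (g z); rewrite <- (cauchy_formula g z r Hg Hr).
  assert (Hc : forall t, rcont (fun t => g (RtoC r * eit t) * (RtoC r * eit t / (RtoC r * eit t - z)))%C t).
  { intros t; apply cont_mult; [apply hol_rcont; [exact Hg|lra]|apply rcont_kernel; lra]. }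
  apply Rle_trans with (1 := Cmod_cint_le _ Hc).
  (* AM-GM: [|g| <= eps / 2 + |g|^2 / (2 eps)] and [|g|^2 <= 2 Re g], whose mean vanishes. *)
  apply Rle_trans with (RInt (fun t => K * (eps / 2) * 1 + K / eps * Re (g (RtoC r * eit t)%C)) 0 (2 * PI)).
  - apply RInt_le; [left; apply two_pi_pos|apply rcont_ex_RInt_Cmod, Hc| |].
    + apply (ex_RInt_plus (V := R_NormedModule)); apply (ex_RInt_scal (V := R_NormedModule)).
      * apply ex_RInt_const.
      * apply (rcont_ex_RInt (fun t => g (RtoC r * eit t)%C)); intros; apply hol_rcont; [exact Hg|lra].
    + intros t _; rewrite Cmod_mult.
      apply Rle_trans with (Cmod (g (RtoC r * eit t)%C) * K).
      { apply Rmult_le_compat_l; [apply Cmod_ge_0|apply circle_kernel_bound; lra]. }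
      set (w := f (RtoC r * eit t)%C).
      assert (Hw : Cmod w <= 1) by (apply H1, circle_in_disk; lra).
      change (g (RtoC r * eit t)%C) with (1 - w)%C; set (x := Cmod (1 - w)%C).
      assert (Hx : x * x <= 2 * Re (1 - w)%C).
      { assert (A := Cmod2_alt w); assert (B := Cmod2_alt (1 - w)%C).
        fold x in B; rewrite Re_minus, Im_minus, re_RtoC, im_RtoC in *.
        assert (Cmod w ^ 2 <= 1) by (generalize (Cmod_ge_0 w); simpl; nra).
        simpl in *; nra. }
      assert (Hx' : x <= eps / 2 + x * x / (2 * eps)).
      { apply Rmult_le_reg_r with (2 * eps); [lra|].
        replace ((eps / 2 + x * x / (2 * eps)) * (2 * eps)) with (eps * eps + x * x) by (field; lra).
        assert (A := Rle_0_sqr (x - eps)); unfold Rsqr in A; lra. }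
      replace (K * (eps / 2) * 1 + K / eps * Re (1 - w)%C)
        with (K * (eps / 2 + 2 * Re (1 - w)%C / (2 * eps))) by (field; lra).
      rewrite Rmult_comm; apply Rmult_le_compat_l; [lra|].
      apply Rle_trans with (1 := Hx'), Rplus_le_compat_l.
      apply Rmult_le_compat_r; [left; apply Rinv_0_lt_compat; lra|exact Hx].
  - rewrite RInt_lin.
    + rewrite (mean_value_Re g r Hg) by lra; rewrite RInt_const_R.
      unfold g; rewrite H0; replace (Re (1 - 1)%C) with 0 by (unfold Re; simpl; ring).
      right; field; lra.
    + apply ex_RInt_const.
    + apply (rcont_ex_RInt (fun t => g (RtoC r * eit t)%C)); intros; apply hol_rcont; [exact Hg|lra].
Qed.

Lemma Cmod_le_1_of_mult f (z : C) : hol f -> (forall z, unit_disk z -> Cmod z * Cmod (f z) <= 1) ->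
  unit_disk z -> Cmod (f z) <= 1.
Proof.
  intros Hf H Hz; unfold unit_disk in Hz; assert (Hz0 := Cmod_ge_0 z).
  assert (A : forall r, Cmod z < r < 1 -> Cmod (f z) <= 1 / r).
  { intros r Hr; apply max_principle with r; [exact Hf|exact Hr|]; intros t.
    assert (B := H _ (circle_in_disk r t ltac:(lra))); rewrite Cmod_circle in B by lra.
    apply Rmult_le_reg_l with r; [lra|]; replace (r * (1 / r)) with 1 by (field; lra); exact B. }
  apply Rnot_lt_le; intros L.
  (* If [|f z| > 1], a radius beyond both [|z|] and [1 / |f z|] contradicts [A]. *)
  set (r := Rmax ((1 + Cmod z) / 2) ((1 + / Cmod (f z)) / 2)).
  assert (Hi : / Cmod (f z) < 1) by (rewrite <- Rinv_1; apply Rinv_lt_contravar; lra).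
  assert (Hr : r < 1) by (apply Rmax_lub_lt; lra).
  assert (Hr1 : (1 + Cmod z) / 2 <= r) by apply Rmax_l.
  assert (Hr2 : (1 + / Cmod (f z)) / 2 <= r) by apply Rmax_r.
  specialize (A r ltac:(lra)).
  assert (B : Cmod (f z) * r <= 1).
  { apply Rmult_le_reg_r with (/ r); [apply Rinv_0_lt_compat; lra|].
    rewrite Rmult_assoc, Rinv_r by lra; lra. }
  assert (E : Cmod (f z) * / Cmod (f z) = 1) by (apply Rinv_r; lra).
  nra.
Qed.

Lemma schwarz_divz f (z : C) : hol f -> f 0 = 0 -> (forall z, unit_disk z -> Cmod (f z) <= 1) ->
  unit_disk z -> Cmod (divz f z) <= 1.
Proof.
  intros Hf H0 H1 Hz; apply Cmod_le_1_of_mult; [apply hol_divz; assumption| |exact Hz].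
  intros w Hw; rewrite <- Cmod_mult, <- divz_spec by exact H0; apply H1, Hw.
Qed.

Lemma schwarz f (z : C) : hol f -> f 0 = 0 -> (forall z, unit_disk z -> Cmod (f z) <= 1) ->
  unit_disk z -> Cmod (f z) <= Cmod z.
Proof.
  intros Hf H0 H1 Hz; rewrite (divz_spec f z H0), Cmod_mult.
  assert (A := schwarz_divz f z Hf H0 H1 Hz); generalize (Cmod_ge_0 z); nra.
Qed.

Lemma schwarz_derive f : hol f -> f 0 = 0 -> (forall z, unit_disk z -> Cmod (f z) <= 1) ->
  Cmod (C_derive f 0) <= 1.
Proof.
  intros Hf H0 H1; rewrite <- divz_0; apply schwarz_divz; [assumption..|apply unit_disk_0].
Qed.

(** The quotient [divz f], divided by [f'(0)], is bounded by 1 and takes the value 1 at the origin,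
    so rigidity makes it constant. *)
Lemma schwarz_equality f (z : C) : hol f -> f 0 = 0 -> (forall z, unit_disk z -> Cmod (f z) <= 1) ->
  Cmod (C_derive f 0) = 1 -> unit_disk z -> f z = (C_derive f 0 * z)%C.
Proof.
  intros Hf H0 H1 Hd Hz; set (c := C_derive f 0) in *.
  assert (Hc : c <> 0) by (apply Cmod_neq_0; lra).
  rewrite (divz_spec f z H0), Cmult_comm; f_equal.
  assert (E : (/ c * divz f z)%C = 1).
  { apply (max_modulus_rigidity (fun z => / c * divz f z)%C); [|intros w Hw| |exact Hz].
    - apply hol_scal, hol_divz; assumption.
    - rewrite Cmod_mult, Cmod_inv, Hd, Rinv_1, Rmult_1_l by exact Hc.
      apply schwarz_divz; assumption.
    - rewrite divz_0; fold c; field; exact Hc. }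
  replace (divz f z) with (c * (/ c * divz f z))%C by (field; exact Hc).
  rewrite E; ring.
Qed.

(** * Logarithm and powers on the right half-plane *)

Definition cexp (z : C) : C := (RtoC (exp (Re z)) * eit (Im z))%C.

Lemma eit_plus s t : eit (s + t) = (eit s * eit t)%C.
Proof.
  unfold eit; rewrite cos_plus, sin_plus; apply injective_projections; simpl; ring.
Qed.

Lemma eit_0 : eit 0 = 1.
Proof. unfold eit; rewrite cos_0, sin_0; reflexivity. Qed.

Lemma cexp_plus a b : cexp (a + b)%C = (cexp a * cexp b)%C.
Proof.
  unfold cexp; rewrite re_plus; replace (Im (a + b)%C) with (Im a + Im b) by (unfold Im; simpl; ring).
  rewrite exp_plus, eit_plus, RtoC_mult; ring.
Qed.

Lemma Cmod_cexp z : Cmod (cexp z) = exp (Re z).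
Proof.
  unfold cexp; rewrite Cmod_mult, Cmod_eit, Cmod_R, Rabs_pos_eq; [ring|left; apply exp_pos].
Qed.

Lemma cexp_neq_0 z : cexp z <> 0.
Proof. apply Cmod_neq_0; rewrite Cmod_cexp; apply exp_pos. Qed.

Lemma cexp_0 : cexp 0 = 1.
Proof.
  unfold cexp; rewrite re_RtoC, im_RtoC, exp_0, eit_0; ring.
Qed.

Lemma cder_of_bound f (z l : C) :
  (forall eps, 0 < eps -> exists d, 0 < d /\ forall w, Cmod (w - z)%C < d ->
     Cmod (f w - f z - (w - z) * l)%C <= eps * Cmod (w - z)%C) -> cder f z l.
Proof.
  intros H; apply cder_is_derive; split; [apply is_linear_scal_l|].
  intros x Hx eps.
  assert (E : z = x)
    by (apply (is_filter_lim_locally_unique (V := AbsRing_NormedModule C_AbsRing) z x), Hx); subst x.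
  destruct (H eps (cond_pos eps)) as [d [Hd H']].
  apply (locally_le_locally_norm (V := AbsRing_NormedModule C_AbsRing)).
  exists (mkposreal _ Hd); intros y Hy; exact (H' y Hy).
Qed.

Lemma cder_cexp_0 : cder cexp 0 1.
Proof.
  assert (H1 : rder (fun x => RtoC (exp x)) 0 (RtoC 1)).
  { apply is_derive_rder; generalize (is_derive_exp 0); rewrite exp_0; auto. }
  assert (H2 : rder eit 0 Ci).
  { apply der_eq with (1 := rder_eit 0); rewrite eit_0; ring. }
  destruct H1 as [p [Hp [Hp0 [d1 [Hd1 H1]]]]], H2 as [q [Hq [Hq0 [d2 [Hd2 H2]]]]].
  apply cder_of_bound; intros eps Heps.
  (* The three error terms below contribute [e], [e] and [4 * e] times [|w|], hence the 6. *)
  set (e := Rmin 1 (eps / 6)).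
  assert (He : 0 < e) by (apply Rmin_pos; lra).
  assert (He1 : e <= 1) by apply Rmin_l.
  assert (He2 : e <= eps / 6) by apply Rmin_r.
  clearbody e.
  destruct (Hp e He) as [d3 [Hd3 H3]], (Hq e He) as [d4 [Hd4 H4]].
  exists (Rmin e (Rmin (Rmin d1 d2) (Rmin d3 d4))); split; [repeat apply Rmin_pos; assumption|].
  intros w Hw; replace (w - 0)%C with w in * by ring.
  set (x := Re w); set (y := Im w).
  assert (Hx : Rabs x <= Cmod w) by apply re_le_Cmod.
  assert (Hy : Rabs y <= Cmod w) by apply Im_le_Cmod.
  assert (Hwe := Rlt_le_trans _ _ _ Hw (Rmin_l _ _)).
  assert (Hw' := Rlt_le_trans _ _ _ Hw (Rmin_r _ _)).
  assert (Hw12 := Rlt_le_trans _ _ _ Hw' (Rmin_l _ _)).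
  assert (Hw34 := Rlt_le_trans _ _ _ Hw' (Rmin_r _ _)).
  assert (Hw1 := Rlt_le_trans _ _ _ Hw12 (Rmin_l _ _)).
  assert (Hw2 := Rlt_le_trans _ _ _ Hw12 (Rmin_r _ _)).
  assert (Hw3 := Rlt_le_trans _ _ _ Hw34 (Rmin_l _ _)).
  assert (Hw4 := Rlt_le_trans _ _ _ Hw34 (Rmin_r _ _)).
  assert (Es : forall s : R, Cmod (RtoC s - RtoC 0)%C = Rabs s).
  { intros s; rewrite <- RtoC_minus, Cmod_R, Rminus_0_r; reflexivity. }
  assert (E1 := H1 x ltac:(rewrite Es; lra)); assert (E2 := H2 y ltac:(rewrite Es; lra)).
  assert (B3 := H3 x ltac:(rewrite Es; lra)); assert (B4 := H4 y ltac:(rewrite Es; lra)).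
  rewrite cexp_0; unfold cexp; fold x y; rewrite E1, E2, exp_0, eit_0.
  rewrite Hp0 in B3; rewrite Hq0 in B4.
  assert (Ew : w = (RtoC x + Ci * RtoC y)%C)
    by (apply injective_projections; unfold x, y, Re, Im; simpl; ring).
  replace ((RtoC 1 + p x * (RtoC x - RtoC 0)) * (1 + q y * (RtoC y - RtoC 0)) - 1 - w * 1)%C
    with ((p x - RtoC 1) * RtoC x + (q y - Ci) * RtoC y
      + (RtoC 1 + (p x - RtoC 1)) * (Ci + (q y - Ci)) * (RtoC x * RtoC y))%C
    by (rewrite Ew at 1; ring).
  apply Rle_trans with (1 := Cmod_triangle _ _).
  apply Rle_trans with (1 := Rplus_le_compat_r _ _ _ (Cmod_triangle _ _)).
  rewrite !Cmod_mult, !Cmod_R.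
  assert (C1 := Cmod_triangle (RtoC 1) (p x - RtoC 1)%C).
  assert (C2 := Cmod_triangle Ci (q y - Ci)%C).
  rewrite Cmod_R, Rabs_R1 in C1; rewrite Cmod_Ci in C2.
  assert (P : Cmod (1 + (p x - 1))%C * Cmod (Ci + (q y - Ci))%C <= 4).
  { replace 4 with (2 * 2) by ring; apply Rmult_le_compat; try apply Cmod_ge_0; lra. }
  assert (Px := Rabs_pos x); assert (Py := Rabs_pos y).
  assert (Q1 : Cmod (p x - 1)%C * Rabs x <= e * Cmod w)
    by (apply Rmult_le_compat; [apply Cmod_ge_0|exact Px|lra|exact Hx]).
  assert (Q2 : Cmod (q y - Ci)%C * Rabs y <= e * Cmod w)
    by (apply Rmult_le_compat; [apply Cmod_ge_0|exact Py|lra|exact Hy]).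
  assert (Q3 : Rabs x * Rabs y <= e * Cmod w)
    by (apply Rmult_le_compat; try assumption; lra).
  assert (Q4 : Cmod (1 + (p x - 1))%C * Cmod (Ci + (q y - Ci))%C * (Rabs x * Rabs y) <= 4 * (e * Cmod w)).
  { apply Rmult_le_compat; try assumption.
    - apply Rmult_le_pos; apply Cmod_ge_0.
    - apply Rmult_le_pos; assumption. }
  assert (Q5 : e * Cmod w <= eps / 6 * Cmod w)
    by (apply Rmult_le_compat_r; [apply Cmod_ge_0|exact He2]).
  lra.
Qed.

Lemma cder_cexp z : cder cexp z (cexp z).
Proof.
  apply der_ext with (fun w => cexp z * cexp (w - z))%C.
  - intros w; rewrite <- cexp_plus; f_equal; ring.
  - apply der_eq with (cexp z * (1 * (1 - 0)))%C; [|ring].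
    apply der_scal, (der_comp idC cexp (fun w => w - z)%C).
    + apply der_minus; [apply (der_pos idC)|apply der_const].
    + replace (z - z)%C with (RtoC 0) by ring; apply cder_cexp_0.
Qed.

Lemma cont_real_comp {T} (e : T -> C) (g : T -> R) (h : R -> R) x :
  cont e (fun y => RtoC (g y)) x -> continuity_pt h (g x) -> cont e (fun y => RtoC (h (g y))) x.
Proof.
  intros Hg Hh; apply (cont_pullback e RtoC g (fun s => RtoC (h s))); [exact Hg|].
  apply continuity_rcont, Hh.
Qed.

Lemma cont_Re {T} (e f : T -> C) x : cont e f x -> cont e (fun y => RtoC (Re (f y))) x.
Proof.
  intros H eps Heps; destruct (H eps Heps) as [d [Hd H']]; exists d; split; [exact Hd|].
  intros y Hy; rewrite <- RtoC_minus, Cmod_R, <- Re_minus.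
  apply Rle_lt_trans with (1 := re_le_Cmod _), H', Hy.
Qed.

Lemma cont_Im {T} (e f : T -> C) x : cont e f x -> cont e (fun y => RtoC (Im (f y))) x.
Proof.
  intros H eps Heps; destruct (H eps Heps) as [d [Hd H']]; exists d; split; [exact Hd|].
  intros y Hy; rewrite <- RtoC_minus, Cmod_R, <- Im_minus.
  apply Rle_lt_trans with (1 := Im_le_Cmod _), H', Hy.
Qed.

(** The principal argument on the right half-plane, the only region where [carg] and [clog] are used
    as argument and logarithm. *)
Definition carg (w : C) : R := atan (Im w / Re w).
Definition clog (w : C) : C := (ln (Cmod w), carg w).

Lemma carg_bound w : Rabs (carg w) < PI / 2.
Proof. apply Rabs_lt_between; generalize (atan_bound (Im w / Re w)); unfold carg; lra. Qed.

Lemma Re_pos_neq_0 w : 0 < Re w -> w <> 0.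
Proof. intros H ->; rewrite re_RtoC in H; lra. Qed.

Lemma Re_pos_Cmod w : 0 < Re w -> 0 < Cmod w.
Proof. intros H; generalize (Re_le_Cmod w); lra. Qed.

Lemma Cmod_carg w : 0 < Re w -> w = (RtoC (Cmod w) * eit (carg w))%C.
Proof.
  intros H.
  assert (E : Cmod w = Re w * sqrt (1 + Rsqr (Im w / Re w))).
  { rewrite <- (sqrt_Rsqr (Re w)) at 1 by lra.
    rewrite <- sqrt_mult; [|apply Rle_0_sqr|generalize (Rle_0_sqr (Im w / Re w)); lra].
    unfold Cmod; f_equal; unfold Rsqr, Re, Im in *; field; lra. }
  assert (S : 0 < sqrt (1 + Rsqr (Im w / Re w)))
    by (apply sqrt_lt_R0; generalize (Rle_0_sqr (Im w / Re w)); lra).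
  unfold carg, eit; rewrite cos_atan, sin_atan, E.
  apply injective_projections; unfold Re, Im in *; simpl; field; lra.
Qed.

Lemma cexp_clog w : 0 < Re w -> cexp (clog w) = w.
Proof.
  intros H; unfold cexp, clog, Re at 1, Im at 1; simpl.
  rewrite exp_ln by apply Re_pos_Cmod, H; symmetry; apply Cmod_carg, H.
Qed.

Lemma Re_pos_open w : 0 < Re w -> forall u, Cmod (u - w)%C < Re w -> 0 < Re u.
Proof.
  intros H u Hu; generalize (re_le_Cmod (u - w)%C); rewrite Re_minus; intros A.
  apply Rabs_le_between in A; lra.
Qed.

Lemma clog_cont w : 0 < Re w -> ccont clog w.
Proof.
  intros H; apply cont_ext with (fun u => RtoC (ln (Cmod u)) + Ci * RtoC (atan (Im u / Re u)))%C.
  { intros u; unfold clog, carg; apply injective_projections; simpl; ring. }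
  apply cont_plus; [|apply cont_mult; [apply cont_const|]].
  - apply (cont_real_comp idC Cmod ln); [apply (cont_Cmod idC idC), cont_pos|].
    apply derivable_continuous_pt; exists (/ Cmod w); apply derivable_pt_lim_ln, Re_pos_Cmod, H.
  - apply (cont_real_comp idC (fun u => Im u / Re u) atan).
    + apply cont_ext_loc with (fun u => RtoC (Im u) / RtoC (Re u))%C (Re w); [exact H| |].
      * intros u Hu; rewrite RtoC_div; [reflexivity|].
        assert (A := Re_pos_open w H u Hu); lra.
      * apply cont_div; [apply (cont_Im idC idC), cont_pos|apply (cont_Re idC idC), cont_pos|].
        apply RtoC_neq_0; lra.
    + apply derivable_continuous_pt; eexists; apply derivable_pt_lim_atan.
Qed.

Lemma cder_clog w : 0 < Re w -> cder clog w (/ w)%C.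
Proof.
  intros H; rewrite <- (cexp_clog w H) at 2.
  apply (cder_inverse cexp clog w (cexp (clog w)) (Re w)); [exact H| | | |apply cexp_neq_0].
  - intros u Hu; apply cexp_clog, (Re_pos_open w H u Hu).
  - apply clog_cont, H.
  - apply cder_cexp.
Qed.

Definition cpow (w : C) (s : R) : C := cexp (RtoC s * clog w)%C.

Lemma cpow_polar w s : cpow w s = (RtoC (Rpower (Cmod w) s) * eit (s * carg w))%C.
Proof.
  unfold cpow, cexp; rewrite re_scal_l, im_scal_l; unfold clog, Re, Im; simpl; reflexivity.
Qed.

Lemma Cmod_cpow w s : Cmod (cpow w s) = Rpower (Cmod w) s.
Proof. unfold cpow; rewrite Cmod_cexp, re_scal_l; reflexivity. Qed.

Lemma Re_cpow w s : Re (cpow w s) = Rpower (Cmod w) s * cos (s * carg w).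
Proof. rewrite cpow_polar, re_scal_l; reflexivity. Qed.

Lemma cpow_neq_0 w s : cpow w s <> 0.
Proof. apply cexp_neq_0. Qed.

Lemma cpow_plus w s t : cpow w (s + t) = (cpow w s * cpow w t)%C.
Proof. unfold cpow; rewrite <- cexp_plus; f_equal; rewrite RtoC_plus; ring. Qed.

Lemma cpow_1 w : 0 < Re w -> cpow w 1 = w.
Proof. intros H; unfold cpow; rewrite Cmult_1_l; apply cexp_clog, H. Qed.

Lemma cder_cpow w s : 0 < Re w -> cder (fun u => cpow u s) w (RtoC s * cpow w (s - 1))%C.
Proof.
  intros H; apply der_eq with (cpow w s * (RtoC s * / w))%C.
  - apply (der_comp idC cexp (fun u => RtoC s * clog u)%C); [|apply cder_cexp].
    apply der_scal, cder_clog, H.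
  - replace s with (s - 1 + 1) at 1 by ring; rewrite cpow_plus, cpow_1 by exact H.
    field; apply Re_pos_neq_0, H.
Qed.

Lemma hol_cpow f s : hol f -> (forall z, unit_disk z -> 0 < Re (f z)) -> hol (fun z => cpow (f z) s).
Proof.
  intros Hf H.
  apply (hol_comp_image (fun w => cpow w s) (fun w => RtoC s * cpow w (s - 1))%C f Hf).
  intros z Hz; split; [apply cder_cpow, H, Hz|].
  apply cont_mult; [apply cont_const|].
  exact (der_cont _ _ _ _ (cder_cpow (f z) (s - 1) (H z Hz))).
Qed.

Lemma cos_Rabs x : cos (Rabs x) = cos x.
Proof. unfold Rabs; destruct (Rcase_abs x); [apply cos_neg|reflexivity]. Qed.

(** * Means of powers of a function with values in a sector *)

Lemma rcont_Rpower_Cmod f s r t : hol f -> (forall z, unit_disk z -> 0 < Re (f z)) -> 0 <= r < 1 ->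
  rcont (fun t => RtoC (Rpower (Cmod (f (RtoC r * eit t)%C)) s)) t.
Proof.
  intros Hf Hp Hr; apply cont_ext with (fun t => RtoC (Cmod (cpow (f (RtoC r * eit t)%C) s))).
  - intros u; rewrite Cmod_cpow; reflexivity.
  - apply cont_Cmod, (hol_rcont (fun z => cpow (f z) s)); [apply hol_cpow; assumption|exact Hr].
Qed.

(* The real part of the holomorphic function [f^s] dominates [|f|^s cos (s th)],
   and its mean is its value at the centre. *)
Lemma sector_mean f s th r : hol f -> (forall z, unit_disk z -> 0 < Re (f z)) ->
  (forall z, unit_disk z -> Rabs (carg (f z)) <= th) ->
  0 <= s -> s * th < PI / 2 -> 0 <= r < 1 ->
  RInt (fun t => Rpower (Cmod (f (RtoC r * eit t)%C)) s) 0 (2 * PI)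
  <= 2 * PI * Rpower (Cmod (f 0)) s / cos (s * th).
Proof.
  intros Hf Hp Hth Hs Hsth Hr.
  assert (Hth0 : 0 <= th) by (apply Rle_trans with (2 := Hth 0 unit_disk_0), Rabs_pos).
  assert (Hst0 : 0 <= s * th) by (apply Rmult_le_pos; assumption).
  assert (Hcos : 0 < cos (s * th)) by (apply cos_gt_0; lra).
  set (h := fun z => cpow (f z) s).
  assert (Hh : hol h) by (apply hol_cpow; assumption).
  apply Rmult_le_reg_r with (cos (s * th)); [exact Hcos|].
  replace (2 * PI * Rpower (Cmod (f 0)) s / cos (s * th) * cos (s * th))
    with (2 * PI * Rpower (Cmod (f 0)) s) by (field; lra).
  assert (Hex : ex_RInt (fun t => Rpower (Cmod (f (RtoC r * eit t)%C)) s) 0 (2 * PI)).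
  { apply (rcont_ex_RInt (fun t => RtoC (Rpower (Cmod (f (RtoC r * eit t)%C)) s))).
    intros; apply rcont_Rpower_Cmod; assumption. }
  apply Rle_trans with (RInt (fun t => Re (h (RtoC r * eit t)%C)) 0 (2 * PI)).
  - rewrite Rmult_comm.
    assert (E := RInt_scal (V := R_CompleteNormedModule) _ 0 (2 * PI) (cos (s * th)) Hex).
    apply Rle_trans with (1 := Req_le _ _ (eq_sym E)).
    apply RInt_le; [left; apply two_pi_pos| | |].
    + apply (ex_RInt_scal (V := R_NormedModule)), Hex.
    + apply (rcont_ex_RInt (fun t => h (RtoC r * eit t)%C)); intros; apply hol_rcont; assumption.
    + intros t _; unfold h; rewrite Re_cpow; unfold scal; simpl; unfold mult; simpl.
      rewrite Rmult_comm; apply Rmult_le_compat_l; [left; apply exp_pos|].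
      rewrite <- (cos_Rabs (s * carg _)), Rabs_mult, (Rabs_pos_eq s) by exact Hs.
      assert (A := Hth _ (circle_in_disk r t Hr)).
      assert (A' : s * Rabs (carg (f (RtoC r * eit t)%C)) <= s * th)
        by (apply Rmult_le_compat_l; assumption).
      assert (B : 0 <= s * Rabs (carg (f (RtoC r * eit t)%C)))
        by (apply Rmult_le_pos; [exact Hs|apply Rabs_pos]).
      apply cos_decr_1; lra.
  - rewrite mean_value_Re by assumption.
    apply Rmult_le_compat_l; [left; apply two_pi_pos|].
    apply Rle_trans with (1 := Re_le_Cmod _); unfold h; rewrite Cmod_cpow; lra.
Qed.

(** * Integral means *)

Lemma pow_nonneg_pos x p : 0 < x -> pow_nonneg x p = Rpower x p.
Proof. intros H; unfold pow_nonneg; destruct (Rlt_dec 0 x); [reflexivity|contradiction]. Qed.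

Lemma pow_nonneg_nonpos x p : x <= 0 -> pow_nonneg x p = 0.
Proof. intros H; unfold pow_nonneg; destruct (Rlt_dec 0 x); [lra|reflexivity]. Qed.

Lemma pow_nonneg_ge_0 x p : 0 <= pow_nonneg x p.
Proof. unfold pow_nonneg; destruct (Rlt_dec 0 x); [left; apply exp_pos|lra]. Qed.

Lemma pow_nonneg_le x y p : 0 <= p -> x <= y -> pow_nonneg x p <= pow_nonneg y p.
Proof.
  intros Hp Hxy; destruct (Rlt_dec 0 x) as [Hx|Hx].
  - rewrite !pow_nonneg_pos by lra; apply Rle_Rpower_l; lra.
  - rewrite (pow_nonneg_nonpos x) by lra; apply pow_nonneg_ge_0.
Qed.

Lemma pow_nonneg_mult x y p : 0 <= x -> 0 <= y ->
  pow_nonneg (x * y) p = pow_nonneg x p * pow_nonneg y p.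
Proof.
  intros [Hx|<-] [Hy|<-]; rewrite ?Rmult_0_l, ?Rmult_0_r.
  - rewrite !pow_nonneg_pos by (try apply Rmult_lt_0_compat; assumption).
    symmetry; apply Rpower_mult_distr; assumption.
  - rewrite !(pow_nonneg_nonpos 0) by lra; ring.
  - rewrite !(pow_nonneg_nonpos 0) by lra; ring.
  - rewrite !(pow_nonneg_nonpos 0) by lra; ring.
Qed.

Lemma pow_nonneg_continuity p x : 0 < p -> continuity_pt (fun x => pow_nonneg x p) x.
Proof.
  intros Hp; destruct (Rtotal_order x 0) as [L|[->|L]].
  - apply continuity_pt_ext_loc with (fun _ => 0); [|apply continuity_pt_const; intros a b; reflexivity].
    assert (Hx : 0 < - x) by lra.
    exists (mkposreal _ Hx); intros y Hy; symmetry; apply pow_nonneg_nonpos.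
    apply Rabs_lt_between in Hy; simpl in Hy; unfold minus, plus, opp in Hy; simpl in Hy; lra.
  - intros eps Heps; exists (Rpower eps (/ p)); split; [apply exp_pos|].
    intros y [_ Hy]; simpl in *; unfold R_dist in *; rewrite Rminus_0_r in Hy.
    rewrite (pow_nonneg_nonpos 0), Rminus_0_r, Rabs_pos_eq by (lra || apply pow_nonneg_ge_0).
    destruct (Rlt_dec 0 y) as [H|H].
    + rewrite pow_nonneg_pos by exact H; rewrite Rabs_pos_eq in Hy by lra.
      replace eps with (Rpower (Rpower eps (/ p)) p).
      * apply Rlt_Rpower_l; lra.
      * rewrite Rpower_mult, Rinv_l, Rpower_1 by lra; reflexivity.
    + rewrite pow_nonneg_nonpos by lra; exact Heps.
  - apply continuity_pt_ext_loc with (fun y => Rpower y p).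
    + exists (mkposreal _ L); intros y Hy; symmetry; apply pow_nonneg_pos.
      apply Rabs_lt_between in Hy; simpl in Hy; unfold minus, plus, opp in Hy; simpl in Hy; lra.
    + apply derivable_continuous_pt; eexists; apply derivable_pt_lim_power, L.
Qed.

Lemma Rpower_le_rescale u d M p : 0 < d -> 0 < p -> Rpower u d <= M -> Rpower u p <= Rpower M (p / d).
Proof.
  intros Hd Hp H; replace (Rpower u p) with (Rpower (Rpower u d) (p / d)).
  - apply Rle_Rpower_l; [apply Rmult_le_pos; [lra|left; apply Rinv_0_lt_compat, Hd]|].
    split; [apply exp_pos|exact H].
  - rewrite Rpower_mult; f_equal; field; lra.
Qed.

(** Let [M] be the right-hand side. Then [x^p <= M^(p/a)], and likewise for [y] and [z]; the three
    exponents of [M] add up to 1. This weak form of Young's inequality is enough for boundedness. *)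
Lemma Rpower_mult_3_le x y z a b c p : 0 < x -> 0 < y -> 0 < z ->
  0 < a -> 0 < b -> 0 < c -> 0 < p -> p / a + p / b + p / c = 1 ->
  Rpower (x * y * z) p <= Rpower x a + Rpower y b + Rpower z c.
Proof.
  intros Hx Hy Hz Ha Hb Hc Hp E.
  set (M := Rpower x a + Rpower y b + Rpower z c).
  assert (Px := exp_pos (a * ln x)); assert (Py := exp_pos (b * ln y)); assert (Pz := exp_pos (c * ln z)).
  fold (Rpower x a) in Px; fold (Rpower y b) in Py; fold (Rpower z c) in Pz.
  assert (HM : 0 < M) by (unfold M; lra).
  rewrite <- (Rpower_1 M HM), <- E, !Rpower_plus.
  rewrite <- !Rpower_mult_distr by (try apply Rmult_lt_0_compat; assumption).
  apply Rmult_le_compat; [apply Rmult_le_pos; left; apply exp_pos|left; apply exp_pos| |].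
  - apply Rmult_le_compat; [left; apply exp_pos..| |]; apply Rpower_le_rescale; try assumption; unfold M; lra.
  - apply Rpower_le_rescale; try assumption; unfold M; lra.
Qed.

Lemma pow_nonneg_mult_3_le x y z a b c p : 0 <= x -> 0 <= y -> 0 <= z ->
  0 < a -> 0 < b -> 0 < c -> 0 < p -> p / a + p / b + p / c = 1 ->
  pow_nonneg (x * y * z) p <= pow_nonneg x a + pow_nonneg y b + pow_nonneg z c.
Proof.
  intros Hx Hy Hz Ha Hb Hc Hp E.
  assert (H0 := pow_nonneg_ge_0 x a); assert (H1 := pow_nonneg_ge_0 y b); assert (H2 := pow_nonneg_ge_0 z c).
  destruct Hx as [Hx|<-], Hy as [Hy|<-], Hz as [Hz|<-];
    try (rewrite ?Rmult_0_l, ?Rmult_0_r, ?Rmult_0_l, (pow_nonneg_nonpos 0 p) by lra; lra).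
  rewrite !pow_nonneg_pos by (repeat apply Rmult_lt_0_compat; assumption).
  apply Rpower_mult_3_le; assumption.
Qed.

Lemma pow_nonneg_mult_2_le x y a b p : 0 <= x -> 0 <= y ->
  0 < a -> 0 < b -> 0 < p -> p / a + p / b = 1 ->
  pow_nonneg (x * y) p <= pow_nonneg x a + pow_nonneg y b.
Proof.
  intros Hx Hy Ha Hb Hp E.
  assert (H0 := pow_nonneg_ge_0 x a); assert (H1 := pow_nonneg_ge_0 y b).
  destruct Hx as [Hx|<-], Hy as [Hy|<-];
    try (rewrite ?Rmult_0_l, ?Rmult_0_r, (pow_nonneg_nonpos 0 p) by lra; lra).
  rewrite !pow_nonneg_pos by (repeat apply Rmult_lt_0_compat; assumption).
  set (M := Rpower x a + Rpower y b).
  assert (Px := exp_pos (a * ln x)); assert (Py := exp_pos (b * ln y)).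
  fold (Rpower x a) in Px; fold (Rpower y b) in Py.
  assert (HM : 0 < M) by (unfold M; lra).
  rewrite <- (Rpower_1 M HM), <- E, Rpower_plus, <- Rpower_mult_distr by assumption.
  apply Rmult_le_compat; [left; apply exp_pos..| |]; apply Rpower_le_rescale; try assumption; unfold M; lra.
Qed.

Lemma pow_nonneg_plus_le x y p : 0 <= x -> 0 <= y -> 0 < p ->
  pow_nonneg (x + y) p <= Rpower 2 p * (pow_nonneg x p + pow_nonneg y p).
Proof.
  intros Hx Hy Hp.
  assert (A : forall u v, 0 <= u -> u <= v -> pow_nonneg (u + v) p <= Rpower 2 p * pow_nonneg v p).
  { intros u v Hu Huv; rewrite <- (pow_nonneg_pos 2), <- pow_nonneg_mult by lra.
    apply pow_nonneg_le; lra. }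
  assert (H2 := exp_pos (p * ln 2)); fold (Rpower 2 p) in H2.
  assert (H0 := pow_nonneg_ge_0 x p); assert (H1 := pow_nonneg_ge_0 y p).
  destruct (Rle_dec x y) as [L|L].
  - apply Rle_trans with (1 := A x y Hx L); nra.
  - rewrite (Rplus_comm x y); apply Rle_trans with (1 := A y x Hy ltac:(lra)); nra.
Qed.

(** Carried along with the bound on the means, so that every [RInt] in sight is a genuine integral
    to which linearity and monotonicity apply. *)
Definition circ_cont (u : C -> R) : Prop :=
  forall r t, 0 <= r < 1 -> rcont (fun t => RtoC (u (RtoC r * eit t)%C)) t.

Definition mean_bdd (u : C -> R) : Prop :=
  circ_cont u /\ exists M, forall r, 0 <= r < 1 ->
    RInt (fun t => u (RtoC r * eit t)%C) 0 (2 * PI) <= M.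

Lemma circ_cont_ex u r a b : circ_cont u -> 0 <= r < 1 ->
  ex_RInt (fun t => u (RtoC r * eit t)%C) a b.
Proof.
  intros Hu Hr; apply (rcont_ex_RInt (fun t => RtoC (u (RtoC r * eit t)%C))).
  intros; apply Hu, Hr.
Qed.

Lemma circ_cont_lin u v a b : circ_cont u -> circ_cont v -> circ_cont (fun z => a * u z + b * v z).
Proof.
  intros Hu Hv r t Hr.
  apply cont_ext with (fun t => RtoC a * RtoC (u (RtoC r * eit t)%C) + RtoC b * RtoC (v (RtoC r * eit t)%C))%C.
  - intros; rewrite RtoC_plus, !RtoC_mult; reflexivity.
  - apply cont_plus; apply cont_mult; try apply cont_const; [apply Hu|apply Hv]; exact Hr.
Qed.

Lemma mean_bdd_lin u v a b : 0 <= a -> 0 <= b -> mean_bdd u -> mean_bdd v ->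
  mean_bdd (fun z => a * u z + b * v z).
Proof.
  intros Ha Hb [Cu [M HM]] [Cv [N HN]]; split; [apply circ_cont_lin; assumption|].
  exists (a * M + b * N); intros r Hr.
  rewrite (RInt_lin (fun t => u (RtoC r * eit t)%C) (fun t => v (RtoC r * eit t)%C));
    [|apply circ_cont_ex; assumption..].
  specialize (HM r Hr); specialize (HN r Hr).
  apply Rplus_le_compat; apply Rmult_le_compat_l; assumption.
Qed.

Lemma mean_bdd_plus u v : mean_bdd u -> mean_bdd v -> mean_bdd (fun z => u z + v z).
Proof.
  intros Hu Hv; destruct (mean_bdd_lin u v 1 1 ltac:(lra) ltac:(lra) Hu Hv) as [H [M HM]].
  split.
  - intros r t Hr; apply cont_ext with (2 := H r t Hr); intros; f_equal; ring.
  - exists M; intros r Hr; apply Rle_trans with (2 := HM r Hr), Req_le, RInt_ext.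
    intros; simpl; ring.
Qed.

Lemma mean_bdd_le u v : circ_cont u -> (forall z, unit_disk z -> u z <= v z) ->
  mean_bdd v -> mean_bdd u.
Proof.
  intros Hu Hle [Hv [M HM]]; split; [exact Hu|exists M]; intros r Hr.
  apply Rle_trans with (2 := HM r Hr); apply RInt_le;
    [left; apply two_pi_pos|apply circ_cont_ex; assumption..|].
  intros t _; apply Hle, circle_in_disk, Hr.
Qed.

Lemma mean_bdd_const c : mean_bdd (fun _ => c).
Proof.
  split; [intros r t _; apply cont_const|].
  exists ((2 * PI - 0) * c); intros r _; rewrite RInt_const_R; lra.
Qed.

Lemma mean_bdd_scal u a : 0 <= a -> mean_bdd u -> mean_bdd (fun z => a * u z).
Proof.
  intros Ha Hu; destruct (mean_bdd_lin u _ a 0 Ha (Rle_refl 0) Hu (mean_bdd_const 0)) as [H [M HM]].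
  split.
  - intros r t Hr; apply cont_ext with (2 := H r t Hr); intros; f_equal; ring.
  - exists M; intros r Hr; apply Rle_trans with (2 := HM r Hr), Req_le, RInt_ext.
    intros; simpl; ring.
Qed.

Lemma circ_cont_hol f p : hol f -> 0 < p -> circ_cont (fun z => pow_nonneg (Cmod (f z)) p).
Proof.
  intros Hf Hp r t Hr.
  apply (cont_real_comp RtoC (fun t => Cmod (f (RtoC r * eit t)%C)) (fun x => pow_nonneg x p)).
  - apply (cont_Cmod RtoC (fun t => f (RtoC r * eit t)%C)), hol_rcont; assumption.
  - apply pow_nonneg_continuity, Hp.
Qed.

Lemma hol_holomorphic f : hol f -> holomorphic_on_disk f.
Proof.
  intros Hf z Hz; exists (C_derive f z); apply cder_is_derive, hol_der; assumption.
Qed.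

Lemma hardy_intro p f : hol f -> mean_bdd (fun z => pow_nonneg (Cmod (f z)) p) -> hardy p f.
Proof.
  intros Hf [_ [M HM]]; split; [apply hol_holomorphic, Hf|exists M]; intros r Hr.
  apply Rle_trans with (2 := HM r Hr), Req_le, RInt_ext; intros t _.
  rewrite polar_eit; reflexivity.
Qed.

Lemma hardy_mean_bdd p f : 0 < p -> hol f -> hardy p f ->
  mean_bdd (fun z => pow_nonneg (Cmod (f z)) p).
Proof.
  intros Hp Hf [_ [M HM]]; split; [apply circ_cont_hol; assumption|exists M]; intros r Hr.
  apply Rle_trans with (2 := HM r Hr), Req_le, RInt_ext; intros t _.
  rewrite polar_eit; reflexivity.
Qed.

Lemma mean_bdd_pow_le f g p : hol f -> hol g -> 0 < p ->
  (forall z, unit_disk z -> Cmod (f z) <= Cmod (g z)) ->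
  mean_bdd (fun z => pow_nonneg (Cmod (g z)) p) -> mean_bdd (fun z => pow_nonneg (Cmod (f z)) p).
Proof.
  intros Hf Hg Hp H; apply mean_bdd_le; [apply circ_cont_hol; assumption|].
  intros z Hz; apply pow_nonneg_le; [lra|apply H, Hz].
Qed.

Lemma mean_bdd_sector_strict f s th : hol f -> (forall z, unit_disk z -> 0 < Re (f z)) ->
  (forall z, unit_disk z -> Rabs (carg (f z)) <= th) ->
  0 < s -> s * th < PI / 2 -> mean_bdd (fun z => pow_nonneg (Cmod (f z)) s).
Proof.
  intros Hf Hp Hth Hs Hst; split; [apply circ_cont_hol; assumption|].
  exists (2 * PI * Rpower (Cmod (f 0)) s / cos (s * th)); intros r Hr.
  apply Rle_trans with (2 := sector_mean f s th r Hf Hp Hth (Rlt_le _ _ Hs) Hst Hr).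
  apply Req_le, RInt_ext; intros t _; apply pow_nonneg_pos, Re_pos_Cmod, Hp, circle_in_disk, Hr.
Qed.

Lemma Cmod_plus_1 w : 0 <= Re w -> Cmod w <= Cmod (w + 1)%C.
Proof.
  intros H; apply Rsqr_incr_0; [|apply Cmod_ge_0..].
  rewrite !Rsqr_pow2, !Cmod2_alt, re_plus.
  replace (Im (w + 1)%C) with (Im w) by (unfold Im; simpl; ring).
  rewrite re_RtoC; nra.
Qed.

(** Adding 1 makes the real part strictly positive, does not decrease the modulus and stays in the
    sector of half-angle [atan k]. *)
Lemma mean_bdd_sector f s k : hol f -> 0 <= k ->
  (forall z, unit_disk z -> Rabs (Im (f z)) <= k * Re (f z) /\ 0 <= Re (f z)) ->
  0 < s -> s * atan k < PI / 2 -> mean_bdd (fun z => pow_nonneg (Cmod (f z)) s).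
Proof.
  intros Hf Hk H Hs Hst.
  assert (Hg : hol (fun z => f z + 1)%C) by (apply hol_plus; [exact Hf|apply hol_const]).
  apply mean_bdd_pow_le with (2 := Hg); [exact Hf|exact Hs| |].
  { intros z Hz; apply Cmod_plus_1, H, Hz. }
  assert (HR : forall z, Re (f z + 1)%C = Re (f z) + 1) by (intros; unfold Re; simpl; ring).
  assert (HI : forall z, Im (f z + 1)%C = Im (f z)) by (intros; unfold Im; simpl; ring).
  apply (mean_bdd_sector_strict _ s (atan k)); [exact Hg| | |exact Hs|exact Hst].
  - intros z Hz; rewrite HR; generalize (proj2 (H z Hz)); lra.
  - intros z Hz; destruct (H z Hz) as [H1 H2]; unfold carg; rewrite HR, HI.
    assert (HX : - k <= Im (f z) / (Re (f z) + 1) <= k).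
    { apply Rabs_le_between in H1; split; apply Rmult_le_reg_r with (Re (f z) + 1); try lra;
      unfold Rdiv; rewrite Rmult_assoc, Rinv_l, Rmult_1_r by lra; nra. }
    assert (Hinc : forall a b, a <= b -> atan a <= atan b).
    { intros a b [L| ->]; [left; apply atan_increasing, L|lra]. }
    apply Rabs_le; split; [rewrite <- atan_opp|]; apply Hinc; lra.
Qed.

Lemma mean_bdd_Re_nonneg f s : hol f -> (forall z, unit_disk z -> 0 <= Re (f z)) ->
  0 < s < 1 -> mean_bdd (fun z => pow_nonneg (Cmod (f z)) s).
Proof.
  intros Hf H Hs.
  assert (Hg : hol (fun z => f z + 1)%C) by (apply hol_plus; [exact Hf|apply hol_const]).
  apply mean_bdd_pow_le with (2 := Hg); [exact Hf|lra| |].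
  { intros z Hz; apply Cmod_plus_1, H, Hz. }
  apply (mean_bdd_sector_strict _ s (PI / 2)); [exact Hg| | |lra|generalize PI_RGT_0; nra].
  - intros z Hz; rewrite re_plus, re_RtoC; generalize (H z Hz); lra.
  - intros z _; left; apply carg_bound.
Qed.

Lemma mean_bdd_rotated f lam s : hol f -> Cmod lam = 1 ->
  (forall z, unit_disk z -> 0 <= Re (lam * f z)%C) ->
  0 < s < 1 -> mean_bdd (fun z => pow_nonneg (Cmod (f z)) s).
Proof.
  intros Hf Hl H Hs.
  apply mean_bdd_pow_le with (fun z => lam * f z)%C; [exact Hf|apply hol_scal, Hf|lra| |].
  - intros z _; rewrite Cmod_mult, Hl; lra.
  - apply mean_bdd_Re_nonneg; [apply hol_scal, Hf|exact H|exact Hs].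
Qed.

(** * Inverses of injective holomorphic functions *)

(* If [w] near [g z0] were not attained near [z0], then [1 / (g - w)] would violate the
   maximum principle. *)
Lemma local_surjectivity g z0 eps : hol g -> unit_disk z0 -> C_derive g z0 <> 0 -> 0 < eps ->
  exists d, 0 < d /\ forall w, Cmod (w - g z0)%C < d ->
    exists z, unit_disk z /\ Cmod (z - z0)%C < eps /\ g z = w.
Proof.
  intros Hg Hz0 Hm Heps; unfold unit_disk in Hz0.
  destruct (hol_der g z0 Hg Hz0) as [phi [Hphi [Hphi0 [d1 [Hd1 H1]]]]].
  destruct (cont_neq_0 idC phi z0 Hphi) as [d2 [Hd2 H2]]; [rewrite Hphi0; exact Hm|].
  rewrite Hphi0 in H2; set (m := Cmod (C_derive g z0)) in *.
  assert (Hmp : 0 < m) by (apply Cmod_gt_0, Hm).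
  set (rho := Rmin (Rmin eps (1 - Cmod z0)) (Rmin d1 d2)).
  assert (Hrho : 0 < rho) by (repeat apply Rmin_pos; lra).
  assert (R1 : rho <= eps) by (eapply Rle_trans; apply Rmin_l).
  assert (R2 : rho <= 1 - Cmod z0) by (eapply Rle_trans; [apply Rmin_l|apply Rmin_r]).
  assert (R3 : rho <= d1) by (eapply Rle_trans; [apply Rmin_r|apply Rmin_l]).
  assert (R4 : rho <= d2) by (eapply Rle_trans; apply Rmin_r).
  clearbody rho.
  assert (Hin : forall u : C, Cmod u < 1 -> unit_disk (z0 + RtoC rho * u)%C).
  { intros u Hu; unfold unit_disk; apply Rle_lt_trans with (1 := Cmod_triangle _ _).
    rewrite Cmod_mult, Cmod_R, Rabs_pos_eq by lra; nra. }
  assert (Hmr : 0 < m * rho) by (apply Rmult_lt_0_compat; assumption).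
  (* On the circle [|z - z0| = rho / 2] the slope exceeds [m / 2], so [|g z - g z0| >= m rho / 4]
     and [|g z - w| >= m rho / 8]. At the centre [|g z0 - w| < m rho / 8], against the maximum
     principle for the reciprocal. *)
  exists (m * rho / 8); split; [lra|]; intros w Hw.
  apply NNPP; intros N.
  assert (Hne : forall u : C, Cmod u < 1 -> (g (z0 + RtoC rho * u) - w)%C <> 0).
  { intros u Hu E; apply N; exists (z0 + RtoC rho * u)%C; split; [apply Hin, Hu|split].
    - replace (z0 + RtoC rho * u - z0)%C with (RtoC rho * u)%C by ring.
      rewrite Cmod_mult, Cmod_R, Rabs_pos_eq by lra; nra.
    - apply Ceq_minus, E. }
  set (h := fun u => (/ (g (z0 + RtoC rho * u) - w))%C).
  assert (Hh : hol h).
  { apply hol_inv; [|exact Hne]; apply hol_minus; [|apply hol_const].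
    apply (hol_comp g (fun u => z0 + RtoC rho * u)%C); [exact Hg| |exact Hin].
    apply hol_plus; [apply hol_const|apply hol_scal, hol_id]. }
  assert (A : Cmod (h 0) <= 8 / (m * rho)).
  { apply max_principle with (1 / 2); [exact Hh|rewrite Cmod_0; lra|]; intros t.
    set (u := (RtoC (1 / 2) * eit t)%C).
    assert (Hu : Cmod u = 1 / 2) by (apply Cmod_circle; lra).
    unfold h; rewrite Cmod_inv by (apply Hne; lra).
    unfold Rdiv; rewrite <- (Rinv_inv 8), <- Rinv_mult.
    apply Rinv_le_contravar; [lra|].
    set (z := (z0 + RtoC rho * u)%C).
    assert (Ez : (z - z0)%C = (RtoC rho * u)%C) by (unfold z; ring).
    assert (Cz : Cmod (z - z0)%C = rho / 2)
      by (rewrite Ez, Cmod_mult, Cmod_R, Hu, Rabs_pos_eq by lra; lra).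
    assert (B : Cmod (g z - g z0)%C = Cmod (phi z) * (rho / 2)).
    { rewrite (H1 z) by (unfold idC; lra); unfold idC.
      replace (g z0 + phi z * (z - z0) - g z0)%C with (phi z * (z - z0))%C by ring.
      rewrite Cmod_mult, Cz; reflexivity. }
    assert (B2 := H2 z ltac:(unfold idC; lra)).
    assert (D := Cmod_reverse (g z - g z0)%C (w - g z0)%C).
    replace (g z - g z0 - (w - g z0))%C with (g z - w)%C in D by ring.
    nra. }
  unfold h in A; rewrite Cmult_0_r, Cplus_0_r in A.
  assert (Hw0 : (g z0 - w)%C <> 0).
  { assert (E := Hne 0 ltac:(rewrite Cmod_0; lra)); rewrite Cmult_0_r, Cplus_0_r in E; exact E. }
  rewrite Cmod_inv in A by exact Hw0.
  rewrite Cmod_minus_rev in Hw; apply Cmod_gt_0 in Hw0.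
  apply Rinv_lt_contravar in Hw; [|apply Rmult_lt_0_compat; lra].
  replace (/ (m * rho / 8)) with (8 / (m * rho)) in Hw by (field; lra); lra.
Qed.

Definition ginv (g : C -> C) (w : C) : C :=
  epsilon (inhabits (RtoC 0)) (fun z => unit_disk z /\ g z = w).

Lemma ginv_spec g w : image_of_disk g w -> unit_disk (ginv g w) /\ g (ginv g w) = w.
Proof. intros H; unfold ginv; apply epsilon_spec; exact H. Qed.

Lemma image_intro g z : unit_disk z -> image_of_disk g (g z).
Proof. intros Hz; exists z; split; [exact Hz|reflexivity]. Qed.

Lemma ginv_g g z : injective_on_disk g -> unit_disk z -> ginv g (g z) = z.
Proof.
  intros Hi Hz; destruct (ginv_spec g (g z) (image_intro g z Hz)) as [H1 H2].
  apply Hi; assumption.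
Qed.

(* The derivative of a univalent function has no zeros; this need not be proved, since for the
   [g] attached to a close-to-convex [f] it follows from [Re (lam f'/g') > 0]. *)
Definition convex_fun (g : C -> C) : Prop :=
  hol g /\ injective_on_disk g /\ (forall z, unit_disk z -> C_derive g z <> 0) /\
  convex_set (image_of_disk g) /\ g 0 = 0 /\ C_derive g 0 = 1.

(** * Univalent functions with convex image *)

Section Convex.
Variable g : C -> C.
Hypothesis Hcv : convex_fun g.

Let Hg : hol g := proj1 Hcv.
Let Hinj : injective_on_disk g := proj1 (proj2 Hcv).
Let Hd : forall z, unit_disk z -> C_derive g z <> 0 := proj1 (proj2 (proj2 Hcv)).
Let Hconv : convex_set (image_of_disk g) := proj1 (proj2 (proj2 (proj2 Hcv))).
Let g_0 : g 0 = 0 := proj1 (proj2 (proj2 (proj2 (proj2 Hcv)))).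
Let g_1 : C_derive g 0 = 1 := proj2 (proj2 (proj2 (proj2 (proj2 Hcv)))).

Lemma image_open w : image_of_disk g w ->
  exists d, 0 < d /\ forall u, Cmod (u - w)%C < d -> image_of_disk g u.
Proof.
  intros [z [Hz <-]]; destruct (local_surjectivity g z 1 Hg Hz (Hd z Hz) Rlt_0_1) as [d [H0 H]].
  exists d; split; [exact H0|]; intros u Hu; destruct (H u Hu) as [x [Hx [_ E]]].
  exists x; split; assumption.
Qed.

Lemma ginv_cont w : image_of_disk g w -> ccont (ginv g) w.
Proof.
  intros [z [Hz <-]] eps Heps.
  destruct (local_surjectivity g z eps Hg Hz (Hd z Hz) Heps) as [d [H0 H]].
  exists d; split; [exact H0|]; intros u Hu; destruct (H u Hu) as [x [Hx [Hxz <-]]].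
  rewrite !ginv_g by assumption; exact Hxz.
Qed.

Lemma cder_ginv w : image_of_disk g w -> cder (ginv g) w (/ C_derive g (ginv g w))%C.
Proof.
  intros Hw; destruct (image_open w Hw) as [d [H0 H]], (ginv_spec g w Hw) as [H1 H2].
  apply (cder_inverse g (ginv g) w _ d); [exact H0| | | |].
  - intros u Hu; apply ginv_spec, H, Hu.
  - apply ginv_cont, Hw.
  - apply hol_der; assumption.
  - apply Hd, H1.
Qed.

Lemma hol_ginv h : hol h -> (forall z, unit_disk z -> image_of_disk g (h z)) ->
  hol (fun z => ginv g (h z)).
Proof.
  intros Hh H; apply (hol_comp_image (ginv g) (fun w => / C_derive g (ginv g w))%C h Hh).
  intros z Hz; destruct (ginv_spec g _ (H z Hz)) as [H1 H2]; split; [apply cder_ginv, H, Hz|].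
  apply cont_inv; [|apply Hd, H1].
  apply (cont_comp idC (C_derive g) (ginv g)); [apply ginv_cont, H, Hz|apply Hg, H1].
Qed.

Lemma segment_image z w t : unit_disk z -> unit_disk w -> 0 <= t <= 1 ->
  image_of_disk g (g w + RtoC t * (g z - g w))%C.
Proof.
  intros Hz Hw Ht.
  replace (g w + RtoC t * (g z - g w))%C with (RtoC (1 - t) * g w + RtoC t * g z)%C
    by (rewrite RtoC_minus; ring).
  apply Hconv; [apply image_intro, Hw|apply image_intro, Hz|exact Ht].
Qed.

Lemma rder_segment z w t : unit_disk z -> unit_disk w -> 0 <= t <= 1 ->
  rder (fun t => ginv g (g w + RtoC t * (g z - g w))%C) t
    (/ C_derive g (ginv g (g w + RtoC t * (g z - g w))) * (g z - g w))%C.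
Proof.
  intros Hz Hw Ht.
  apply (der_comp RtoC (ginv g) (fun t => g w + RtoC t * (g z - g w))%C); [apply rder_affine|].
  apply cder_ginv, segment_image; assumption.
Qed.

(* Noshiro-Warschawski along the preimage of a segment of the convex image. *)
Lemma close_to_convex_quotient f lam z w : hol f ->
  (forall z, unit_disk z -> 0 < Re (lam * (C_derive f z / C_derive g z))%C) ->
  unit_disk z -> unit_disk w -> z <> w ->
  0 < Re (lam * ((f z - f w) / (g z - g w)))%C.
Proof.
  intros Hf HP Hz Hw Hzw.
  set (D := (g z - g w)%C).
  assert (HD : D <> 0).
  { intros E; apply Hzw, Hinj; [exact Hz|exact Hw|apply Ceq_minus, E]. }
  set (gam := fun t : R => ginv g (g w + RtoC t * D)%C).
  set (dgam := fun t => (/ C_derive g (gam t) * D)%C).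
  assert (Hgam : forall t, 0 <= t <= 1 -> unit_disk (gam t)).
  { intros t Ht; apply ginv_spec, segment_image; assumption. }
  assert (Hr : forall t, 0 <= t <= 1 ->
    is_derive (fun t => Re (lam / D * f (gam t))%C) t (Re (lam / D * (C_derive f (gam t) * dgam t))%C)).
  { intros t Ht; apply rder_Re, der_scal, (der_comp RtoC f gam).
    - apply rder_segment; assumption.
    - apply hol_der; [exact Hf|apply Hgam, Ht]. }
  destruct (MVT_gen (fun t => Re (lam / D * f (gam t))%C) 0 1
    (fun t => Re (lam / D * (C_derive f (gam t) * dgam t))%C)) as [c [Hc E]].
  - intros t Ht; rewrite Rmin_left, Rmax_right in Ht by lra; apply Hr; lra.
  - intros t Ht; rewrite Rmin_left, Rmax_right in Ht by lra.
    apply derivable_continuous_pt; eexists; apply is_derive_Reals, Hr, Ht.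
  - rewrite Rmin_left, Rmax_right in Hc by lra.
    replace (gam 1) with z in E.
    2: { unfold gam, D; replace (g w + 1 * (g z - g w))%C with (g z) by ring.
      symmetry; apply ginv_g; assumption. }
    replace (gam 0) with w in E.
    2: { unfold gam; rewrite Cmult_0_l, Cplus_0_r; symmetry; apply ginv_g; assumption. }
    rewrite <- Re_minus in E.
    replace (lam * ((f z - f w) / D))%C with (lam / D * f z - lam / D * f w)%C by (field; exact HD).
    rewrite E, Rminus_0_r, Rmult_1_r; unfold dgam.
    replace (lam / D * (C_derive f (gam c) * (/ C_derive g (gam c) * D)))%C
      with (lam * (C_derive f (gam c) / C_derive g (gam c)))%C
      by (field; split; [apply Hd, Hgam, Hc|exact HD]).
    apply HP, Hgam, Hc.
Qed.

Lemma is_derive_nonneg (F : R -> R) l : is_derive F 0 l ->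
  (forall s, 0 < s < 1 -> F 0 <= F s) -> 0 <= l.
Proof.
  intros H HF; apply is_derive_Reals in H; apply Rnot_lt_le; intros L.
  destruct (H (- l) ltac:(lra)) as [d Hdl].
  set (s := Rmin (d / 2) (1 / 2)).
  assert (Hs : 0 < s) by (apply Rmin_pos; [generalize (cond_pos d)|]; lra).
  assert (Hs1 : s <= d / 2) by apply Rmin_l.
  assert (Hs2 : s <= 1 / 2) by apply Rmin_r.
  specialize (Hdl s ltac:(lra) ltac:(rewrite Rabs_pos_eq; generalize (cond_pos d); lra)).
  rewrite Rplus_0_l in Hdl; specialize (HF s ltac:(lra)).
  assert (0 <= (F s - F 0) / s) by (apply Rmult_le_pos; [lra|left; apply Rinv_0_lt_compat, Hs]).
  apply Rabs_lt_between in Hdl; lra.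
Qed.

Lemma divz_g_neq_0 z : unit_disk z -> divz g z <> 0.
Proof.
  intros Hz; destruct (Ceq_dec z 0) as [->|N].
  - rewrite divz_0, g_1; apply C1_nz.
  - intros E; apply N, Hinj; [exact Hz|apply unit_disk_0|].
    rewrite (divz_spec g z g_0), E, g_0; ring.
Qed.

Lemma Re_Cconj_div a b : 0 <= Re (Cconj a * b)%C -> 0 <= Re (b / a)%C.
Proof.
  intros H.
  replace (Re (b / a)%C) with (Re (Cconj a * b)%C * / (fst a ^ 2 + snd a ^ 2)).
  - destruct (Req_dec (fst a ^ 2 + snd a ^ 2) 0) as [E|N].
    + rewrite E, Rinv_0; lra.
    + apply Rmult_le_pos; [exact H|left; apply Rinv_0_lt_compat].
      generalize (pow2_ge_0 (fst a)) (pow2_ge_0 (snd a)); lra.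
  - unfold Re; simpl; unfold Rdiv; ring.
Qed.

(** The path [rho s], the preimage of [(1 - s) g(z)], starts at [z] and satisfies [|rho s| <= |z|]
    by Schwarz. Its initial velocity [v = - g(z) / g'(z)] therefore does not point outwards, which
    is the claim up to a positive factor. [F] is minus the squared modulus of [rho], nondecreasing
    away from [s = 0] in the sense of [is_derive_nonneg]. *)
Lemma starlike z : unit_disk z -> 0 <= Re (C_derive g z / divz g z)%C.
Proof.
  intros Hz; destruct (Ceq_dec z 0) as [->|N].
  { rewrite divz_0, g_1; unfold Re; simpl; lra. }
  set (rho := fun s : R => ginv g (g z + RtoC s * (g 0 - g z))%C).
  assert (Hrho : rho 0 = z).
  { unfold rho; rewrite Cmult_0_l, Cplus_0_r; apply ginv_g; assumption. }
  set (v := (/ C_derive g z * (g 0 - g z))%C).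
  assert (Hder : rder rho 0 v).
  { apply der_eq with (1 := rder_segment 0 z 0 unit_disk_0 Hz ltac:(lra)).
    fold (rho 0); rewrite Hrho; reflexivity. }
  assert (Hle : forall s, 0 < s < 1 -> Cmod (rho s) <= Cmod z).
  { intros s Hs.
    assert (Him : forall u, unit_disk u -> image_of_disk g (g u + RtoC s * (g 0 - g u))%C)
      by (intros u Hu; apply segment_image; [apply unit_disk_0|exact Hu|lra]).
    apply (schwarz (fun u => ginv g (g u + RtoC s * (g 0 - g u)))%C); [| | |exact Hz].
    - apply hol_ginv; [|exact Him].
      apply hol_plus; [exact Hg|apply hol_scal, hol_minus; [apply hol_const|exact Hg]].
    - replace (g 0 + RtoC s * (g 0 - g 0))%C with (g 0) by ring; apply ginv_g; [exact Hinj|apply unit_disk_0].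
    - intros u Hu; left; apply (ginv_spec g _ (Him u Hu)). }
  set (F := fun s => - (Re (rho s) * Re (rho s) + Im (rho s) * Im (rho s))).
  assert (HF : is_derive F 0 (- (2 * (Re z * Re v + Im z * Im v)))).
  { assert (D1 := rder_Re rho 0 v Hder).
    assert (D2 : is_derive (fun s => Im (rho s)) 0 (Im v)).
    { apply is_derive_ext with (fun s => Re (- Ci * rho s)%C).
      - intros; symmetry; apply Im_Re.
      - rewrite Im_Re; apply rder_Re, der_scal, Hder. }
    replace (- (2 * (Re z * Re v + Im z * Im v))) with
      (- ((Re v * Re (rho 0) + Re (rho 0) * Re v) + (Im v * Im (rho 0) + Im (rho 0) * Im v)))
      by (rewrite Hrho; ring).
    apply is_derive_Reals, derivable_pt_lim_opp, derivable_pt_lim_plus;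
      apply derivable_pt_lim_mult; apply is_derive_Reals; assumption. }
  assert (A := is_derive_nonneg F _ HF); unfold F in A.
  assert (Hsq : forall w : C, Re w * Re w + Im w * Im w = Cmod w * Cmod w).
  { intros w; generalize (Cmod2_alt w); simpl; lra. }
  assert (A' : 0 <= - (2 * (Re z * Re v + Im z * Im v))).
  { apply A; intros s Hs; rewrite !Hsq, Hrho.
    assert (L := Hle s Hs); generalize (Cmod_ge_0 (rho s)) (Cmod_ge_0 z); nra. }
  assert (Hgz : g z <> 0).
  { intros E; apply N, Hinj; [exact Hz|apply unit_disk_0|rewrite E, g_0; reflexivity]. }
  replace (C_derive g z / divz g z)%C with (z / (- v))%C.
  - apply Re_Cconj_div.
    replace (Re (Cconj (- v) * z)%C) with (- (Re z * Re v + Im z * Im v)); [lra|].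
    unfold Re, Im; simpl; ring.
  - rewrite divz_neq by exact N; unfold v; rewrite g_0; field.
    repeat split; try assumption; apply Hd, Hz.
Qed.
End Convex.

(** * The Schwarz-Pick estimate for convex functions *)

Lemma mobius_denom a z : unit_disk a -> unit_disk z -> (1 + Cconj a * z)%C <> 0.
Proof.
  unfold unit_disk at 1; intros Ha Hz; apply one_plus_neq_0, unit_disk_mult; [rewrite Cmod_conj; lra|exact Hz].
Qed.

Lemma mobius_identity a z :
  Cmod (1 + Cconj a * z)%C ^ 2 - Cmod (z + a)%C ^ 2 = (1 - Cmod a ^ 2) * (1 - Cmod z ^ 2).
Proof.
  rewrite !Cmod2_alt; unfold Re, Im; destruct a, z; simpl; ring.
Qed.

Lemma mobius_disk a z : unit_disk a -> unit_disk z -> unit_disk ((z + a) / (1 + Cconj a * z))%C.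
Proof.
  intros Ha Hz; apply Cmod_div_lt_1; [apply mobius_denom; assumption|unfold unit_disk in *].
  assert (A := mobius_identity a z).
  assert (0 < (1 - Cmod a ^ 2) * (1 - Cmod z ^ 2)).
  { generalize (Cmod_ge_0 a) (Cmod_ge_0 z); intros; apply Rmult_lt_0_compat; simpl; nra. }
  lra.
Qed.

Lemma hol_mobius a : unit_disk a -> hol (fun z => (z + a) / (1 + Cconj a * z))%C.
Proof.
  intros Ha; apply hol_div.
  - apply hol_plus; [apply hol_id|apply hol_const].
  - apply hol_plus; [apply hol_const|apply hol_scal, hol_id].
  - intros z Hz; apply mobius_denom; assumption.
Qed.

(* Schwarz-Pick at [a] for the self-maps [ginv ((1-t) g + t g(a))] of the disk,
   evaluated at the origin. *)
Lemma Re_quotient_nonneg g a : convex_fun g -> unit_disk a -> 0 <= Re (divz g a).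
Proof.
  intros Hcv Ha; assert (Hcv' := Hcv); destruct Hcv' as [Hg [Hinj [Hd [Hconv [g_0 g_1]]]]].
  destruct (Ceq_dec a 0) as [->|N].
  { rewrite divz_0, g_1, re_RtoC; lra. }
  set (sig := fun z => ((z + a) / (1 + Cconj a * z))%C).
  set (tau := fun z => ((z + - a) / (1 + Cconj (- a) * z))%C).
  assert (Ha' : unit_disk (- a)%C) by (unfold unit_disk; rewrite Cmod_opp; exact Ha).
  assert (Hsig : hol sig) by apply hol_mobius, Ha.
  assert (Htau : hol tau) by apply hol_mobius, Ha'.
  assert (Dsig : forall z, unit_disk z -> unit_disk (sig z)) by (intros; apply mobius_disk; assumption).
  assert (Dtau : forall z, unit_disk z -> unit_disk (tau z)) by (intros; apply mobius_disk; assumption).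
  assert (sig_0 : sig 0 = a).
  { unfold sig; field; replace (1 + Cconj a * 0)%C with (RtoC 1) by ring; apply C1_nz. }
  assert (sig_a : sig (- a)%C = 0).
  { unfold sig; replace (- a + a)%C with (RtoC 0) by ring; unfold Cdiv; ring. }
  set (rho := fun s : R => ginv g (g 0 + RtoC s * (g a - g 0))%C).
  assert (Hrho : rho 0 = 0).
  { unfold rho; rewrite Cmult_0_l, Cplus_0_r; apply ginv_g; [exact Hinj|apply unit_disk_0]. }
  assert (Hder : rder rho 0 (g a)).
  { apply der_eq with (1 := rder_segment g Hcv a 0 0 Ha unit_disk_0 ltac:(lra)).
    fold (rho 0); rewrite Hrho, g_0, g_1; field; apply C1_nz. }
  assert (HP : forall s, 0 < s < 1 -> 0 <= Re (Cconj a * rho s)%C).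
  { intros s Hs.
    assert (Him : forall u, unit_disk u ->
      image_of_disk g (g (sig u) + RtoC s * (g a - g (sig u)))%C)
      by (intros u Hu; apply (segment_image g Hcv); [exact Ha|apply Dsig, Hu|lra]).
    (* Before conjugation the self-map fixes [a]; conjugated by [sig] and its inverse [tau] it fixes
       the origin. Schwarz is applied at [- a], which [sig] sends to 0. *)
    assert (A : Cmod (tau (rho s)) <= Cmod a).
    { rewrite <- (Cmod_opp a).
      replace (rho s) with (ginv g (g (sig (- a)) + RtoC s * (g a - g (sig (- a))))%C)
        by (rewrite sig_a; reflexivity).
      apply (schwarz (fun u => tau (ginv g (g (sig u) + RtoC s * (g a - g (sig u)))))%C); [| | |exact Ha'].
      - apply hol_comp with (g := tau); [exact Htau| |intros z Hz; apply ginv_spec, Him, Hz].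
        apply (hol_ginv g Hcv); [|exact Him].
        assert (Hgs : hol (fun u => g (sig u))) by (apply hol_comp; assumption).
        apply hol_plus; [exact Hgs|apply hol_scal, hol_minus; [apply hol_const|exact Hgs]].
      - rewrite sig_0; replace (g a + RtoC s * (g a - g a))%C with (g a) by ring.
        rewrite ginv_g by assumption; unfold tau.
        replace (a + - a)%C with (RtoC 0) by ring; unfold Cdiv; ring.
      - intros u Hu; left; apply Dtau, ginv_spec, Him, Hu. }
    assert (Dr : unit_disk (rho s)) by (apply ginv_spec, (segment_image g Hcv); [exact Ha|apply unit_disk_0|lra]).
    assert (Nd := mobius_denom (- a) (rho s) Ha' Dr).
    unfold tau in A; rewrite Cmod_div in A by exact Nd.
    assert (Np := Nd); apply Cmod_gt_0 in Np.
    apply (Rmult_le_compat_r _ _ _ (Rlt_le _ _ Np)) in A.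
    unfold Rdiv in A; rewrite Rmult_assoc, Rinv_l, Rmult_1_r in A by lra.
    assert (B : Cmod (rho s + - a)%C ^ 2 <= (Cmod a * Cmod (1 + Cconj (- a) * rho s)%C) ^ 2)
      by (apply pow_incr; split; [apply Cmod_ge_0|exact A]).
    rewrite Rpow_mult_distr in B.
    assert (E := mobius_identity (- a) (rho s)); rewrite Cmod_opp in E.
    assert (E2 : Cmod (rho s + - a)%C ^ 2 = Cmod (rho s) ^ 2 - 2 * Re (Cconj a * rho s)%C + Cmod a ^ 2).
    { rewrite !Cmod2_alt; unfold Re, Im; destruct a, (rho s); simpl; ring. }
    assert (HA : 0 <= Cmod a ^ 2 < 1).
    { unfold unit_disk in Ha; generalize (Cmod_ge_0 a); simpl; nra. }
    assert (HR := pow2_ge_0 (Cmod (rho s))).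
    set (X := Cmod (1 + Cconj (- a) * rho s)%C ^ 2) in *.
    set (A2 := Cmod a ^ 2) in *; set (R2 := Cmod (rho s) ^ 2) in *.
    set (p := Re (Cconj a * rho s)%C) in *.
    assert (EX : X = R2 - 2 * p + A2 + (1 - A2) * (1 - R2)) by lra.
    rewrite EX, E2 in B; clearbody X A2 R2 p; apply Rnot_lt_le; intros L.
    (* Clearing denominators in the Schwarz estimate leaves [|rho|^2 (1 + |a|^2) <= 2 p], which
       excludes [p < 0]. *)
    assert (K : (1 - A2) * (R2 * (1 + A2) - 2 * p) <= 0) by lra.
    assert (0 <= R2 * (1 + A2)) by (apply Rmult_le_pos; lra).
    assert (0 < (1 - A2) * (R2 * (1 + A2) - 2 * p)) by (apply Rmult_lt_0_compat; lra).
    lra. }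
  rewrite divz_neq by exact N; apply Re_Cconj_div.
  apply (is_derive_nonneg (fun s => Re (Cconj a * rho s)%C)).
  - apply rder_Re, der_scal, Hder.
  - intros s Hs; rewrite Hrho, Cmult_0_r, re_RtoC; apply HP, Hs.
Qed.

(** * Factorization of close-to-convex functions *)

Lemma class_C_convex_fun g : class_C g -> (forall z, unit_disk z -> C_derive g z <> 0) -> convex_fun g.
Proof.
  intros [[_ [Hi [a [Ha0 [Ha1 Ha]]]]] Hc] Hd.
  split; [exact (expansion_hol a g Ha)|].
  split; [exact Hi|split; [exact Hd|split; [exact Hc|]]].
  rewrite (expansion_0 a g Ha), (expansion_1 a g Ha); split; assumption.
Qed.

Section Factors.
Variables (f g : C -> C) (lam : C).
Hypothesis Hf : hol f.
Hypothesis f_0 : f 0 = 0.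
Hypothesis f_1 : C_derive f 0 = 1.
Hypothesis Hcv : convex_fun g.
Hypothesis Hlam : Cmod lam = 1.
Hypothesis HP : forall z, unit_disk z -> 0 < Re (lam * (C_derive f z / C_derive g z))%C.

Let Hg : hol g := proj1 Hcv.
Let Hd : forall z, unit_disk z -> C_derive g z <> 0 := proj1 (proj2 (proj2 Hcv)).
Let g_0 : g 0 = 0 := proj1 (proj2 (proj2 (proj2 (proj2 Hcv)))).
Let g_1 : C_derive g 0 = 1 := proj2 (proj2 (proj2 (proj2 (proj2 Hcv)))).
Let G_neq := divz_g_neq_0 g Hcv.

Lemma hol_P : hol (fun z => C_derive f z / C_derive g z)%C.
Proof. apply hol_div; [apply hol_C_derive, Hf|apply hol_C_derive, Hg|exact Hd]. Qed.

Lemma hol_Q : hol (fun z => C_derive g z / divz g z)%C.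
Proof. apply hol_div; [apply hol_C_derive, Hg|apply hol_divz; assumption|exact G_neq]. Qed.

Lemma hol_R : hol (fun z => divz f z / divz g z)%C.
Proof. apply hol_div; [apply hol_divz; assumption..|exact G_neq]. Qed.

Lemma Re_R z : unit_disk z -> 0 < Re (lam * (divz f z / divz g z))%C.
Proof.
  intros Hz; destruct (Ceq_dec z 0) as [->|N].
  - rewrite !divz_0, f_1, g_1; replace (lam * (1 / 1))%C with (lam * (C_derive f 0 / C_derive g 0))%C
      by (rewrite f_1, g_1; reflexivity).
    apply HP, unit_disk_0.
  - replace (divz f z / divz g z)%C with ((f z - f 0) / (g z - g 0))%C.
    + apply close_to_convex_quotient; try assumption; apply unit_disk_0.
    + assert (NG := G_neq z Hz); rewrite f_0, g_0.
      rewrite (divz_spec f z f_0), (divz_spec g z g_0) at 1; field; split; assumption.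
Qed.

Lemma f_factor z : unit_disk z -> Cmod (f z) <= Cmod (divz f z / divz g z)%C * Cmod (divz g z).
Proof.
  intros Hz; rewrite <- Cmod_mult.
  replace (divz f z / divz g z * divz g z)%C with (divz f z) by (field; apply G_neq, Hz).
  rewrite (divz_spec f z f_0), Cmod_mult; unfold unit_disk in Hz.
  generalize (Cmod_ge_0 z) (Cmod_ge_0 (divz f z)); nra.
Qed.

Lemma derive_factor z : unit_disk z ->
  Cmod (C_derive f z) = Cmod (C_derive f z / C_derive g z)%C * Cmod (C_derive g z / divz g z)%C
    * Cmod (divz g z).
Proof.
  intros Hz; rewrite <- !Cmod_mult; f_equal; field.
  split; [apply G_neq|apply Hd]; exact Hz.
Qed.

Lemma mean_P s : 0 < s < 1 -> mean_bdd (fun z => pow_nonneg (Cmod (C_derive f z / C_derive g z)%C) s).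
Proof.
  intros Hs; apply (mean_bdd_rotated _ lam); [apply hol_P|exact Hlam| |exact Hs].
  intros z Hz; left; apply HP, Hz.
Qed.

Lemma mean_Q s : 0 < s < 1 -> mean_bdd (fun z => pow_nonneg (Cmod (C_derive g z / divz g z)%C) s).
Proof.
  intros Hs; apply mean_bdd_Re_nonneg; [apply hol_Q| |exact Hs].
  intros z Hz; apply starlike; assumption.
Qed.

Lemma mean_R s : 0 < s < 1 -> mean_bdd (fun z => pow_nonneg (Cmod (divz f z / divz g z)%C) s).
Proof.
  intros Hs; apply (mean_bdd_rotated _ lam); [apply hol_R|exact Hlam| |exact Hs].
  intros z Hz; left; apply Re_R, Hz.
Qed.

Lemma mean_G s : 0 < s < 1 -> mean_bdd (fun z => pow_nonneg (Cmod (divz g z)) s).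
Proof.
  intros Hs; apply mean_bdd_Re_nonneg; [apply hol_divz; assumption| |exact Hs].
  intros z Hz; apply Re_quotient_nonneg; assumption.
Qed.

Lemma hardy_derive_of_means p a c : 0 < p -> 0 < a < 1 -> 0 < c -> p / a + p / a + p / c = 1 ->
  mean_bdd (fun z => pow_nonneg (Cmod (divz g z)) c) -> hardy p (C_derive f).
Proof.
  intros Hp Ha Hc E HG; apply hardy_intro; [apply hol_C_derive, Hf|].
  apply mean_bdd_le with (v := fun z => pow_nonneg (Cmod (C_derive f z / C_derive g z)%C) a
    + pow_nonneg (Cmod (C_derive g z / divz g z)%C) a + pow_nonneg (Cmod (divz g z)) c).
  - apply circ_cont_hol; [apply hol_C_derive, Hf|exact Hp].
  - intros z Hz; rewrite derive_factor by exact Hz.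
    apply pow_nonneg_mult_3_le; try apply Cmod_ge_0; try assumption; lra.
  - apply mean_bdd_plus; [apply mean_bdd_plus; [apply mean_P|apply mean_Q]; exact Ha|exact HG].
Qed.

Lemma hardy_f_of_means q a c : 0 < q -> 0 < a < 1 -> 0 < c -> q / a + q / c = 1 ->
  mean_bdd (fun z => pow_nonneg (Cmod (divz g z)) c) -> hardy q f.
Proof.
  intros Hq Ha Hc E HG; apply hardy_intro; [exact Hf|].
  apply mean_bdd_le with (v := fun z => pow_nonneg (Cmod (divz f z / divz g z)%C) a
    + pow_nonneg (Cmod (divz g z)) c).
  - apply circ_cont_hol; [exact Hf|exact Hq].
  - intros z Hz; apply Rle_trans with (pow_nonneg (Cmod (divz f z / divz g z)%C * Cmod (divz g z)) q).
    + apply pow_nonneg_le; [lra|apply f_factor, Hz].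
    + apply pow_nonneg_mult_2_le; try apply Cmod_ge_0; try assumption; lra.
  - apply mean_bdd_plus; [apply mean_R; exact Ha|exact HG].
Qed.

Lemma hardy_derive p : 0 < p < 1 / 3 -> hardy p (C_derive f).
Proof.
  intros Hp; apply hardy_derive_of_means with (3 * p) (3 * p); try lra; [field; lra|apply mean_G; lra].
Qed.

Lemma hardy_f q : 0 < q < 1 / 2 -> hardy q f.
Proof.
  intros Hq; apply hardy_f_of_means with (2 * q) (2 * q); try lra; [field; lra|apply mean_G; lra].
Qed.

(** The order [a] of the other factors is dictated by the exponents: [2/(3 a) + 1/(3 c) = 1] gives
    [a = 2 c / (3 c - 1)], and [1/(2 a) + 1/(2 c) = 1] gives [a = c / (2 c - 1)]. Both are below 1
    exactly because [c > 1]. *)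
Lemma hardy_critical c : 1 < c -> mean_bdd (fun z => pow_nonneg (Cmod (divz g z)) c) ->
  hardy (1 / 3) (C_derive f) /\ hardy (1 / 2) f.
Proof.
  intros Hc HG; split.
  - apply hardy_derive_of_means with (2 * c / (3 * c - 1)) c; try lra; [|field; lra|exact HG].
    split; [apply Rdiv_lt_0_compat; lra|].
    apply Rmult_lt_reg_r with (3 * c - 1); [lra|].
    unfold Rdiv; rewrite Rmult_assoc, Rinv_l; lra.
  - apply hardy_f_of_means with (c / (2 * c - 1)) c; try lra; [|field; lra|exact HG].
    split; [apply Rdiv_lt_0_compat; lra|].
    apply Rmult_lt_reg_r with (2 * c - 1); [lra|].
    unfold Rdiv; rewrite Rmult_assoc, Rinv_l; lra.
Qed.

End Factors.

(** * Supporting lines of a planar convex set *)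

(** Since [K] contains 1 but not 0, it meets the real axis only in positive numbers. A segment from
    a point [a] above the axis to a point [b] below crosses it at such a number, which says that the
    quotient [- Re / Im] at [a] is at most the one at [b]. The supremum [c] of these quotients over
    the upper points gives the separating line. *)
Lemma convex_separation (K : C -> Prop) (u v : C) : convex_set K -> K 1 -> ~ K 0 ->
  K u -> 0 < Im u -> K v -> Im v < 0 ->
  exists c, forall w, K w -> 0 <= Re w + c * Im w.
Proof.
  intros HK H1 H0 Hu Hu0 Hv Hv0.
  assert (Hreal : forall w, K w -> Im w = 0 -> 0 < Re w).
  { intros w Hw Hi; apply Rnot_le_lt; intros L; apply H0.
    assert (Hd : 0 < 1 - Re w) by lra.
    replace (RtoC 0) with (RtoC (1 - / (1 - Re w)) * 1 + RtoC (/ (1 - Re w)) * w)%C.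
    - apply HK; [exact H1|exact Hw|]; split; [left; apply Rinv_0_lt_compat, Hd|].
      rewrite <- Rinv_1; apply Rinv_le_contravar; lra.
    - unfold Re, Im in *; destruct w as [x y]; simpl in *; subst y.
      apply injective_projections; simpl; field; lra. }
  assert (Hkey : forall a b, K a -> 0 < Im a -> K b -> Im b < 0 -> - Re a / Im a <= - Re b / Im b).
  { intros a b Ha Ha0 Hb Hb0.
    set (t := Im a / (Im a - Im b)).
    assert (Hd : 0 < Im a - Im b) by lra.
    assert (Ht : 0 <= t <= 1).
    { unfold t; split; [apply Rmult_le_pos; [lra|left; apply Rinv_0_lt_compat, Hd]|].
      apply Rmult_le_reg_r with (Im a - Im b); [exact Hd|].
      unfold Rdiv; rewrite Rmult_assoc, Rinv_l; lra. }
    assert (A := Hreal _ (HK a b t Ha Hb Ht)).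
    assert (E1 : Im (RtoC (1 - t) * a + RtoC t * b)%C = 0).
    { replace (Im (RtoC (1 - t) * a + RtoC t * b)%C) with ((1 - t) * Im a + t * Im b)
        by (unfold Im; simpl; ring).
      unfold t; field; lra. }
    specialize (A E1).
    replace (Re (RtoC (1 - t) * a + RtoC t * b)%C) with ((1 - t) * Re a + t * Re b) in A
      by (unfold Re; simpl; ring).
    assert (B : 0 < - Im b * Re a + Im a * Re b).
    { replace (- Im b * Re a + Im a * Re b) with (((1 - t) * Re a + t * Re b) * (Im a - Im b))
        by (unfold t; field; lra).
      apply Rmult_lt_0_compat; assumption. }
    assert (E : - Re b / Im b - - Re a / Im a = (- Im b * Re a + Im a * Re b) * / (Im a * - Im b))
      by (field; lra).
    assert (0 < / (Im a * - Im b)) by (apply Rinv_0_lt_compat, Rmult_lt_0_compat; lra).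
    assert (0 < (- Im b * Re a + Im a * Re b) * / (Im a * - Im b)) by (apply Rmult_lt_0_compat; assumption).
    lra. }
  destruct (completeness (fun x => exists w, K w /\ 0 < Im w /\ x = - Re w / Im w)) as [c [Hc1 Hc2]].
  - exists (- Re v / Im v); intros x [w [Hw [Hw0 ->]]]; apply Hkey; assumption.
  - exists (- Re u / Im u); exists u; auto.
  - exists c; intros w Hw; destruct (Rtotal_order (Im w) 0) as [L|[E|L]].
    + assert (A : c <= - Re w / Im w).
      { apply Hc2; intros x [a [Ha [Ha0 ->]]]; apply Hkey; assumption. }
      assert (B : - Re w / Im w * Im w = - Re w) by (field; lra); nra.
    + rewrite E; generalize (Hreal w Hw E); lra.
    + assert (A : - Re w / Im w <= c) by (apply Hc1; exists w; auto).
      assert (B : - Re w / Im w * Im w = - Re w) by (field; lra); nra.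
Qed.

Definition supports (g : C -> C) (m : C) : Prop :=
  m <> 0 /\ exists c, forall z, unit_disk z -> c <= Re (m * g z)%C.

Lemma supporting_line g w0 : convex_fun g -> ~ image_of_disk g w0 ->
  exists m : C, m <> 0 /\ forall z, unit_disk z -> Re (m * w0)%C <= Re (m * g z)%C.
Proof.
  intros Hcv Hw; assert (Hcv' := Hcv); destruct Hcv' as [Hg [Hinj [Hd [Hconv [g_0 g_1]]]]].
  assert (I0 : image_of_disk g 0) by (rewrite <- g_0; apply image_intro, unit_disk_0).
  assert (N : w0 <> 0) by (intros ->; contradiction).
  (* The affine change of variable sends [w0] to 0 and 0 to 1. As the image is open at 0, [K]
     contains points just above and just below 1. *)
  set (K := fun w => image_of_disk g (w0 - w0 * w)%C).
  destruct (image_open g Hcv 0 I0) as [d [Hd0 Hop]].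
  assert (Np := N); apply Cmod_gt_0 in Np.
  set (e := d / (2 * Cmod w0)).
  assert (He : 0 < e) by (apply Rdiv_lt_0_compat; lra).
  assert (Hsmall : forall s, Rabs s = e -> K (1, s)).
  { intros s Hs; apply Hop.
    replace (w0 - w0 * (1, s) - 0)%C with (w0 * (- Ci * RtoC s))%C
      by (apply injective_projections; simpl; ring).
    rewrite !Cmod_mult, Cmod_opp, Cmod_Ci, Cmod_R, Hs; unfold e.
    replace (Cmod w0 * (1 * (d / (2 * Cmod w0)))) with (d / 2) by (field; lra); lra. }
  destruct (convex_separation K (1, e) (1, - e)) as [c Hc].
  - intros a b t Ha Hb Ht; unfold K in *.
    replace (w0 - w0 * (RtoC (1 - t) * a + RtoC t * b))%C
      with (RtoC (1 - t) * (w0 - w0 * a) + RtoC t * (w0 - w0 * b))%C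
      by (rewrite RtoC_minus; ring).
    apply Hconv; assumption.
  - unfold K; replace (w0 - w0 * 1)%C with (RtoC 0) by ring; exact I0.
  - unfold K; replace (w0 - w0 * 0)%C with w0 by ring; exact Hw.
  - apply Hsmall; rewrite Rabs_pos_eq; lra.
  - exact He.
  - apply Hsmall; rewrite Rabs_Ropp, Rabs_pos_eq; lra.
  - unfold Im; simpl; lra.
  (* [Re (v * q) = Re q + c * Im q]; dividing by [- w0] undoes the change of variable. *)
  - set (v := (1, - c) : C); exists (- (v / w0))%C; split.
    + intros E; apply C1_nz.
      assert (E' : v = 0).
      { replace v with (- (- (v / w0) * w0))%C by (field; exact N).
        rewrite E; ring. }
      apply (f_equal fst) in E'; simpl in E'; lra.
    + intros z Hz.
      assert (A := Hc ((w0 - g z) / w0)%C).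
      assert (B : K ((w0 - g z) / w0)%C).
      { unfold K; replace (w0 - w0 * ((w0 - g z) / w0))%C with (g z) by (field; exact N).
        apply image_intro, Hz. }
      specialize (A B).
      assert (E : Re (- (v / w0) * g z)%C - Re (- (v / w0) * w0)%C
        = Re (v * ((w0 - g z) / w0))%C).
      { rewrite <- Re_minus; f_equal; field; exact N. }
      replace (Re (v * ((w0 - g z) / w0))%C)
        with (Re ((w0 - g z) / w0)%C + c * Im ((w0 - g z) / w0)%C) in E.
      * lra.
      * set (q := ((w0 - g z) / w0)%C); unfold Re, Im; simpl; ring.
Qed.

(** If [g] were onto, the preimage under [g] of [2 z] would be a self-map of the disk fixing 0 with
    derivative 2, against Schwarz. *)
Lemma convex_fun_not_onto g : convex_fun g -> exists w0, ~ image_of_disk g w0.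
Proof.
  intros Hcv; assert (Hcv' := Hcv); destruct Hcv' as [Hg [Hinj [Hd [Hconv [g_0 g_1]]]]].
  apply NNPP; intros N.
  assert (Hall : forall w, image_of_disk g w) by (intros w; apply NNPP; intros H; apply N; exists w; exact H).
  set (om := fun z => ginv g (2 * z)%C).
  assert (H0 : ginv g 0 = 0).
  { rewrite <- g_0 at 1; apply ginv_g; [exact Hinj|apply unit_disk_0]. }
  assert (H2 : om 0 = 0) by (unfold om; rewrite Cmult_0_r; exact H0).
  assert (A : Cmod (C_derive om 0) <= 1).
  { apply schwarz_derive; [|exact H2|intros z _; left; apply (ginv_spec g), Hall].
    apply (hol_ginv g Hcv (fun z => 2 * z)%C); [apply hol_scal, hol_id|intros; apply Hall]. }
  assert (D : cder om 0 (/ C_derive g 0 * (2 * 1))%C).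
  { apply (der_comp idC (ginv g) (fun z => 2 * z)%C); [apply der_scal, (der_pos idC)|].
    rewrite Cmult_0_r; rewrite <- H0 at 2; apply cder_ginv; [exact Hcv|apply Hall]. }
  rewrite (cder_C_derive _ _ _ D), g_1 in A.
  replace (/ 1 * (2 * 1))%C with (RtoC 2) in A by (field; apply C1_nz).
  rewrite Cmod_R, Rabs_pos_eq in A; lra.
Qed.

(** * Passing from the means of a function to those of its quotient by z *)

Lemma mean_bdd_affine f g p A B : hol f -> hol g -> 0 < p -> 0 <= A -> 0 <= B ->
  (forall z, unit_disk z -> Cmod (f z) <= A * Cmod (g z) + B) ->
  mean_bdd (fun z => pow_nonneg (Cmod (g z)) p) -> mean_bdd (fun z => pow_nonneg (Cmod (f z)) p).
Proof.
  intros Hf Hg Hp HA HB H HM.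
  apply mean_bdd_le with (v := fun z => Rpower 2 p * (pow_nonneg A p * pow_nonneg (Cmod (g z)) p + pow_nonneg B p)).
  - apply circ_cont_hol; assumption.
  - intros z Hz; apply Rle_trans with (pow_nonneg (A * Cmod (g z) + B) p).
    + apply pow_nonneg_le; [lra|apply H, Hz].
    + rewrite <- pow_nonneg_mult by (assumption || apply Cmod_ge_0).
      apply pow_nonneg_plus_le; [apply Rmult_le_pos; [exact HA|apply Cmod_ge_0]|exact HB|exact Hp].
  - apply mean_bdd_scal; [left; apply exp_pos|].
    apply mean_bdd_plus; [apply mean_bdd_scal; [apply pow_nonneg_ge_0|exact HM]|apply mean_bdd_const].
Qed.

Lemma hol_bounded_half f : hol f -> exists B, 0 <= B /\ forall z, Cmod z <= 1 / 2 -> Cmod (f z) <= B.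
Proof.
  (* For [|z| <= 1/2] the Cauchy kernel on the circle of radius 3/4 is at most
     [(3/4) / (3/4 - 1/2) = 3]. *)
  intros Hf; set (r := 3 / 4).
  set (I := RInt (fun t => Cmod (f (RtoC r * eit t)%C)) 0 (2 * PI)).
  assert (Hr : 0 <= r < 1) by (unfold r; lra).
  assert (HI : 0 <= I).
  { apply RInt_ge_0; [left; apply two_pi_pos| |intros; apply Cmod_ge_0].
    apply (rcont_ex_RInt_Cmod (fun t => f (RtoC r * eit t)%C)); intros; apply hol_rcont; assumption. }
  exists (3 * I); split; [lra|]; intros z Hz.
  assert (Hzr : Cmod z < r < 1) by (unfold r; lra).
  assert (Hc : forall t, rcont (fun t => f (RtoC r * eit t) * (RtoC r * eit t / (RtoC r * eit t - z)))%C t).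
  { intros t; apply cont_mult; [apply hol_rcont; assumption|apply rcont_kernel; lra]. }
  apply Rle_trans with (2 * PI * Cmod (f z)).
  { generalize PI2_1 (Cmod_ge_0 (f z)); nra. }
  rewrite <- (Rabs_pos_eq (2 * PI)) by (left; apply two_pi_pos).
  rewrite <- Cmod_R, <- Cmod_mult, <- (cauchy_formula f z r Hf Hzr).
  apply Rle_trans with (1 := Cmod_cint_le _ Hc).
  assert (Hex : ex_RInt (fun t => Cmod (f (RtoC r * eit t)%C)) 0 (2 * PI)).
  { apply (rcont_ex_RInt_Cmod (fun t => f (RtoC r * eit t)%C)); intros; apply hol_rcont; assumption. }
  assert (E := RInt_scal (V := R_CompleteNormedModule) _ 0 (2 * PI) 3 Hex).
  apply Rle_trans with (2 := Req_le _ _ E).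
  apply RInt_le; [left; apply two_pi_pos|apply rcont_ex_RInt_Cmod, Hc| |].
  - apply (ex_RInt_scal (V := R_NormedModule)), Hex.
  - intros t _; rewrite Cmod_mult; unfold scal; simpl; unfold mult; simpl.
    rewrite Rmult_comm; apply Rmult_le_compat_r; [apply Cmod_ge_0|].
    apply Rle_trans with (1 := circle_kernel_bound r t z (proj1 Hzr)).
    apply Rmult_le_reg_r with (r - Cmod z); [lra|].
    unfold Rdiv; rewrite Rmult_assoc, Rinv_l by lra; unfold r in *; lra.
Qed.

(** For [|z| > 1/2] the division costs at most a factor 2; for [|z| <= 1/2] the quotient is
    bounded. *)
Lemma mean_bdd_divz g p : hol g -> g 0 = 0 -> 0 < p ->
  mean_bdd (fun z => pow_nonneg (Cmod (g z)) p) -> mean_bdd (fun z => pow_nonneg (Cmod (divz g z)) p).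
Proof.
  intros Hg g_0 Hp HM; destruct (hol_bounded_half (divz g) (hol_divz g Hg g_0)) as [B [HB Hhalf]].
  apply mean_bdd_affine with g 2 B; try assumption; try lra; [apply hol_divz; assumption|].
  intros z Hz; assert (G0 := Cmod_ge_0 (divz g z)); assert (G1 := Cmod_ge_0 (g z)).
  destruct (Rle_dec (Cmod z) (1 / 2)) as [L|L].
  - generalize (Hhalf z L); lra.
  - rewrite (divz_spec g z g_0), Cmod_mult in *; nra.
Qed.

(** * Convex functions: an order above 1, or a half-plane *)

Section Dichotomy.
Variable g : C -> C.
Hypothesis Hcv : convex_fun g.
Let Hg : hol g := proj1 Hcv.
Let Hinj : injective_on_disk g := proj1 (proj2 Hcv).
Let Hd : forall z, unit_disk z -> C_derive g z <> 0 := proj1 (proj2 (proj2 Hcv)).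
Let g_0 : g 0 = 0 := proj1 (proj2 (proj2 (proj2 (proj2 Hcv)))).
Let g_1 : C_derive g 0 = 1 := proj2 (proj2 (proj2 (proj2 (proj2 Hcv)))).

(* With [k = m2 / m1 = a + i b], the function [E = m1 g - e0] satisfies [Re E >= 0] and
   [Re (k E) >= 0]; then [(1 + k) E] takes its values in a proper sector. *)
Lemma wedge_mean m1 m2 : supports g m1 -> supports g m2 -> Im (m2 / m1)%C <> 0 ->
  exists c, 1 < c /\ mean_bdd (fun z => pow_nonneg (Cmod (divz g z)) c).
Proof.
  intros [N1 [c1 H1]] [N2 [c2 H2]] HI.
  set (k := (m2 / m1)%C) in *; set (a := Re k); set (b := Im k); fold b in HI.
  (* The vertex of the wedge: the intersection of the lines [Re w = c1] and [Re (k w) = c2]. *)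
  set (e0 := (c1, (a * c1 - c2) / b) : C).
  set (E := fun z => ((1 + k) * (m1 * g z - e0))%C).
  assert (Ek : k = (a, b)) by (unfold a, b; destruct k; reflexivity).
  set (K := Rabs ((1 + a) * a / b + b) + Rabs ((1 + a) / b)).
  assert (HK : 0 <= K) by (unfold K; generalize (Rabs_pos ((1 + a) * a / b + b)) (Rabs_pos ((1 + a) / b)); lra).
  assert (HE : hol E).
  { apply hol_scal, hol_minus; [apply hol_scal, Hg|apply hol_const]. }
  assert (Hsec : forall z, unit_disk z -> Rabs (Im (E z)) <= K * Re (E z) /\ 0 <= Re (E z)).
  { intros z Hz; specialize (H1 z Hz); specialize (H2 z Hz).
    replace (m2 * g z)%C with (k * (m1 * g z))%C in H2 by (unfold k; field; exact N1).
    set (w := (m1 * g z)%C) in *; set (x := Re w - c1); set (u := Re (k * w)%C - c2).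
    assert (Hy : Im w - (a * c1 - c2) / b = (a * x - u) / b).
    { unfold u, x; rewrite Ek; unfold Re, Im; simpl; field; exact HI. }
    assert (ER : Re (E z) = x + u).
    { unfold E; fold w; replace (Re ((1 + k) * (w - e0))%C)
        with ((1 + a) * x - b * (Im w - (a * c1 - c2) / b)).
      - rewrite Hy; field; exact HI.
      - rewrite Ek; unfold x, e0, Re, Im; simpl; ring. }
    assert (EI : Im (E z) = ((1 + a) * a / b + b) * x - (1 + a) / b * u).
    { unfold E; fold w; replace (Im ((1 + k) * (w - e0))%C)
        with ((1 + a) * (Im w - (a * c1 - c2) / b) + b * x).
      - rewrite Hy; field; exact HI.
      - rewrite Ek; unfold x, e0, Re, Im; simpl; ring. }
    assert (Hx : 0 <= x) by (unfold x; lra).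
    assert (Hu : 0 <= u) by (unfold u; lra).
    rewrite ER, EI; split; [|lra].
    apply Rle_trans with (1 := Rabs_triang _ _).
    rewrite Rabs_Ropp, !Rabs_mult, (Rabs_pos_eq x), (Rabs_pos_eq u) by assumption.
    unfold K; generalize (Rabs_pos ((1 + a) * a / b + b)) (Rabs_pos ((1 + a) / b)).
    generalize (Rabs ((1 + a) * a / b + b)) (Rabs ((1 + a) / b)); intros; nra. }
  set (th := atan K).
  assert (Hth : 0 <= th < PI / 2).
  { split; [|apply atan_bound]; unfold th; rewrite <- atan_0.
    destruct HK as [L| <-]; [left; apply atan_increasing, L|lra]. }
  (* The harmonic mean of 1 and [(PI/2) / th], hence strictly between them; it also makes sense for
     [th = 0]. *)
  set (s := 2 * PI / (PI + 2 * th)).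
  assert (HPI := PI_RGT_0).
  assert (Hs : 1 < s).
  { unfold s; apply Rmult_lt_reg_r with (PI + 2 * th); [lra|].
    unfold Rdiv; rewrite Rmult_assoc, Rinv_l; lra. }
  assert (Hsth : s * th < PI / 2).
  { unfold s; apply Rmult_lt_reg_r with (PI + 2 * th); [lra|].
    replace (2 * PI / (PI + 2 * th) * th * (PI + 2 * th)) with (2 * PI * th) by (field; lra).
    nra. }
  exists s; split; [exact Hs|].
  apply mean_bdd_divz; [exact Hg|exact g_0|lra|].
  assert (Nk : (1 + k)%C <> 0).
  { intros Z; apply HI; unfold b; replace (Im k) with (Im (1 + k)%C) by (unfold Im; simpl; ring).
    rewrite Z; apply im_RtoC. }
  apply mean_bdd_affine with E (/ Cmod (m1 * (1 + k))%C) (Cmod (e0 / m1)%C).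
  - exact Hg.
  - exact HE.
  - lra.
  - left; apply Rinv_0_lt_compat, Cmod_gt_0, Cmult_neq_0; assumption.
  - apply Cmod_ge_0.
  - intros z Hz; replace (g z) with (/ (m1 * (1 + k)) * E z + e0 / m1)%C.
    + apply Rle_trans with (1 := Cmod_triangle _ _).
      rewrite Cmod_mult, Cmod_inv by (apply Cmult_neq_0; assumption); lra.
    + unfold E; field; split; assumption.
  - apply mean_bdd_sector with K; try assumption; lra.
Qed.

Lemma pow_nonneg_2 x : 0 <= x -> pow_nonneg x 2 = x ^ 2.
Proof.
  intros [H| <-]; [|rewrite pow_nonneg_nonpos by lra; simpl; ring].
  rewrite pow_nonneg_pos by exact H.
  replace 2 with (INR 2) at 1 by (simpl; ring); apply Rpower_pow, H.
Qed.

(* On a strip, [|h|^2 = 2 (Re h)^2 - Re (h^2)], where the last term has mean zero. *)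
Lemma strip_mean (m : C) (M : R) : m <> 0 -> (forall z, unit_disk z -> Rabs (Re (m * g z)%C) <= M) ->
  mean_bdd (fun z => pow_nonneg (Cmod (divz g z)) 2).
Proof.
  intros Nm HM; set (h := fun z => (m * g z)%C).
  assert (Hh : hol h) by apply hol_scal, Hg.
  apply mean_bdd_divz; [exact Hg|exact g_0|lra|].
  apply mean_bdd_affine with h (/ Cmod m) 0; try assumption; try lra.
  { left; apply Rinv_0_lt_compat, Cmod_gt_0, Nm. }
  { intros z Hz; unfold h; rewrite Cmod_mult; right; field; apply Rgt_not_eq, Cmod_gt_0, Nm. }
  split; [apply circ_cont_hol; [exact Hh|lra]|].
  exists (2 * PI * (2 * M ^ 2)); intros r Hr.
  set (k := fun z => (h z * h z)%C).
  assert (Hk : hol k) by (apply hol_mult; exact Hh).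
  apply Rle_trans with (RInt (fun t => 2 * M ^ 2 * 1 + -1 * Re (k (RtoC r * eit t)%C)) 0 (2 * PI)).
  - apply RInt_le; [left; apply two_pi_pos|apply (circ_cont_ex (fun z => pow_nonneg (Cmod (h z)) 2)); [apply circ_cont_hol; [exact Hh|lra]|exact Hr]| |].
    + apply (ex_RInt_plus (V := R_NormedModule)); apply (ex_RInt_scal (V := R_NormedModule)).
      * apply ex_RInt_const.
      * apply (rcont_ex_RInt (fun t => k (RtoC r * eit t)%C)); intros; apply hol_rcont; assumption.
    + intros t _; rewrite pow_nonneg_2 by apply Cmod_ge_0; rewrite Cmod2_alt.
      assert (A := HM _ (circle_in_disk r t Hr)); fold (h (RtoC r * eit t)%C) in A.
      unfold k; set (w := h (RtoC r * eit t)%C) in *; rewrite re_mult.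
      apply Rabs_le_between in A.
      assert (A' : 0 <= (M - Re w) * (M + Re w)) by (apply Rmult_le_pos; lra).
      clearbody w; unfold pow; lra.
  - rewrite (RInt_lin (fun _ => 1) (fun t => Re (k (RtoC r * eit t)%C))).
    + rewrite (mean_value_Re k r Hk Hr), RInt_const_R; unfold k, h; rewrite g_0.
      replace (m * 0 * (m * 0))%C with (RtoC 0) by ring; rewrite re_RtoC; lra.
    + apply ex_RInt_const.
    + apply (rcont_ex_RInt (fun t => k (RtoC r * eit t)%C)); intros; apply hol_rcont; assumption.
Qed.

(** Schwarz is used in both directions. The map [k] of the disk into the half-plane, followed by the
    inverse of [g], has derivative of modulus [2 M] at 0, so [2 M <= 1]. The map [phi], which takes
    the half-plane back into the disk after [g], has derivative of modulus [1 / (2 M)], so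
    [2 M >= 1]. Equality forces [phi z = m z], and this is solved for [g]. *)
Lemma half_plane_rigidity m M : Cmod m = 1 -> 0 < M ->
  (forall z, unit_disk z -> - M <= Re (m * g z)%C) ->
  (forall w, - M < Re (m * w)%C -> image_of_disk g w) ->
  forall z, unit_disk z -> g z = (z / (1 - m * z))%C.
Proof.
  intros Hm HM Hlow Honto.
  assert (Nm : m <> 0) by (apply Cmod_neq_0; lra).
  assert (Nz := one_minus_neq_0).
  assert (Hcay : forall z, unit_disk z -> - (1 / 2) < Re (z / (1 - z))%C).
  { intros z Hz; assert (N := Nz z Hz); unfold unit_disk in Hz.
    assert (E : Re (z / (1 - z))%C + 1 / 2 = (1 - Cmod z ^ 2) * / (2 * Cmod (1 - z)%C ^ 2)).
    { assert (Np := N); apply Cmod_gt_0 in Np.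
      assert (P : 0 < Cmod (1 - z)%C ^ 2) by (apply pow_lt, Np).
      rewrite !Cmod2_alt in *; unfold Re, Im in *; destruct z as [x y]; simpl in *; field; lra. }
    assert (0 < (1 - Cmod z ^ 2) * / (2 * Cmod (1 - z)%C ^ 2)); [|lra].
    apply Rmult_lt_0_compat; [generalize (Cmod_ge_0 z); simpl; nra|].
    apply Rinv_0_lt_compat; apply Cmod_gt_0 in N; assert (0 < Cmod (1 - z)%C ^ 2) by (apply pow_lt, N); lra. }
  set (k := fun z => (RtoC (2 * M) / m * (z / (1 - z)))%C).
  assert (Hk : hol k).
  { apply hol_scal, hol_div; [apply hol_id|apply hol_minus; [apply hol_const|apply hol_id]|exact Nz]. }
  assert (Dk : forall z, unit_disk z -> image_of_disk g (k z)).
  { intros z Hz; apply Honto; unfold k.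
    replace (m * (RtoC (2 * M) / m * (z / (1 - z))))%C with (RtoC (2 * M) * (z / (1 - z)))%C
      by (field; split; [apply Nz, Hz|exact Nm]).
    rewrite re_scal_l; assert (A := Hcay z Hz); nra. }
  assert (k_0 : k 0 = 0) by (unfold k; unfold Cdiv; ring).
  set (om := fun z => ginv g (k z)).
  assert (H0 : ginv g 0 = 0).
  { rewrite <- g_0 at 1; apply ginv_g; [exact Hinj|apply unit_disk_0]. }
  assert (A1 : Cmod (C_derive om 0) <= 1).
  { apply schwarz_derive; [apply hol_ginv; assumption|unfold om; rewrite k_0; exact H0|].
    intros z Hz; left; apply (ginv_spec g), Dk, Hz. }
  assert (D : cder om 0 (/ C_derive g 0 * (RtoC (2 * M) / m))%C).
  { apply (der_comp idC (ginv g) k).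
    - apply der_eq with (RtoC (2 * M) / m * ((1 * (1 - 0) - 0 * (0 - 1)) / ((1 - 0) * (1 - 0))))%C.
      + apply der_scal, (der_div idC idC (fun z => 1 - z)%C).
        * apply der_pos.
        * apply der_minus; [apply der_const|apply (der_pos idC)].
        * apply Nz, unit_disk_0.
      + replace (1 - 0)%C with (RtoC 1) by ring; field; exact Nm.
    - rewrite k_0; rewrite <- H0 at 2; apply cder_ginv; [exact Hcv|].
      rewrite <- k_0; apply Dk, unit_disk_0. }
  rewrite (cder_C_derive _ _ _ D), g_1 in A1.
  rewrite Cmod_mult, Cmod_inv, Cmod_1, Rinv_1, Rmult_1_l, Cmod_div, Hm, Cmod_R, Rabs_pos_eq in A1
    by (lra || exact Nm || apply C1_nz).
  set (h := fun z => (m * g z)%C).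
  assert (Hh : hol h) by apply hol_scal, Hg.
  assert (Nh : forall z, unit_disk z -> (h z + RtoC (2 * M))%C <> 0).
  { intros z Hz; apply Re_pos_neq_0; rewrite re_plus, re_RtoC; generalize (Hlow z Hz); unfold h; lra. }
  set (phi := fun z => (h z / (h z + RtoC (2 * M)))%C).
  assert (Hphi : hol phi).
  { apply hol_div; [exact Hh|apply hol_plus; [exact Hh|apply hol_const]|exact Nh]. }
  assert (h_0 : h 0 = 0) by (unfold h; rewrite g_0; ring).
  assert (phi_0 : phi 0 = 0) by (unfold phi; rewrite h_0; unfold Cdiv; ring).
  assert (Dphi : forall z, unit_disk z -> Cmod (phi z) <= 1).
  { intros z Hz; apply Cmod_div_le_1; [apply Nh, Hz|].
    rewrite !Cmod2_alt, re_plus, re_RtoC.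
    replace (Im (h z + RtoC (2 * M))%C) with (Im (h z)) by (unfold Im; simpl; ring).
    assert (B := Hlow z Hz); fold (h z) in B; revert B.
    generalize (Re (h z)) (Im (h z)); intros x y B; simpl; nra. }
  assert (N2M : RtoC (2 * M) <> 0) by (apply RtoC_neq_0; lra).
  assert (Dp : cder phi 0 (m / RtoC (2 * M))%C).
  { assert (Dh : cder h 0 m).
    { apply der_eq with (m * C_derive g 0)%C; [|rewrite g_1; ring].
      apply der_scal, hol_der; [exact Hg|apply unit_disk_0]. }
    apply der_eq with ((m * (h 0 + RtoC (2 * M)) - h 0 * (m + 0)) / ((h 0 + RtoC (2 * M)) * (h 0 + RtoC (2 * M))))%C.
    - apply (der_div idC h (fun z => h z + RtoC (2 * M))%C); [exact Dh| |apply Nh, unit_disk_0].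
      apply der_plus; [exact Dh|apply der_const].
    - rewrite h_0, Cplus_0_l; field; exact N2M. }
  assert (A2 := schwarz_derive phi Hphi phi_0 Dphi).
  rewrite (cder_C_derive _ _ _ Dp), Cmod_div, Hm, Cmod_R, Rabs_pos_eq in A2 by (lra || exact N2M).
  assert (EM : 2 * M = 1).
  { assert (B : 1 <= 2 * M).
    { apply Rmult_le_compat_r with (r := 2 * M) in A2; [|lra].
      unfold Rdiv in A2; rewrite Rmult_assoc, Rinv_l in A2; lra. }
    lra. }
  intros z Hz.
  assert (E := schwarz_equality phi z Hphi phi_0 Dphi).
  rewrite (cder_C_derive _ _ _ Dp), EM in E.
  replace (m / 1)%C with m in E by (field; apply C1_nz).
  specialize (E Hm Hz).
  assert (N := Nh z Hz); rewrite EM in N; unfold phi in E; rewrite EM in E.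
  assert (E2 : (h z * (1 - m * z) = m * z)%C).
  { transitivity (h z / (h z + 1) * (h z + 1) - h z * (m * z))%C; [field; exact N|].
    rewrite E; ring. }
  assert (N3 : (1 - m * z)%C <> 0).
  { apply Nz; unfold unit_disk in *; rewrite Cmod_mult, Hm; lra. }
  transitivity (/ m * (h z * (1 - m * z)) / (1 - m * z))%C.
  - unfold h; field; split; assumption.
  - rewrite E2; field; split; assumption.
Qed.

Lemma convex_fun_dichotomy :
  (exists c, 1 < c /\ mean_bdd (fun z => pow_nonneg (Cmod (divz g z)) c)) \/
  (exists m, Cmod m = 1 /\ forall z, unit_disk z -> g z = (z / (1 - m * z))%C).
Proof.
  destruct (classic (exists c, 1 < c /\ mean_bdd (fun z => pow_nonneg (Cmod (divz g z)) c)))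
    as [Y|N]; [left; exact Y|right].
  destruct (convex_fun_not_onto g Hcv) as [w0 Hw0].
  destruct (supporting_line g w0 Hcv Hw0) as [m0 [Nm0 Hm0]].
  assert (Np := Nm0); apply Cmod_gt_0 in Np.
  assert (NR : RtoC (Cmod m0) <> 0) by (apply RtoC_neq_0; lra).
  set (m := (m0 / RtoC (Cmod m0))%C).
  assert (Hm : Cmod m = 1).
  { unfold m; rewrite Cmod_div, Cmod_R, Rabs_pos_eq by (lra || exact NR); field; lra. }
  assert (Nm : m <> 0) by (apply Cmod_neq_0; lra).
  assert (Sm : supports g m).
  { split; [exact Nm|]; exists (/ Cmod m0 * Re (m0 * w0)%C); intros z Hz.
    replace (m * g z)%C with (RtoC (/ Cmod m0) * (m0 * g z))%C
      by (unfold m; rewrite RtoC_inv by lra; field; exact NR).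
    rewrite re_scal_l; apply Rmult_le_compat_l; [left; apply Rinv_0_lt_compat, Np|apply Hm0, Hz]. }
  (* A supporting direction not parallel to [m] would put the image in a wedge, an opposite one in a
     strip. Both give an order above 1, excluded by [N]. *)
  assert (Hpar : forall m', supports g m' -> exists k, 0 < k /\ m' = (RtoC k * m)%C).
  { intros m' Sm'; set (q := (m' / m)%C).
    destruct (Req_dec (Im q) 0) as [E|E]; [|destruct N; apply (wedge_mean m m'); assumption].
    assert (Eq : m' = (RtoC (Re q) * m)%C).
    { replace (RtoC (Re q)) with q; [unfold q; field; exact Nm|].
      apply injective_projections; [reflexivity|exact E]. }
    destruct (Rtotal_order (Re q) 0) as [L|[Z|L]]; [|destruct Sm' as [N' _]; destruct N'; rewrite Eq, Z; ring|exists (Re q); auto].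
    destruct N; exists 2; split; [lra|].
    destruct Sm as [_ [c Hc]], Sm' as [_ [c' Hc']].
    apply strip_mean with m (Rabs c + Rabs (c' / Re q)); [exact Nm|]; intros z Hz.
    specialize (Hc z Hz); specialize (Hc' z Hz).
    rewrite Eq, <- Cmult_assoc, re_scal_l in Hc'.
    assert (B : Re (m * g z)%C <= c' / Re q).
    { assert (Z : c' / Re q * Re q = c') by (field; lra); nra. }
    apply Rabs_le; generalize (Rle_abs c) (Rle_abs (c' / Re q)) (Rle_abs (- c)) (Rabs_Ropp c)
      (Rabs_pos c) (Rabs_pos (c' / Re q)); intros; lra. }
  destruct Sm as [_ [c Hc]].
  (* [M] is the least constant for the direction [m], so that its half-plane touches the image. *)
  destruct (completeness (fun x => exists z, unit_disk z /\ x = - Re (m * g z)%C)) as [M [HM1 HM2]].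
  { exists (- c); intros x [z [Hz ->]]; generalize (Hc z Hz); lra. }
  { exists (- Re (m * g 0)%C); exists (RtoC 0); split; [apply unit_disk_0|reflexivity]. }
  exists m; split; [exact Hm|].
  apply (half_plane_rigidity m M Hm).
  - assert (I0 : image_of_disk g 0) by (rewrite <- g_0; apply image_intro, unit_disk_0).
    destruct (image_open g Hcv 0 I0) as [d [Hd0 Hop]].
    destruct (Hop (- RtoC (d / 2) / m)%C) as [z [Hz Ez]].
    { replace (- RtoC (d / 2) / m - 0)%C with (- RtoC (d / 2) / m)%C by ring.
      rewrite Cmod_div, Cmod_opp, Cmod_R, Hm, Rabs_pos_eq by (lra || exact Nm); lra. }
    apply Rlt_le_trans with (d / 2); [lra|]; apply HM1; exists z; split; [exact Hz|].
    rewrite Ez; replace (m * (- RtoC (d / 2) / m))%C with (RtoC (- (d / 2)))%C.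
    + rewrite re_RtoC; ring.
    + rewrite RtoC_opp; field; exact Nm.
  - intros z Hz; assert (A : - Re (m * g z)%C <= M) by (apply HM1; exists z; auto); lra.
  - intros w Hw; apply NNPP; intros Nw.
    (* A point [w] missed inside the half-plane has a supporting line of its own, necessarily in the
       direction [m], which would improve the least constant [M]. *)
    destruct (supporting_line g w Hcv Nw) as [m' [Nm' Hm']].
    destruct (Hpar m') as [k [Hk ->]]; [split; [exact Nm'|exists (Re (m' * w)%C); exact Hm']|].
    assert (A : M <= - Re (m * w)%C); [|lra].
    apply HM2; intros x [z [Hz ->]]; specialize (Hm' z Hz).
    rewrite <- !Cmult_assoc, !re_scal_l in Hm'; apply Rmult_le_reg_l in Hm'; [lra|exact Hk].
Qed.

End Dichotomy.

(** * Close-to-convex functions over a half-plane *)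

Lemma Re_inv_pos w : 0 < Re w -> 0 < Re (/ w)%C.
Proof.
  intros H; assert (N := Re_pos_neq_0 w H); apply Cmod_gt_0 in N.
  assert (P : 0 < Cmod w ^ 2) by (apply pow_lt, N); rewrite Cmod2_alt in P.
  unfold Re, Im in *; simpl in *; apply Rdiv_lt_0_compat; assumption.
Qed.

(* Equality case of the coefficient estimate for functions of positive real part. *)
Lemma extremal_positive_part P lam m : hol P -> P 0 = 1 -> C_derive P 0 = (- (2 * m))%C ->
  Cmod m = 1 -> Cmod lam = 1 -> (forall z, unit_disk z -> 0 < Re (lam * P z)%C) ->
  forall z, unit_disk z -> P z = ((1 - m * z) / (1 + m * z))%C.
Proof.
  intros HP P_0 P_1 Hm Hlam HRe.
  assert (Hl : 0 < Re lam).
  { assert (A := HRe 0 unit_disk_0); rewrite P_0, Cmult_1_r in A; exact A. }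
  assert (Nl : lam <> 0) by (apply Cmod_neq_0; lra).
  (* The Cayley transform of the right half-plane onto the disk that sends [lam = lam * P 0] to
     0. *)
  set (phi := fun z => ((lam * P z - lam) / (lam * P z + Cconj lam))%C).
  assert (Nd : forall z, unit_disk z -> (lam * P z + Cconj lam)%C <> 0).
  { intros z Hz; apply Re_pos_neq_0; rewrite re_plus, re_conj; generalize (HRe z Hz); lra. }
  assert (HlP : hol (fun z => lam * P z)%C) by apply hol_scal, HP.
  assert (Hphi : hol phi).
  { apply hol_div; [apply hol_minus; [exact HlP|apply hol_const]
      |apply hol_plus; [exact HlP|apply hol_const]|exact Nd]. }
  assert (phi_0 : phi 0 = 0).
  { unfold phi; rewrite P_0; replace (lam * 1 - lam)%C with (RtoC 0) by ring; unfold Cdiv; ring. }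
  assert (Dphi : forall z, unit_disk z -> Cmod (phi z) <= 1).
  { intros z Hz; apply Cmod_div_le_1; [apply Nd, Hz|assert (R1 := HRe z Hz); revert R1].
    generalize (lam * P z)%C; intros w R1.
    rewrite !Cmod2_alt, re_plus, re_conj, Re_minus, Im_minus.
    replace (Im (w + Cconj lam)%C) with (Im w - Im lam) by (unfold Im; simpl; ring).
    revert R1; generalize (Re w); intros x R1; simpl; nra. }
  assert (D : cder phi 0 (- lam * m / RtoC (Re lam))%C).
  { assert (DP : cder (fun z => lam * P z)%C 0 (lam * - (2 * m))%C).
    { rewrite <- P_1; apply der_scal, hol_der; [exact HP|apply unit_disk_0]. }
    assert (E : (lam + Cconj lam)%C = (2 * RtoC (Re lam))%C)
      by (apply injective_projections; unfold Re; simpl; ring).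
    assert (NR : RtoC (Re lam) <> 0) by (apply RtoC_neq_0; lra).
    apply der_eq with (((lam * - (2 * m) - 0) * (lam * P 0 + Cconj lam)
      - (lam * P 0 - lam) * (lam * - (2 * m) + 0)) / ((lam * P 0 + Cconj lam) * (lam * P 0 + Cconj lam)))%C.
    - apply (der_div idC (fun z => lam * P z - lam)%C (fun z => lam * P z + Cconj lam)%C).
      + apply der_minus; [exact DP|apply der_const].
      + apply der_plus; [exact DP|apply der_const].
      + apply Nd, unit_disk_0.
    - rewrite P_0, Cmult_1_r, E; field; exact NR. }
  assert (A := schwarz_derive phi Hphi phi_0 Dphi).
  assert (S := schwarz_equality phi).
  rewrite (cder_C_derive _ _ _ D) in A, S.
  assert (Em : Cmod (- lam * m / RtoC (Re lam))%C = / Re lam).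
  { rewrite Cmod_div, Cmod_mult, Cmod_opp, Hlam, Hm, Cmod_R, Rabs_pos_eq; [field; lra|lra|].
    apply RtoC_neq_0; lra. }
  rewrite Em in A, S.
  (* [|phi'(0)| = 1 / Re lam] is at least 1 because [|lam| = 1], and at most 1 by Schwarz. Hence
     [lam = 1] and the equality case applies. *)
  assert (R1 : Re lam = 1).
  { apply Rle_antisym; [rewrite <- Hlam; apply Re_le_Cmod|].
    apply Rmult_le_compat_r with (r := Re lam) in A; [|lra]; rewrite Rinv_l in A; lra. }
  assert (I1 : Im lam = 0).
  { assert (B := Cmod2_alt lam); rewrite Hlam, R1 in B; simpl in B; nra. }
  assert (El : lam = 1) by (apply injective_projections; assumption).
  intros z Hz; specialize (S z Hphi phi_0 Dphi ltac:(rewrite R1; apply Rinv_1) Hz).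
  assert (N := Nd z Hz); unfold phi in S; rewrite R1, El in S; rewrite El in N.
  replace (Cconj 1) with (RtoC 1) in * by (apply injective_projections; simpl; ring).
  rewrite Cmult_1_l in S, N.
  set (w := (m * z)%C) in *.
  assert (Hw : unit_disk w) by (apply unit_disk_mult; [lra|exact Hz]).
  assert (Nw := one_plus_neq_0 w Hw).
  assert (S2 : (P z - 1 = - w * (P z + 1))%C).
  { transitivity ((P z - 1) / (P z + 1) * (P z + 1))%C; [field; exact N|].
    rewrite S; unfold w; field; apply C1_nz. }
  transitivity (((P z - 1) + w * (P z + 1) + (1 - w)) / (1 + w))%C; [field; exact Nw|].
  rewrite S2; field; exact Nw.
Qed.

Lemma convex_fun_id : convex_fun (fun z => z).
Proof.
  assert (D : forall z, C_derive (fun z => z) z = 1) by (intros; apply cder_C_derive, (der_pos idC)).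
  split; [apply hol_id|split; [intros z w _ _ E; exact E|split; [|split]]].
  - intros z _; rewrite D; apply C1_nz.
  - intros u v t [z [Hz <-]] [w [Hw <-]] Ht; unfold unit_disk in *.
    exists (RtoC (1 - t) * z + RtoC t * w)%C; split; [|reflexivity].
    apply Rle_lt_trans with (1 := Cmod_triangle _ _).
    rewrite !Cmod_mult, !Cmod_R, !Rabs_pos_eq by lra.
    assert (A := Rmult_le_compat_l (1 - t) _ _ ltac:(lra) (Rmax_l (Cmod z) (Cmod w))).
    assert (B := Rmult_le_compat_l t _ _ ltac:(lra) (Rmax_r (Cmod z) (Cmod w))).
    assert (Rmax (Cmod z) (Cmod w) < 1) by (apply Rmax_lub_lt; assumption); lra.
  - split; [reflexivity|apply D].
Qed.

Lemma divz_id z : divz (fun z => z) z = 1.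
Proof.
  destruct (Ceq_dec z 0) as [->|N].
  - rewrite divz_0; apply cder_C_derive, (der_pos idC).
  - rewrite divz_neq by exact N; field; exact N.
Qed.

(** The identity serves as the convex function [g]. Then [P = f'], both [Q] and [G] are 1, and [|f|]
    is at most [|R|], so the orders below 1 of [P] and [R] pass to [f'] and [f]. *)
Lemma Re_derive_pos_hardy f : hol f -> f 0 = 0 -> C_derive f 0 = 1 ->
  (forall z, unit_disk z -> 0 < Re (C_derive f z)) ->
  (forall s, 0 < s < 1 -> hardy s (C_derive f)) /\ (forall s, 0 < s < 1 -> hardy s f).
Proof.
  intros Hf f_0 f_1 HR; split; intros s Hs; apply hardy_intro.
  - apply hol_C_derive, Hf.
  - apply mean_bdd_Re_nonneg; [apply hol_C_derive, Hf| |exact Hs].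
    intros z Hz; left; apply HR, Hz.
  - exact Hf.
  - assert (HP : forall z, unit_disk z -> 0 < Re (1 * (C_derive f z / C_derive (fun z => z) z))%C).
    { intros z Hz; replace (C_derive (fun z => z) z) with (RtoC 1)
        by (symmetry; apply cder_C_derive, (der_pos idC)).
      replace (1 * (C_derive f z / 1))%C with (C_derive f z) by (field; apply C1_nz); apply HR, Hz. }
    apply mean_bdd_pow_le with (fun z => divz f z / divz (fun z => z) z)%C;
      [exact Hf|apply hol_R; [exact Hf|exact f_0|apply convex_fun_id]|lra| |].
    + intros z Hz.
      apply Rle_trans with (1 := f_factor f (fun z => z) f_0 convex_fun_id z Hz).
      rewrite divz_id, Cmod_1, Rmult_1_r; lra.
    + apply (mean_R f (fun z => z) 1); try assumption; [apply convex_fun_id|apply Cmod_1].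
Qed.

Lemma half_plane_case f g lam m : hol f -> f 0 = 0 -> C_derive f 0 = 1 ->
  C_derive (C_derive f) 0 = 0 -> Cmod lam = 1 -> Cmod m = 1 ->
  (forall z, unit_disk z -> g z = (z / (1 - m * z))%C) ->
  (forall z, unit_disk z -> 0 < Re (lam * (C_derive f z / C_derive g z))%C) ->
  forall z, unit_disk z -> 0 < Re (C_derive f z).
Proof.
  intros Hf f_0 f_1 f_2 Hlam Hm Hgz HP.
  assert (Nm : forall z, unit_disk z -> (1 - m * z)%C <> 0).
  { intros z Hz; apply one_minus_neq_0, unit_disk_mult; [lra|exact Hz]. }
  assert (Dm : forall z, cder (fun z => 1 - m * z)%C z (- m)%C).
  { intros z; apply der_eq with (0 - m * 1)%C; [|ring].
    apply der_minus; [apply der_const|apply der_scal, (der_pos idC)]. }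
  assert (Dg : forall z, unit_disk z -> C_derive g z = (/ ((1 - m * z) * (1 - m * z)))%C).
  { intros z Hz; apply cder_C_derive; destruct (unit_disk_open z Hz) as [d [Hd Ho]].
    apply der_ext_loc with (fun z => z / (1 - m * z))%C d; [exact Hd| |].
    - intros w Hw; symmetry; apply Hgz, Ho, Hw.
    - apply der_eq with ((1 * (1 - m * z) - z * - m) / ((1 - m * z) * (1 - m * z)))%C.
      + apply (der_div idC idC (fun z => 1 - m * z)%C); [apply der_pos|apply Dm|apply Nm, Hz].
      + field; apply Nm, Hz. }
  set (P := fun z => (C_derive f z * ((1 - m * z) * (1 - m * z)))%C).
  assert (Hf' := hol_C_derive f Hf).
  assert (Hml : hol (fun z => 1 - m * z)%C) by (apply hol_minus; [apply hol_const|apply hol_scal, hol_id]).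
  assert (HPh : hol P) by (apply hol_mult; [exact Hf'|apply hol_mult; exact Hml]).
  assert (EP : forall z, unit_disk z -> P z = ((1 - m * z) / (1 + m * z))%C).
  { apply (extremal_positive_part P lam m HPh); try assumption.
    - unfold P; rewrite f_1; ring.
    (* [P'(0) = f''(0) - 2 m], and [f''(0)] vanishes with [a_2]. *)
    - apply cder_C_derive; apply der_eq with (C_derive (C_derive f) 0 * ((1 - m * 0) * (1 - m * 0))
        + C_derive f 0 * (- m * (1 - m * 0) + (1 - m * 0) * - m))%C.
      + apply (der_mult idC (C_derive f) (fun z => (1 - m * z) * (1 - m * z))%C).
        * apply hol_der; [exact Hf'|apply unit_disk_0].
        * apply (der_mult idC (fun z => 1 - m * z)%C (fun z => 1 - m * z)%C); apply Dm.
      + rewrite f_1, f_2; ring.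
    - intros z Hz; unfold P; assert (A := HP z Hz); rewrite Dg in A by exact Hz.
      replace (C_derive f z * ((1 - m * z) * (1 - m * z)))%C
        with (C_derive f z / / ((1 - m * z) * (1 - m * z)))%C; [exact A|].
      field; apply Nm, Hz. }
  intros z Hz; set (w := (m * z)%C).
  assert (Hw : unit_disk w) by (apply unit_disk_mult; [lra|exact Hz]).
  assert (N := Nm z Hz); fold w in N.
  assert (Nw := one_plus_neq_0 w Hw).
  assert (E : C_derive f z = (/ (1 - w * w))%C).
  { transitivity (P z / ((1 - w) * (1 - w)))%C; [unfold P; fold w; field; exact N|].
    rewrite (EP z Hz); fold w; field; repeat split; try assumption.
    replace (1 - w * w)%C with ((1 - w) * (1 + w))%C by ring; apply Cmult_neq_0; assumption. }
  rewrite E; apply Re_inv_pos, Re_one_minus_pos, unit_disk_mult; [|exact Hw].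
  unfold unit_disk in Hw; lra.
Qed.

(** * The integral estimates for the class K *)

Lemma class_K_data f : class_K f -> exists g lam, convex_fun g /\ Cmod lam = 1 /\
  forall z, unit_disk z -> 0 < Re (lam * (C_derive f z / C_derive g z))%C.
Proof.
  intros [_ [g [lam [Hg [Hlam HP]]]]]; exists g, lam; split; [|split; assumption].
  apply class_C_convex_fun; [exact Hg|]; intros z Hz E; specialize (HP z Hz).
  rewrite E in HP; unfold Cdiv in HP.
  (* The inverse of 0 evaluates to 0, so a zero of [g'] would make the positive real part equal to
     0. *)
  replace (/ 0)%C with (RtoC 0) in HP.
  - rewrite !Cmult_0_r, re_RtoC in HP; lra.
  - apply injective_projections; simpl; unfold Rdiv; rewrite ?Ropp_0; ring.
Qed.

Lemma close_to_convex_means f a : class_K f -> normalized_expansion f a ->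
  (a 2%nat = RtoC 0 -> hardy (1 / 3) (C_derive f) /\ hardy (1 / 2) f) /\
  (a 2%nat <> RtoC 0 ->
    (forall p : R, 0 < p < 1 / 3 -> hardy p (C_derive f)) /\
    (forall q : R, 0 < q < 1 / 2 -> hardy q f)).
Proof.
  intros HK [Ha0 [Ha1 Ha]]; destruct (class_K_data f HK) as [g [lam [Hcv [Hlam HP]]]].
  assert (Hf := expansion_hol a f Ha).
  assert (f_0 : f 0 = 0) by (rewrite (expansion_0 a f Ha); exact Ha0).
  assert (f_1 : C_derive f 0 = 1) by (rewrite (expansion_1 a f Ha); exact Ha1).
  split.
  - intros Ha2.
    assert (f_2 : C_derive (C_derive f) 0 = 0) by (rewrite (expansion_2 a f Ha), Ha2; ring).
    destruct (convex_fun_dichotomy g Hcv) as [[c [Hc HG]]|[m [Hm Hgz]]].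
    + apply (hardy_critical f g lam) with c; assumption.
    + assert (HR := half_plane_case f g lam m Hf f_0 f_1 f_2 Hlam Hm Hgz HP).
      destruct (Re_derive_pos_hardy f Hf f_0 f_1 HR) as [H1 H2]; split; [apply H1|apply H2]; lra.
  - intros _; split.
    + intros p Hp; apply (hardy_derive f g lam); assumption.
    + intros q Hq; apply (hardy_f f g lam); assumption.
Qed.

(** * Sharpness *)

Definition cayley (z : C) : C := ((1 + z) / (1 - z))%C.

Lemma cayley_0 : cayley 0 = 1.
Proof. unfold cayley; rewrite Cplus_0_r; replace (1 - 0)%C with (RtoC 1) by ring; field; apply C1_nz. Qed.

Lemma Re_cayley z : unit_disk z -> 0 < Re (cayley z).
Proof.
  intros Hz; assert (N := one_minus_neq_0 z Hz).
  replace (cayley z) with (2 * / (1 - z) - 1)%C by (unfold cayley; field; exact N).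
  assert (Np := N); apply Cmod_gt_0 in Np.
  assert (P : 0 < Cmod (1 - z)%C ^ 2) by (apply pow_lt, Np).
  assert (Hz2 : Cmod z ^ 2 < 1) by (unfold unit_disk in Hz; generalize (Cmod_ge_0 z); simpl; nra).
  rewrite Cmod2_alt in P, Hz2.
  replace (Re (2 * / (1 - z) - 1)%C)
    with ((1 - (Re z ^ 2 + Im z ^ 2)) / (Re (1 - z)%C ^ 2 + Im (1 - z)%C ^ 2)).
  - apply Rdiv_lt_0_compat; lra.
  - unfold Re, Im in *; destruct z as [x y]; simpl in *; field; lra.
Qed.

Lemma cayley_onto v : 0 < Re v -> exists z, unit_disk z /\ cayley z = v.
Proof.
  intros Hv.
  assert (N : (v + 1)%C <> 0) by (apply Re_pos_neq_0; rewrite re_plus, re_RtoC; lra).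
  exists ((v - 1) / (v + 1))%C; split.
  - apply Cmod_div_lt_1; [exact N|]; rewrite !Cmod2_alt; unfold Re, Im in *; simpl; nra.
  - unfold cayley; field; split; [exact N|].
    replace (v + 1 - (v - 1))%C with (RtoC 2) by (apply injective_projections; simpl; ring).
    apply RtoC_neq_0; lra.
Qed.

Lemma cayley_inj z w : unit_disk z -> unit_disk w -> cayley z = cayley w -> z = w.
Proof.
  intros Hz Hw E; assert (Nz := one_minus_neq_0 z Hz); assert (Nw := one_minus_neq_0 w Hw).
  assert (N2 : RtoC 2 <> 0) by (apply RtoC_neq_0; lra).
  assert (E' : (2 * / (1 - z))%C = (2 * / (1 - w))%C).
  { replace (2 * / (1 - z))%C with (cayley z + 1)%C by (unfold cayley; field; exact Nz).
    rewrite E; unfold cayley; field; exact Nw. }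
  transitivity (1 - 2 / (2 * / (1 - z)))%C; [field; auto|].
  rewrite E'; field; auto.
Qed.

Lemma cder_cayley z : unit_disk z -> cder cayley z (2 / ((1 - z) * (1 - z)))%C.
Proof.
  intros Hz; assert (N := one_minus_neq_0 z Hz).
  apply der_eq with (((0 + 1) * (1 - z) - (1 + z) * (0 - 1)) / ((1 - z) * (1 - z)))%C.
  - apply (der_div idC (fun z => 1 + z)%C (fun z => 1 - z)%C).
    + apply der_plus; [apply der_const|apply (der_pos idC)].
    + apply der_minus; [apply der_const|apply (der_pos idC)].
    + exact N.
  - field; exact N.
Qed.

Lemma hol_cayley : hol cayley.
Proof.
  apply hol_div; [apply hol_plus; [apply hol_const|apply hol_id]
    |apply hol_minus; [apply hol_const|apply hol_id]|exact one_minus_neq_0].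
Qed.

(** * Powers and sectors *)

Lemma clog_cexp u : Rabs (Im u) < PI / 2 -> clog (cexp u) = u.
Proof.
  intros H; apply Rabs_lt_between in H.
  apply injective_projections; unfold clog; cbn [fst snd].
  - rewrite Cmod_cexp; apply ln_exp.
  - unfold carg, cexp; rewrite re_scal_l, im_scal_l; unfold eit, Re, Im; cbn [fst snd].
    rewrite <- (atan_tan (snd u)) at 3 by (unfold Im in H; lra).
    f_equal; unfold tan; field; split; [apply Rgt_not_eq, cos_gt_0; unfold Im in H; lra|].
    apply Rgt_not_eq, exp_pos.
Qed.

Lemma Re_cpow_pos v s : Rabs (s * carg v) < PI / 2 -> 0 < Re (cpow v s).
Proof.
  intros H; apply Rabs_lt_between in H; rewrite Re_cpow.
  apply Rmult_lt_0_compat; [apply exp_pos|apply cos_gt_0; lra].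
Qed.

Lemma cpow_cpow_inv v s : 0 < Re v -> s <> 0 -> Rabs (s * carg v) < PI / 2 -> cpow (cpow v s) (/ s) = v.
Proof.
  intros Hv Hs H; unfold cpow at 1; unfold cpow; rewrite clog_cexp.
  - rewrite Cmult_assoc, <- RtoC_mult, Rinv_l, Cmult_1_l by exact Hs; apply cexp_clog, Hv.
  - rewrite im_scal_l; exact H.
Qed.

Lemma cpow_one_l s : cpow 1 s = 1.
Proof.
  assert (E : clog 1 = 0).
  { unfold clog, carg; rewrite Cmod_1, ln_1, re_RtoC, im_RtoC; unfold Rdiv; rewrite Rmult_0_l, atan_0.
    reflexivity. }
  unfold cpow; rewrite E, Cmult_0_r; apply cexp_0.
Qed.

(* The sector [|arg w| < gam pi / 2] as an intersection of two half-planes, where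
   [b = (1 - gam) pi / 2]. *)
Lemma sector_cpow gam w : 0 < gam <= 1 -> let b := (1 - gam) * PI / 2 in
  0 < cos b * Re w + sin b * Im w -> 0 < cos b * Re w - sin b * Im w ->
  exists v, 0 < Re v /\ cpow v gam = w.
Proof.
  intros Hg b H1 H2; assert (HPI := PI_RGT_0).
  assert (Hb : 0 <= b < PI / 2) by (unfold b; split; nra).
  assert (Hcb : 0 < cos b) by (apply cos_gt_0; lra).
  assert (Hw : 0 < Re w) by nra.
  set (al := carg w).
  assert (Hal : Rabs al < PI / 2) by apply carg_bound.
  assert (Hm := Re_pos_Cmod w Hw).
  assert (Ew := Cmod_carg w Hw); fold al in Ew.
  assert (ER : Re w = Cmod w * cos al) by (rewrite Ew at 1; rewrite re_scal_l; reflexivity).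
  assert (EI : Im w = Cmod w * sin al) by (rewrite Ew at 1; rewrite im_scal_l; reflexivity).
  assert (C1 : 0 < cos (b - al)).
  { rewrite cos_minus; apply Rmult_lt_reg_l with (1 := Hm).
    rewrite Rmult_0_r; replace (Cmod w * (cos b * cos al + sin b * sin al))
      with (cos b * (Cmod w * cos al) + sin b * (Cmod w * sin al)) by ring.
    rewrite <- ER, <- EI; exact H1. }
  assert (C2 : 0 < cos (b + al)).
  { rewrite cos_plus; apply Rmult_lt_reg_l with (1 := Hm).
    rewrite Rmult_0_r; replace (Cmod w * (cos b * cos al - sin b * sin al))
      with (cos b * (Cmod w * cos al) - sin b * (Cmod w * sin al)) by ring.
    rewrite <- ER, <- EI; exact H2. }
  apply Rabs_lt_between in Hal.
  (* Both [b - al] and [b + al] lie in [(- PI/2, PI)], where a positive cosine means an angle below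
     [PI/2]. Together they give [|al| < gam * PI/2]. *)
  assert (B1 : b - al < PI / 2).
  { apply Rnot_le_lt; intros L; assert (A := cos_le_0 (b - al) L ltac:(lra)); lra. }
  assert (B2 : b + al < PI / 2).
  { apply Rnot_le_lt; intros L; assert (A := cos_le_0 (b + al) L ltac:(lra)); lra. }
  assert (Hig : / gam * gam = 1) by (apply Rinv_l; lra).
  assert (Hip : 0 < / gam) by (apply Rinv_0_lt_compat; lra).
  assert (Hbg : PI / 2 - b = gam * (PI / 2)) by (unfold b; field).
  assert (Hs : Rabs (/ gam * al) < PI / 2).
  { apply Rabs_lt_between; split.
    - apply Rmult_lt_reg_l with gam; [lra|].
      replace (gam * (/ gam * al)) with al by (field; lra); lra.
    - apply Rmult_lt_reg_l with gam; [lra|].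
      replace (gam * (/ gam * al)) with al by (field; lra); lra. }
  exists (cpow w (/ gam)); split; [apply Re_cpow_pos, Hs|].
  rewrite <- (Rinv_inv gam) at 2; apply cpow_cpow_inv; [exact Hw|lra|exact Hs].
Qed.

Lemma cpow_sector gam v : 0 < gam <= 1 -> let b := (1 - gam) * PI / 2 in 0 < Re v ->
  0 < cos b * Re (cpow v gam) + sin b * Im (cpow v gam) /\
  0 < cos b * Re (cpow v gam) - sin b * Im (cpow v gam).
Proof.
  intros Hg b Hv; assert (HPI := PI_RGT_0); rewrite cpow_polar, re_scal_l, im_scal_l.
  set (x := gam * carg v); unfold eit, Re, Im; cbn [fst snd].
  assert (H := carg_bound v); apply Rabs_lt_between in H.
  assert (Hx : - (gam * (PI / 2)) < x < gam * (PI / 2)) by (unfold x; nra).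
  assert (Hbg : b + gam * (PI / 2) = PI / 2) by (unfold b; field).
  assert (Hb : 0 <= b) by (unfold b; nra).
  assert (HR : 0 < Rpower (Cmod v) gam) by apply exp_pos.
  split.
  - replace (cos b * (Rpower (Cmod v) gam * cos x) + sin b * (Rpower (Cmod v) gam * sin x))
      with (Rpower (Cmod v) gam * cos (b - x)) by (rewrite cos_minus; ring).
    apply Rmult_lt_0_compat; [exact HR|apply cos_gt_0; lra].
  - replace (cos b * (Rpower (Cmod v) gam * cos x) - sin b * (Rpower (Cmod v) gam * sin x))
      with (Rpower (Cmod v) gam * cos (b + x)) by (rewrite cos_plus; ring).
    apply Rmult_lt_0_compat; [exact HR|apply cos_gt_0; lra].
Qed.

(** For [0 < gam <= 1], the normalized map onto the sector of opening [gam * PI] with vertex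
    [- 1 / (2 gam)]; for [gam = 1] it is [z / (1 - z)]. The factor [2 gam] is the derivative of the
    power at 0, since [cayley] has derivative 2 there. *)
Definition wedge (gam : R) (z : C) : C := ((cpow (cayley z) gam - 1) / RtoC (2 * gam))%C.

Lemma cder_wedge gam z : 0 < gam -> unit_disk z ->
  cder (wedge gam) z (cpow (cayley z) (gam - 1) / ((1 - z) * (1 - z)))%C.
Proof.
  intros Hg Hz; assert (N := one_minus_neq_0 z Hz).
  assert (N2 : RtoC gam <> 0) by (apply RtoC_neq_0; lra).
  apply der_ext with (fun z => / RtoC (2 * gam) * (cpow (cayley z) gam - 1))%C.
  { intros; unfold wedge, Cdiv; ring. }
  apply der_eq with (/ RtoC (2 * gam) * (RtoC gam * cpow (cayley z) (gam - 1) * (2 / ((1 - z) * (1 - z))) - 0))%C.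
  - apply der_scal, der_minus; [|apply der_const].
    apply (der_comp idC (fun v => cpow v gam) cayley); [apply cder_cayley, Hz|].
    apply cder_cpow, Re_cayley, Hz.
  - rewrite RtoC_mult; field; repeat split; try assumption; apply RtoC_neq_0; lra.
Qed.

Lemma hol_wedge gam : hol (wedge gam).
Proof.
  apply hol_ext with (fun z => / RtoC (2 * gam) * (cpow (cayley z) gam - 1))%C.
  { intros; unfold wedge, Cdiv; ring. }
  apply hol_scal, hol_minus; [|apply hol_const].
  apply hol_cpow; [apply hol_cayley|exact Re_cayley].
Qed.

(** Two linear inequalities in [u], an affine function of [w]: in this form the convexity of the
    image is immediate. *)
Lemma wedge_image gam w : 0 < gam <= 1 -> let b := (1 - gam) * PI / 2 in
  let u := (RtoC (2 * gam) * w + 1)%C in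
  image_of_disk (wedge gam) w <->
  (0 < cos b * Re u + sin b * Im u /\ 0 < cos b * Re u - sin b * Im u).
Proof.
  intros Hg b u; assert (N : RtoC (2 * gam) <> 0) by (apply RtoC_neq_0; lra); split.
  - intros [z [Hz E]].
    assert (Eu : u = cpow (cayley z) gam) by (unfold u; rewrite <- E; unfold wedge; field; exact N).
    rewrite Eu; apply cpow_sector; [exact Hg|apply Re_cayley, Hz].
  - intros [H1 H2]; destruct (sector_cpow gam u Hg H1 H2) as [v [Hv Ev]].
    destruct (cayley_onto v Hv) as [z [Hz <-]]; exists z; split; [exact Hz|].
    unfold wedge; rewrite Ev; unfold u; field; exact N.
Qed.

Lemma convex_fun_wedge gam : 0 < gam <= 1 -> convex_fun (wedge gam).
Proof.
  intros Hg.
  assert (D : forall z, unit_disk z -> C_derive (wedge gam) z = (cpow (cayley z) (gam - 1) / ((1 - z) * (1 - z)))%C).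
  { intros z Hz; apply cder_C_derive, cder_wedge; [lra|exact Hz]. }
  split; [apply hol_wedge|split; [|split; [|split; [|split]]]].
  - intros z w Hz Hw E; apply cayley_inj; [exact Hz|exact Hw|].
    assert (N : RtoC (2 * gam) <> 0) by (apply RtoC_neq_0; lra).
    assert (E' : cpow (cayley z) gam = cpow (cayley w) gam).
    { replace (cpow (cayley z) gam) with (RtoC (2 * gam) * wedge gam z + 1)%C by (unfold wedge; field; exact N).
      rewrite E; unfold wedge; field; exact N. }
    assert (B : forall v, Rabs (gam * carg v) < PI / 2).
    { intros v; rewrite Rabs_mult, Rabs_pos_eq by lra.
      generalize (carg_bound v) (Rabs_pos (carg v)); nra. }
    rewrite <- (cpow_cpow_inv (cayley z) gam), <- (cpow_cpow_inv (cayley w) gam), E';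
      try apply B; try apply Re_cayley; try assumption; try lra; reflexivity.
  - intros z Hz; rewrite (D z Hz); apply Cmult_neq_0; [apply cpow_neq_0|].
    assert (N := one_minus_neq_0 z Hz); intros E.
    assert (A := Cinv_r _ (Cmult_neq_0 _ _ N N)); rewrite E, Cmult_0_r in A; apply C1_nz; symmetry; exact A.
  - intros u v t Hu Hv Ht; apply wedge_image in Hu; apply wedge_image in Hv; try exact Hg.
    apply wedge_image; [exact Hg|].
    set (b := (1 - gam) * PI / 2) in *.
    destruct Hu as [U1 U2], Hv as [V1 V2].
    set (x := (RtoC (2 * gam) * u + 1)%C) in *; set (y := (RtoC (2 * gam) * v + 1)%C) in *.
    replace (RtoC (2 * gam) * (RtoC (1 - t) * u + RtoC t * v) + 1)%C
      with (RtoC (1 - t) * x + RtoC t * y)%C by (unfold x, y; rewrite RtoC_minus; ring).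
    assert (ER : Re (RtoC (1 - t) * x + RtoC t * y)%C = (1 - t) * Re x + t * Re y)
      by (rewrite re_plus, !re_scal_l; reflexivity).
    assert (EI : Im (RtoC (1 - t) * x + RtoC t * y)%C = (1 - t) * Im x + t * Im y).
    { replace (Im (RtoC (1 - t) * x + RtoC t * y)%C)
        with (Im (RtoC (1 - t) * x)%C + Im (RtoC t * y)%C) by (unfold Im; simpl; ring).
      rewrite !im_scal_l; reflexivity. }
    rewrite ER, EI.
    assert (Hpos : forall a c, 0 < a -> 0 < c -> 0 < (1 - t) * a + t * c).
    { intros a c Ha Hc; destruct (Req_dec t 0) as [->|Nt]; [lra|].
      assert (0 <= (1 - t) * a) by (apply Rmult_le_pos; lra).
      assert (0 < t * c) by (apply Rmult_lt_0_compat; lra); lra. }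
    assert (P1 := Hpos _ _ U1 V1); assert (P2 := Hpos _ _ U2 V2); split; lra.
  - unfold wedge; rewrite cayley_0, cpow_one_l; replace (1 - 1)%C with (RtoC 0) by ring; unfold Cdiv; ring.
  - rewrite (D 0 unit_disk_0), cayley_0, cpow_one_l; replace (1 - 0)%C with (RtoC 1) by ring.
    field; apply C1_nz.
Qed.

(** * Membership in the classes *)

Lemma normalized_expansion_intro f : hol f -> f 0 = 0 -> C_derive f 0 = 1 ->
  normalized_expansion f (taylor_coef f).
Proof.
  intros Hf H0 H1; assert (Ha := hol_expansion f Hf); split; [|split; [|exact Ha]].
  - rewrite <- (expansion_0 _ f Ha); exact H0.
  - rewrite <- (expansion_1 _ f Ha); exact H1.
Qed.

Lemma convex_fun_class_C g : convex_fun g -> class_C g.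
Proof.
  intros [Hg [Hi [_ [Hc [H0 H1]]]]]; split; [split; [apply hol_holomorphic, Hg|split; [exact Hi|]]|exact Hc].
  exists (taylor_coef g); apply normalized_expansion_intro; assumption.
Qed.

(** Univalence of [f] comes from [close_to_convex_quotient]: two points with the same value would
    make a positive real part vanish. *)
Lemma class_K_intro f g : hol f -> f 0 = 0 -> C_derive f 0 = 1 -> convex_fun g ->
  (forall z, unit_disk z -> 0 < Re (C_derive f z / C_derive g z)%C) -> class_K f.
Proof.
  intros Hf H0 H1 Hg HP.
  assert (HP1 : forall z, unit_disk z -> 0 < Re (1 * (C_derive f z / C_derive g z))%C)
    by (intros z Hz; rewrite Cmult_1_l; apply HP, Hz).
  split.
  - split; [apply hol_holomorphic, Hf|split].
    + intros z w Hz Hw E; apply NNPP; intros N.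
      assert (A := close_to_convex_quotient g Hg f 1 z w Hf HP1 Hz Hw N).
      rewrite E in A; replace (f w - f w)%C with (RtoC 0) in A by ring.
      unfold Cdiv in A; rewrite Cmult_0_l, Cmult_0_r, re_RtoC in A; lra.
    + exists (taylor_coef f); apply normalized_expansion_intro; assumption.
  - exists g, (RtoC 1); split; [apply convex_fun_class_C, Hg|split; [apply Cmod_1|exact HP1]].
Qed.

Lemma cpow_primitive gam : 0 < gam <= 1 -> exists L : C -> C, exists K : R,
  L 1 = 0 /\ 0 <= K /\ (forall v, 0 < Re v -> cder L v (cpow v (gam - 2))) /\
  (forall v, 0 < Re v -> 1 <= Cmod v -> Cmod (L v) <= K + Cmod v).
Proof.
  intros Hg; destruct (Req_dec gam 1) as [->|N1].
  - exists clog, 2; split; [|split; [lra|split]].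
    + unfold clog, carg; rewrite Cmod_1, ln_1, re_RtoC, im_RtoC; unfold Rdiv; rewrite Rmult_0_l, atan_0.
      reflexivity.
    + intros v Hv; apply der_eq with (/ v)%C; [apply cder_clog, Hv|].
      assert (E := cpow_plus v (1 - 2) 1); rewrite (cpow_1 v Hv) in E.
      replace (1 - 2 + 1) with 0 in E by ring.
      assert (E0 : cpow v 0 = 1) by (unfold cpow; rewrite Cmult_0_l; apply cexp_0).
      rewrite E0 in E; assert (Nv := Re_pos_neq_0 v Hv).
      transitivity (1 * / v)%C; [ring|rewrite E; field; exact Nv].
    + intros v Hv H1; apply Rle_trans with (1 := Cmod_Re_Im _); unfold clog, Re at 1, Im at 1; simpl.
      assert (A := carg_bound v); assert (B := PI_4).
      assert (L0 : 0 <= ln (Cmod v)) by (rewrite <- ln_1; apply ln_le; lra).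
      assert (L1 : ln (Cmod v) <= Cmod v).
      { assert (X := exp_ineq1_le (ln (Cmod v))); rewrite exp_ln in X by lra; lra. }
      rewrite (Rabs_pos_eq (ln _)) by exact L0; lra.
  - assert (Nr : RtoC (gam - 1) <> 0) by (apply RtoC_neq_0; lra).
    exists (fun v => / RtoC (gam - 1) * (cpow v (gam - 1) - 1))%C, (2 / (1 - gam)).
    split; [|split; [|split]].
    + rewrite cpow_one_l; ring.
    + left; apply Rdiv_lt_0_compat; lra.
    + intros v Hv; apply der_eq with (/ RtoC (gam - 1) * (RtoC (gam - 1) * cpow v (gam - 1 - 1) - 0))%C.
      * apply der_scal, der_minus; [apply cder_cpow, Hv|apply der_const].
      * replace (gam - 1 - 1) with (gam - 2) by ring; field; exact Nr.
    + intros v Hv H1; rewrite Cmod_mult, Cmod_inv, Cmod_R, Rabs_left by (lra || exact Nr).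
      assert (A := Cmod_triangle_minus (cpow v (gam - 1)) 1); rewrite Cmod_cpow, Cmod_1 in A.
      assert (B : Rpower (Cmod v) (gam - 1) <= 1).
      { rewrite <- (Rpower_O (Cmod v)) at 2 by lra; apply Rle_Rpower; lra. }
      apply Rle_trans with (/ (- (gam - 1)) * 2).
      * apply Rmult_le_compat_l; [left; apply Rinv_0_lt_compat; lra|lra].
      * replace (/ (- (gam - 1)) * 2) with (2 / (1 - gam)) by (field; lra); lra.
Qed.

(** * Divergence of the means *)

(* On the arc [0 <= t <= d] of the circle of radius [1 - h] the Cayley transform is at
   least [1 / (h + t)], whose integral [ln ((h + d) / h)] is unbounded as [h -> 0]. *)
Lemma cayley_lower h t : 0 < h -> 0 <= t -> h + t <= 1 ->
  / (h + t) <= Cmod (cayley (RtoC (1 - h) * eit t)%C).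
Proof.
  intros Hh Ht H1; set (z := (RtoC (1 - h) * eit t)%C).
  assert (Hz : unit_disk z) by (apply circle_in_disk; lra).
  assert (N := one_minus_neq_0 z Hz).
  (* [|1 - e^(i t)|^2 = 2 - 2 cos t = 4 sin^2 (t/2)], at most [t^2]. *)
  assert (E1 : Cmod (1 - eit t)%C <= t).
  { apply Rsqr_incr_0; [|apply Cmod_ge_0|exact Ht].
    rewrite !Rsqr_pow2, Cmod2_alt; unfold eit, Re, Im; simpl.
    assert (S := sin2_cos2 t); unfold Rsqr in S.
    assert (S2 := cos_2a_sin (t / 2)); replace (2 * (t / 2)) with t in S2 by field.
    assert (S3 : 0 <= sin (t / 2) <= t / 2).
    { split; [apply sin_ge_0; generalize PI2_1; lra|].
      destruct Ht as [Ht|<-]; [left; apply sin_lt_x; lra|].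
      replace (0 / 2) with 0 by field; rewrite sin_0; lra. }
    nra. }
  assert (E2 : Cmod (1 - z)%C <= h + t).
  { replace (1 - z)%C with (RtoC h + RtoC (1 - h) * (1 - eit t))%C
      by (unfold z; rewrite RtoC_minus; ring).
    apply Rle_trans with (1 := Cmod_triangle _ _).
    rewrite Cmod_mult, !Cmod_R, !Rabs_pos_eq by lra.
    generalize (Cmod_ge_0 (1 - eit t)%C); nra. }
  assert (E3 : 1 <= Cmod (1 + z)%C).
  { assert (A := Cmod_reverse 2 (1 - z)%C).
    replace (2 - (1 - z))%C with (1 + z)%C in A by (apply injective_projections; simpl; ring).
    rewrite Cmod_R, Rabs_pos_eq in A by lra; lra. }
  unfold cayley; rewrite Cmod_div by exact N; apply Cmod_gt_0 in N.
  apply Rle_trans with (/ Cmod (1 - z)%C); [apply Rinv_le_contravar; assumption|].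
  rewrite <- (Rmult_1_l (/ _)); apply Rmult_le_compat_r; [left; apply Rinv_0_lt_compat, N|exact E3].
Qed.

(** Where [|cayley| >= W >= 1], the condition [k * p >= 1] gives [|f|^p >= c^p |cayley|]. On a fixed
    arc the mean is therefore at least [c^p] times the divergent logarithm. *)
Lemma not_mean_bdd f c W k p : hol f -> 0 < c -> 1 <= W -> 0 < p -> 1 <= k * p ->
  (forall z, unit_disk z -> W <= Cmod (cayley z) -> c * Rpower (Cmod (cayley z)) k <= Cmod (f z)) ->
  ~ mean_bdd (fun z => pow_nonneg (Cmod (f z)) p).
Proof.
  intros Hf Hc HW Hp Hkp Hlow [HC [M HM]].
  set (cp := Rpower c p); assert (Hcp : 0 < cp) by apply exp_pos.
  (* With [h <= d], every point of the arc has [h + t <= 2 d = 1 / W], so [|cayley| >= W] there. *)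
  set (d := / (2 * W)).
  assert (Hd : 0 < d) by (apply Rinv_0_lt_compat; lra).
  assert (HdW : d * (2 * W) = 1) by (apply Rinv_l; lra).
  assert (Hd1 : d <= 1 / 2) by nra.
  set (X := Rabs M / cp + 1).
  assert (HX : 0 < X).
  { assert (0 <= Rabs M / cp) by (apply Rmult_le_pos; [apply Rabs_pos|left; apply Rinv_0_lt_compat, Hcp]).
    unfold X; lra. }
  (* Then [ln ((h + d) / h) >= X], and [cp * X = |M| + cp] exceeds the supposed bound [M]. *)
  set (h := d * exp (- X)).
  assert (Hex : 0 < exp (- X) < 1) by (split; [apply exp_pos|rewrite <- exp_0; apply exp_increasing; lra]).
  assert (Hh : 0 < h) by (apply Rmult_lt_0_compat; lra).
  assert (Hhd : h <= d) by (unfold h; nra).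
  assert (Hr : 0 <= 1 - h < 1) by lra.
  specialize (HM (1 - h) Hr).
  set (F := fun t => pow_nonneg (Cmod (f (RtoC (1 - h) * eit t)%C)) p) in HM.
  assert (HF : forall a b, ex_RInt F a b).
  { intros a b; apply (circ_cont_ex (fun z => pow_nonneg (Cmod (f z)) p)); assumption. }
  assert (Hd2 : d <= 2 * PI) by (generalize PI2_1; lra).
  assert (E : @eq R (RInt F 0 d + RInt F d (2 * PI)) (RInt F 0 (2 * PI))).
  { apply (RInt_Chasles (V := R_CompleteNormedModule)); apply HF. }
  assert (E2 : 0 <= RInt F d (2 * PI)) by (apply RInt_ge_0; [exact Hd2|apply HF|intros; apply pow_nonneg_ge_0]).
  assert (HI : is_RInt (fun t => cp * / (h + t)) 0 d (cp * ln (h + d) - cp * ln (h + 0))).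
  { apply (is_RInt_derive (fun t => cp * ln (h + t)) (fun t => cp * / (h + t))).
    - intros t Ht; rewrite Rmin_left, Rmax_right in Ht by lra.
      auto_derive; [lra|field; lra].
    - intros t Ht; rewrite Rmin_left, Rmax_right in Ht by lra.
      apply continuity_pt_filterlim, derivable_continuous_pt.
      exists (- cp / (h + t) ^ 2); apply is_derive_Reals; auto_derive; [lra|field; lra]. }
  assert (E3 : cp * ln (h + d) - cp * ln (h + 0) <= RInt F 0 d).
  { rewrite <- (is_RInt_unique _ _ _ _ HI); apply RInt_le; [lra|eexists; exact HI|apply HF|].
    intros t Ht; unfold F; set (z := (RtoC (1 - h) * eit t)%C).
    assert (Hz : unit_disk z) by (apply circle_in_disk; lra).
    assert (L := cayley_lower h t Hh ltac:(lra) ltac:(lra)); fold z in L.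
    set (x := Cmod (cayley z)) in *.
    assert (HxW : W <= x).
    { apply Rle_trans with (2 := L); rewrite <- (Rinv_inv W); apply Rinv_le_contravar; [lra|].
      apply Rle_trans with (2 * d); [lra|]; right; unfold d; field; lra. }
    assert (Hx1 : 1 <= x) by lra.
    assert (A := Hlow z Hz HxW); fold x in A.
    assert (Hpos : 0 < c * Rpower x k) by (apply Rmult_lt_0_compat; [exact Hc|apply exp_pos]).
    apply Rle_trans with (cp * x); [apply Rmult_le_compat_l; lra|].
    apply Rle_trans with (pow_nonneg (c * Rpower x k) p); [|apply pow_nonneg_le; lra].
    rewrite pow_nonneg_pos, <- Rpower_mult_distr, Rpower_mult by (try assumption; apply exp_pos).
    apply Rmult_le_compat_l; [left; exact Hcp|].
    rewrite <- (Rpower_1 x) at 1 by lra; apply Rle_Rpower; assumption. }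
  assert (E4 : X <= ln (h + d) - ln (h + 0)).
  { rewrite Rplus_0_r; unfold h at 2; rewrite ln_mult, ln_exp by lra.
    assert (ln d <= ln (h + d)) by (apply ln_le; lra); lra. }
  assert (E5 : cp * X <= M).
  { apply Rle_trans with (cp * (ln (h + d) - ln (h + 0))); [apply Rmult_le_compat_l; lra|lra]. }
  assert (E6 : cp * X = Rabs M + cp) by (unfold X; field; lra).
  generalize (Rle_abs M); lra.
Qed.

(** * The extremal family *)

Section Family.
Variables (gam s : R).
Hypothesis Hgam : 0 < gam <= 1.
Hypothesis Hs : 0 < s <= 1.

(** With [v = cayley z], both [f] and the sector map are functions of [v]: as
    [wedge' = v^(gam-1) cayley' / 2], the product [(s v + (1-s)/v) wedge'] is [F'(v) cayley'], and
    [F] is its explicit primitive. Since [cayley' = (v + 1)^2 / 2], the orders of growth are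
    [gam + 2] for [f'] and [gam + 1] for [f]. *)
Lemma extremal_family : exists f : C -> C, exists a : nat -> C,
  class_K f /\ normalized_expansion f a /\ a 2%nat = RtoC (gam + 2 * s - 1) /\
  (forall p, 0 < p -> 1 <= (gam + 2) * p -> ~ hardy p (C_derive f)) /\
  (forall q, 0 < q -> 1 <= (gam + 1) * q -> ~ hardy q f).
Proof.
  destruct (cpow_primitive gam Hgam) as [L [K [L_1 [HK [HL HLb]]]]].
  assert (N2 : RtoC 2 <> 0) by (apply RtoC_neq_0; lra).
  assert (Ng : RtoC (gam + 1) <> 0) by (apply RtoC_neq_0; lra).
  set (F := fun v => (/ 2 * (RtoC (s / (gam + 1)) * (cpow v (gam + 1) - 1) + RtoC (1 - s) * L v))%C).
  set (F' := fun v => (/ 2 * (RtoC s * cpow v gam + RtoC (1 - s) * cpow v (gam - 2)))%C).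
  assert (HF : forall v, 0 < Re v -> cder F v (F' v)).
  { intros v Hv; apply der_eq with (/ 2 * (RtoC (s / (gam + 1)) * (RtoC (gam + 1) * cpow v (gam + 1 - 1) - 0)
      + RtoC (1 - s) * cpow v (gam - 2)))%C.
    - apply der_scal, der_plus; [|apply der_scal, HL, Hv].
      apply der_scal, der_minus; [apply cder_cpow, Hv|apply der_const].
    - unfold F'; replace (gam + 1 - 1) with gam by ring.
      rewrite RtoC_div by lra; field; repeat split; assumption. }
  assert (CF' : forall v, 0 < Re v -> ccont F' v).
  { intros v Hv; apply cont_mult; [apply cont_const|].
    apply cont_plus; apply cont_mult; try apply cont_const; exact (der_cont _ _ _ _ (cder_cpow v _ Hv)). }
  set (f := fun z => F (cayley z)).
  set (f' := fun z => (F' (cayley z) * (2 / ((1 - z) * (1 - z))))%C).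
  assert (Hf : hol f).
  { apply (hol_comp_image F F' cayley hol_cayley); intros z Hz.
    split; [apply HF|apply CF']; apply Re_cayley, Hz. }
  assert (Df : forall z, unit_disk z -> C_derive f z = f' z).
  { intros z Hz; apply cder_C_derive, (der_comp idC F cayley); [apply cder_cayley, Hz|].
    apply HF, Re_cayley, Hz. }
  assert (F'_1 : F' 1 = (/ 2)%C).
  { unfold F'; rewrite !cpow_one_l, RtoC_minus; ring. }
  assert (f_0 : f 0 = 0) by (unfold f, F; rewrite cayley_0, cpow_one_l, L_1; ring).
  assert (f_1 : C_derive f 0 = 1).
  { rewrite (Df 0 unit_disk_0); unfold f'; rewrite cayley_0, F'_1.
    replace (1 - 0)%C with (RtoC 1) by ring; field; exact N2. }
  assert (f_2 : C_derive (C_derive f) 0 = (2 * RtoC (gam + 2 * s - 1))%C).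
  { apply cder_C_derive; apply der_ext_loc with f' 1; [lra| |].
    { intros w Hw; symmetry; apply Df; unfold unit_disk, idC in *.
      replace (w - 0)%C with w in Hw by ring; exact Hw. }
    set (dF' := (/ 2 * (RtoC s * (RtoC gam * cpow 1 (gam - 1))
      + RtoC (1 - s) * (RtoC (gam - 2) * cpow 1 (gam - 2 - 1))))%C).
    assert (D1 : cder F' 1 dF').
    { assert (H1 : 0 < Re 1) by (rewrite re_RtoC; lra).
      apply der_scal, der_plus; apply der_scal; apply cder_cpow, H1. }
    assert (D2 : cder (fun z => F' (cayley z)) 0 (dF' * (2 / ((1 - 0) * (1 - 0))))%C).
    { apply (der_comp idC F' cayley); [apply cder_cayley, unit_disk_0|rewrite cayley_0; exact D1]. }
    assert (Hu : forall z, cder (fun z => 1 - z)%C z (0 - 1)%C).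
    { intros z; apply der_minus; [apply der_const|apply (der_pos idC)]. }
    assert (E1 : ((1 - 0) * (1 - 0))%C = RtoC 1) by ring.
    assert (D3 : cder (fun z => 2 / ((1 - z) * (1 - z)))%C 0
      ((0 * ((1 - 0) * (1 - 0)) - 2 * ((0 - 1) * (1 - 0) + (1 - 0) * (0 - 1)))
        / (((1 - 0) * (1 - 0)) * ((1 - 0) * (1 - 0))))%C).
    { apply (der_div idC (fun _ => RtoC 2) (fun z => (1 - z) * (1 - z))%C); [apply der_const| |].
      - apply (der_mult idC (fun z => 1 - z)%C (fun z => 1 - z)%C); apply Hu.
      - rewrite E1; apply C1_nz. }
    apply der_eq with (1 := der_mult idC _ _ _ _ _ D2 D3).
    rewrite cayley_0, F'_1, E1; unfold dF'; rewrite !cpow_one_l.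
    rewrite !RtoC_minus, !RtoC_plus, !RtoC_mult; field. }
  assert (HKf : class_K f).
  { apply class_K_intro with (wedge gam); try assumption; [apply convex_fun_wedge, Hgam|].
    intros z Hz; assert (Hv := Re_cayley z Hz); assert (N := one_minus_neq_0 z Hz).
    rewrite (Df z Hz), (cder_C_derive _ _ _ (cder_wedge gam z (proj1 Hgam) Hz)); unfold f', F'.
    set (v := cayley z) in *; assert (Nv := Re_pos_neq_0 v Hv).
    assert (Nc := cpow_neq_0 v (gam - 1)).
    assert (E1 : cpow v gam = (cpow v (gam - 1) * v)%C).
    { rewrite <- (cpow_1 v Hv) at 3; rewrite <- cpow_plus; f_equal; ring. }
    assert (E2 : (cpow v (gam - 2) * v)%C = cpow v (gam - 1)).
    { rewrite <- (cpow_1 v Hv) at 2; rewrite <- cpow_plus; f_equal; ring. }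
    assert (E3 : cpow v (gam - 2) = (cpow v (gam - 1) / v)%C) by (rewrite <- E2; field; exact Nv).
    rewrite E1, E3.
    match goal with |- 0 < Re ?x => replace x with (RtoC s * v + RtoC (1 - s) * / v)%C end.
    - rewrite re_plus, !re_scal_l; assert (A := Re_inv_pos v Hv).
      assert (0 < s * Re v) by (apply Rmult_lt_0_compat; lra).
      assert (0 <= (1 - s) * Re (/ v)%C) by (apply Rmult_le_pos; lra); lra.
    - field; repeat split; assumption. }
  (* For [|v| >= 2 / s] the term in [v^(gam-2)] is at most half of the one in [v^gam]; the constant
     [s/8] is [1/2 * s/2 * 1/2]. *)
  assert (Hlow' : forall z, unit_disk z -> 2 / s <= Cmod (cayley z) ->
    s / 8 * Rpower (Cmod (cayley z)) (gam + 2) <= Cmod (C_derive f z)).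
  { intros z Hz Hx; rewrite (Df z Hz); unfold f'.
    assert (Hv := Re_cayley z Hz); assert (N := one_minus_neq_0 z Hz).
    replace (2 / ((1 - z) * (1 - z)))%C with (/ 2 * ((cayley z + 1) * (cayley z + 1)))%C
      by (unfold cayley; field; auto).
    set (v := cayley z) in *; set (x := Cmod v) in *.
    assert (Hs2 : 2 <= 2 / s).
    { apply Rmult_le_reg_r with s; [lra|]; unfold Rdiv; rewrite Rmult_assoc, Rinv_l; lra. }
    assert (Hxs : 2 <= s * x).
    { apply Rmult_le_compat_l with (r := s) in Hx; [|lra].
      replace (s * (2 / s)) with 2 in Hx by (field; lra); exact Hx. }
    assert (A1 : x <= Cmod (v + 1)%C) by (apply Cmod_plus_1; lra).
    assert (Rx : 0 < Rpower x gam) by apply exp_pos.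
    assert (EP : Rpower x (gam + 2) = Rpower x gam * (x * x)).
    { rewrite Rpower_plus; f_equal; replace 2 with (1 + 1) by ring; rewrite Rpower_plus, Rpower_1 by lra; ring. }
    assert (EQ : Rpower x (gam - 2) * (x * x) = Rpower x gam).
    { replace gam with (gam - 2 + 2) at 2 by ring; rewrite Rpower_plus; f_equal.
      replace 2 with (1 + 1) by ring; rewrite Rpower_plus, Rpower_1 by lra; ring. }
    assert (A2 : s / 2 * Rpower x gam <= Cmod (RtoC s * cpow v gam + RtoC (1 - s) * cpow v (gam - 2))%C).
    { assert (B := Cmod_reverse (RtoC s * cpow v gam) (- (RtoC (1 - s) * cpow v (gam - 2)))%C).
      replace (RtoC s * cpow v gam - - (RtoC (1 - s) * cpow v (gam - 2)))%C
        with (RtoC s * cpow v gam + RtoC (1 - s) * cpow v (gam - 2))%C in B by ring.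
      rewrite Cmod_opp, !Cmod_mult, !Cmod_cpow, !Cmod_R, !Rabs_pos_eq in B by lra; fold x in B.
      assert (R2 : 0 < Rpower x (gam - 2)) by apply exp_pos.
      assert (B2 : Rpower x (gam - 2) <= s / 2 * Rpower x gam).
      { rewrite <- EQ; assert (1 <= s / 2 * (x * x)) by nra; nra. }
      assert (B3 : (1 - s) * Rpower x (gam - 2) <= Rpower x (gam - 2)) by nra.
      lra. }
    unfold F'; rewrite !Cmod_mult, Cmod_inv, Cmod_R, Rabs_pos_eq by (lra || exact N2).
    rewrite EP.
    apply Rle_trans with (/ 2 * (s / 2 * Rpower x gam) * (/ 2 * (x * x))); [right; field|].
    apply Rmult_le_compat.
    - apply Rmult_le_pos; [lra|apply Rmult_le_pos; lra].
    - assert (0 <= x * x) by nra; lra.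
    - lra.
    - assert (x * x <= Cmod (v + 1)%C * Cmod (v + 1)%C) by (apply Rmult_le_compat; lra); lra. }
  (* Chosen so that [x^gam >= Y] lets half of the leading term [s/2 * x^(gam+1)] absorb
     [s/2 + K + x], the contribution of the constants and of the primitive [L]. *)
  set (Y := 4 / s * (s / 2 + K + 1)).
  assert (HY : 0 < Y) by (apply Rmult_lt_0_compat; [apply Rdiv_lt_0_compat|]; lra).
  set (W := Rmax 1 (Rpower Y (/ gam))).
  assert (Hlow : forall z, unit_disk z -> W <= Cmod (cayley z) ->
    s / 8 * Rpower (Cmod (cayley z)) (gam + 1) <= Cmod (f z)).
  { intros z Hz Hx; unfold f, F.
    assert (Hv := Re_cayley z Hz); set (v := cayley z) in *; set (x := Cmod v) in *.
    assert (Hx1 : 1 <= x) by (apply Rle_trans with (2 := Hx), Rmax_l).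
    assert (HxY : Rpower Y (/ gam) <= x) by (apply Rle_trans with (2 := Hx), Rmax_r).
    assert (HG : Y <= Rpower x gam).
    { apply Rle_trans with (Rpower (Rpower Y (/ gam)) gam).
      - rewrite Rpower_mult, Rinv_l, Rpower_1 by lra; lra.
      - apply Rle_Rpower_l; [lra|split; [apply exp_pos|exact HxY]]. }
    assert (EP : Rpower x (gam + 1) = Rpower x gam * x) by (rewrite Rpower_plus, Rpower_1 by lra; reflexivity).
    rewrite Cmod_mult, Cmod_inv, Cmod_R, Rabs_pos_eq by (lra || exact N2).
    set (T := cpow v (gam + 1)).
    assert (HT : Cmod T = Rpower x (gam + 1)) by apply Cmod_cpow.
    assert (B := Cmod_reverse (RtoC (s / (gam + 1)) * (T - 1)) (- (RtoC (1 - s) * L v))%C).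
    replace (RtoC (s / (gam + 1)) * (T - 1) - - (RtoC (1 - s) * L v))%C
      with (RtoC (s / (gam + 1)) * (T - 1) + RtoC (1 - s) * L v)%C in B by ring.
    assert (Hsg : s / 2 <= s / (gam + 1)).
    { apply Rmult_le_compat_l; [lra|apply Rinv_le_contravar; lra]. }
    rewrite Cmod_opp, !Cmod_mult, !Cmod_R, !Rabs_pos_eq in B by lra.
    assert (B1 := Cmod_reverse T 1); rewrite Cmod_1, HT in B1.
    assert (B2 := HLb v Hv Hx1); fold x in B2.
    assert (B3 : (1 - s) * Cmod (L v) <= K + x) by (generalize (Cmod_ge_0 (L v)); nra).
    assert (Hlarge : s / 4 * Rpower x (gam + 1) >= s / 2 + K + x).
    { rewrite EP.
      assert (Q : s / 4 * Y = s / 2 + K + 1) by (unfold Y; field; lra).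
      assert (s / 4 * Y * x <= s / 4 * (Rpower x gam * x)).
      { rewrite <- (Rmult_assoc (s / 4) (Rpower x gam)); apply Rmult_le_compat_r; [lra|].
        apply Rmult_le_compat_l; lra. }
      nra. }
    assert (B4 : s / 2 * (Rpower x (gam + 1) - 1) <= s / (gam + 1) * Cmod (T - 1)%C).
    { apply Rle_trans with (s / 2 * Cmod (T - 1)%C); [apply Rmult_le_compat_l; lra|].
      apply Rmult_le_compat_r; [apply Cmod_ge_0|exact Hsg]. }
    lra. }
  exists f, (taylor_coef f); split; [exact HKf|split; [apply normalized_expansion_intro; assumption|split; [|split]]].
  - assert (E := expansion_2 _ f (hol_expansion f Hf)); rewrite f_2 in E.
    transitivity (/ 2 * (2 * taylor_coef f 2))%C; [field; exact N2|].
    rewrite <- E; field; exact N2.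
  - intros p Hp Hk HH.
    assert (Hf2 := hol_C_derive f Hf).
    apply (not_mean_bdd (C_derive f) (s / 8) (2 / s) (gam + 2) p Hf2); try lra.
    + apply Rmult_le_reg_r with s; [lra|]; unfold Rdiv; rewrite Rmult_assoc, Rinv_l; lra.
    + exact Hlow'.
    + apply hardy_mean_bdd; assumption.
  - intros q Hq Hk HH.
    apply (not_mean_bdd f (s / 8) W (gam + 1) q Hf); try lra.
    + apply Rmax_l.
    + exact Hlow.
    + apply hardy_mean_bdd; assumption.
Qed.

End Family.

Theorem theorem8 :
  (forall (f : C -> C) (a : nat -> C),
     class_K f -> normalized_expansion f a ->
     (a 2%nat = RtoC 0 ->
        hardy (1 / 3) (C_derive f) /\ hardy (1 / 2) f) /\
     (a 2%nat <> RtoC 0 ->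
        (forall p : R, 0 < p < 1 / 3 -> hardy p (C_derive f)) /\
        (forall q : R, 0 < q < 1 / 2 -> hardy q f))) /\
  (forall p : R, 1 / 3 < p ->
     exists (f : C -> C) (a : nat -> C),
       class_K f /\ normalized_expansion f a /\ a 2%nat = RtoC 0 /\
       ~ hardy p (C_derive f)) /\
  (forall q : R, 1 / 2 < q ->
     exists (f : C -> C) (a : nat -> C),
       class_K f /\ normalized_expansion f a /\ a 2%nat = RtoC 0 /\
       ~ hardy q f) /\
  (forall alpha : R, 0 < alpha <= 2 ->
     (exists (f : C -> C) (a : nat -> C),
        class_K f /\ normalized_expansion f a /\ Cmod (a 2%nat) = alpha /\
        ~ hardy (1 / 3) (C_derive f)) /\
     (exists (f : C -> C) (a : nat -> C),
        class_K f /\ normalized_expansion f a /\ Cmod (a 2%nat) = alpha /\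
        ~ hardy (1 / 2) f)).
Proof.
  split; [exact close_to_convex_means|split; [|split]].
  (* [(gam + 2) * p >= 1] asks for [gam >= 1/p - 2], which is below 1 since [p > 1/3]; the maximum
     with 1/2 keeps [gam] positive for large [p]. Then [s = (1 - gam) / 2] is positive and makes
     [a_2] vanish. For [f] the same is done with the order [gam + 1]. *)
  - intros p Hp; set (gam := Rmax (1 / 2) (/ p - 2)).
    assert (Hi : / p < 3) by (replace 3 with (/ (1 / 3)) by field; apply Rinv_lt_contravar; lra).
    assert (H1 : gam < 1) by (apply Rmax_lub_lt; lra).
    assert (H2 : 1 / 2 <= gam) by apply Rmax_l.
    assert (H3 : / p - 2 <= gam) by apply Rmax_r.
    destruct (extremal_family gam ((1 - gam) / 2)) as [f [a [HK [Ha [Ha2 [Hf' _]]]]]]; try lra.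
    exists f, a; repeat (split; [assumption|]); split; [rewrite Ha2; f_equal; field|].
    apply Hf'; [lra|]; apply Rmult_le_reg_r with (/ p); [apply Rinv_0_lt_compat; lra|].
    rewrite Rmult_assoc, Rinv_r by lra; lra.
  - intros q Hq; set (gam := Rmax (1 / 2) (/ q - 1)).
    assert (Hi : / q < 2) by (replace 2 with (/ (1 / 2)) by field; apply Rinv_lt_contravar; lra).
    assert (H1 : gam < 1) by (apply Rmax_lub_lt; lra).
    assert (H2 : 1 / 2 <= gam) by apply Rmax_l.
    assert (H3 : / q - 1 <= gam) by apply Rmax_r.
    destruct (extremal_family gam ((1 - gam) / 2)) as [f [a [HK [Ha [Ha2 [_ Hf]]]]]]; try lra.
    exists f, a; repeat (split; [assumption|]); split; [rewrite Ha2; f_equal; field|].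
    apply Hf; [lra|]; apply Rmult_le_reg_r with (/ q); [apply Rinv_0_lt_compat; lra|].
    rewrite Rmult_assoc, Rinv_r by lra; lra.
  - intros alpha Hal.
    (* For [gam = 1] the coefficient is [2 s = alpha], and the orders 3 and 2 meet the exponents 1/3
       and 1/2 exactly. *)
    destruct (extremal_family 1 (alpha / 2)) as [f [a [HK [Ha [Ha2 [Hf' Hf]]]]]]; try lra.
    assert (Em : Cmod (a 2%nat) = alpha).
    { rewrite Ha2, Cmod_R, Rabs_pos_eq; lra. }
    split; exists f, a; repeat (split; [assumption|]); [apply Hf'|apply Hf]; lra.
Qed.
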